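(* Let $\lambda\in\mathbb C\setminus(-\infty,-\frac14)$ and let $g\in C(\partial\mathbb D)$ be a continuous complex-valued function. Then $h(z)=\boldsymbol\Pi_\lambda g(z)$ is the unique $\lambda$-harmonic function on $\mathbb D$ for which $$ \lim_{\mathbb D\ni z\to\xi}\frac{h(z)}{\Phi(z\,|\,\lambda)}=g(\xi)\qquad\text{for every }\xi\in\partial\mathbb D. $$
   Context: $\mathbb D=\{z=x+iy\in\mathbb C:|z|<1\}$ is the open unit disk, $\partial\mathbb D$ the unit circle, $d\xi$ the normalised Lebesgue measure on $\partial\mathbb D$. The hyperbolic Laplacian is $\mathfrak L=\frac{(1-|z|^2)^2}{4}(\partial_x^2+\partial_y^2)$; a function $h:\mathbb D\to\mathbb C$ is $\lambda$-harmonic if $\mathfrak Lh=\lambda h$. The Poisson kernel is $P(z,\xi)=\frac{1-|z|^2}{|\xi-z|^2}$. For $\lambda\in\mathbb C$, $s(\lambda)=\sqrt{\lambda+\frac14}$, where the square root of $re^{i\phi}$ ($r\ge0$, $\phi\in(-\pi,\pi]$) is $\sqrt r\,e^{i\phi/2}$, and $P(z,\xi\,|\,\lambda)=P(z,\xi)^{s(\lambda)+1/2}$. The spherical function is $\Phi(z\,|\,\lambda)=\int_{\partial\mathbb D}P(z,\xi\,|\,\lambda)\,d\xi$ (it has no zeroes in $\mathbb D$ for $\lambda\in\mathbb C\setminus(-\infty,-\frac14)$), and $\boldsymbol\Pi_\lambda g(z)=\int_{\partial\mathbb D}P(z,\xi\,|\,\lambda)\,g(\xi)\,d\xi$. *)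

(* Defs.v *)
From Stdlib Require Import Reals Lra.
From Coquelicot Require Import Coquelicot.

Open Scope R_scope.

Definition in_disk (z : C) : Prop := Cmod z < 1.
Definition on_circle (xi : C) : Prop := Cmod xi = 1.

Definition cis (t : R) : C := (cos t, sin t).
Definition Cexp (w : C) : C := (RtoC (exp (Re w)) * cis (Im w))%C.

(* Principal argument in (-PI, PI]; its value at 0 is irrelevant below. *)
Definition Carg (z : C) : R :=
  if Rle_dec 0 (Im z) then acos (Re z / Cmod z) else - acos (Re z / Cmod z).

Definition Csqrt (z : C) : C := (RtoC (sqrt (Cmod z)) * cis (Carg z / 2))%C.

Lemma Cmod_cis (t : R) : Cmod (cis t) = 1.
Proof.
unfold Cmod, cis; simpl.
replace (cos t * (cos t * 1) + sin t * (sin t * 1)) with (Rsqr (sin t) + Rsqr (cos t))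
  by (unfold Rsqr; ring).
now rewrite sin2_cos2, sqrt_1.
Qed.

Lemma Cmod_polar (r t : R) : 0 <= r -> Cmod (RtoC r * cis t) = r.
Proof.
intros Hr; rewrite Cmod_mult, Cmod_cis, Cmod_R, Rabs_pos_eq by easy; ring.
Qed.

Lemma Carg_polar (r t : R) : 0 < r -> - PI < t <= PI -> Carg (RtoC r * cis t) = t.
Proof.
intros Hr Ht; unfold Carg; rewrite Cmod_polar by lra.
rewrite im_scal_l, re_scal_l.
change (Im (cis t)) with (sin t); change (Re (cis t)) with (cos t).
replace (r * cos t / r) with (cos t) by (field; lra).
destruct (Rle_dec 0 (r * sin t)) as [H|H].
- apply acos_cos; split; [|lra].
  destruct (Rle_dec 0 t) as [|Hn]; [easy|exfalso].
  assert (Hs : 0 < sin (- t)) by (apply sin_gt_0; lra).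
  rewrite sin_neg in Hs; nra.
- assert (Htn : t < 0).
  { destruct (Rle_dec 0 t) as [Hp|Hn]; [exfalso|lra].
    apply H; apply Rmult_le_pos; [lra|apply sin_ge_0; lra]. }
  rewrite <- (cos_neg t), acos_cos by lra; ring.
Qed.

Lemma Csqrt_polar (r phi : R) : 0 <= r -> - PI < phi <= PI ->
  Csqrt (RtoC r * cis phi) = (RtoC (sqrt r) * cis (phi / 2))%C.
Proof.
intros Hr Hphi; unfold Csqrt; rewrite Cmod_polar by easy.
destruct Hr as [Hr|<-].
- now rewrite Carg_polar.
- rewrite sqrt_0; ring.
Qed.

(* Integral against normalised Lebesgue measure on the unit circle; only
   applied to integrands that are continuous on the circle. *)
Definition circle_int (f : C -> C) : C :=
  (RtoC (/ (2 * PI)) *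
   RInt (V := C_R_CompleteNormedModule) (fun t : R => f (cis t)) 0 (2 * PI))%C.

Definition spectral (lambda : C) : C := Csqrt (lambda + RtoC (1 / 4))%C.

Definition Poisson (z xi : C) : R := (1 - Cmod z ^ 2) / Cmod (xi - z)%C ^ 2.

(* P(z, xi) ^ (s(lambda) + 1/2), a complex power of a positive real. *)
Definition Poisson_pow (lambda z xi : C) : C :=
  Cexp ((spectral lambda + RtoC (1 / 2)) * RtoC (ln (Poisson z xi)))%C.

Definition spherical (lambda z : C) : C := circle_int (Poisson_pow lambda z).

Definition Poisson_transform (lambda : C) (g : C -> C) (z : C) : C :=
  circle_int (fun xi => Poisson_pow lambda z xi * g xi)%C.

Definition partial_x (h : C -> C) (z : C) : C :=
  (Derive (fun x : R => Re (h (x, Im z))) (Re z),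
   Derive (fun x : R => Im (h (x, Im z))) (Re z)).

Definition partial_y (h : C -> C) (z : C) : C :=
  (Derive (fun y : R => Re (h (Re z, y))) (Im z),
   Derive (fun y : R => Im (h (Re z, y))) (Im z)).

Definition C1_on_disk (h : C -> C) : Prop :=
  forall z : C, in_disk z ->
    ex_derive (V := C_R_NormedModule) (fun x : R => h (x, Im z)) (Re z) /\
    ex_derive (V := C_R_NormedModule) (fun y : R => h (Re z, y)) (Im z) /\
    continuous (partial_x h) z /\ continuous (partial_y h) z.

Definition C2_on_disk (h : C -> C) : Prop :=
  C1_on_disk h /\ C1_on_disk (partial_x h) /\ C1_on_disk (partial_y h).

Definition hyp_laplacian (h : C -> C) (z : C) : C :=
  (RtoC ((1 - Cmod z ^ 2) ^ 2 / 4) *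
   (partial_x (partial_x h) z + partial_y (partial_y h) z))%C.

Definition lambda_harmonic (lambda : C) (h : C -> C) : Prop :=
  C2_on_disk h /\
  forall z : C, in_disk z -> hyp_laplacian h z = (lambda * h z)%C.

Definition continuous_on_circle (g : C -> C) : Prop :=
  forall xi : C, on_circle xi ->
    filterlim g (within on_circle (locally xi)) (locally (g xi)).

Definition has_boundary_values (lambda : C) (h g : C -> C) : Prop :=
  forall xi : C, on_circle xi ->
    filterlim (fun z : C => h z / spherical lambda z)%C
      (within in_disk (locally xi)) (locally (g xi)).

(* Main.v *)
(** Write [P] for the Poisson kernel, [s = s(lambda)] and [a = s + 1/2], so that [a (a - 1) = lambda].

    Harmonicity: as a function of [z], [P^a] is an eigenfunction of the hyperbolic Laplacian with
    eigenvalue [a (a - 1)], and one may differentiate under the integral sign.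

    Boundary values: it must be shown that [P^a / Phi] is an approximate identity, the difficulty
    being that [P^a] oscillates when [s] is not real.  A change of variable by a disk automorphism
    gives [Phi(r) = (1 - r^2)^(1/2 - s) I(s - 1/2) / (2 pi)], where
    [I(B) = int |1 + r e^(it)|^(2B) dt].  The three-term recurrence between [I(B + 1)], [I(B)] and
    [I(B - 1)] loses its last term as [r -> 1], so a lower bound for [|I(B)|] near [r = 1], obvious
    when [Re B] is large compared with [Im B], descends from [B + 1] to [B] as long as
    [Re B > -1/2].  Hence [|Phi|] is comparable to the integral of [|P^a|].  The remaining case
    [s = 0] is real and elementary.

    Uniqueness: the [k]-th Fourier modes in the angle of two eigenfunctions solve the same ordinary
    differential equation, singular at [r = 0].  Their Wronskian vanishes at [0], hence everywhere,
    so they are proportional.  The [k]-th mode of the difference of two solutions is [o(Phi)] at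
    the boundary while that of the Poisson transform of [e^(ikt)] is equivalent to [2 pi Phi];
    so the former is zero. *)
Require Import Defs.
From Stdlib Require Import Reals ZArith Lra Lia ClassicalEpsilon.
From Coquelicot Require Import Coquelicot.

Open Scope R_scope.

(** * Continuity and derivatives of complex-valued functions *)

(** For complex [lambda] neither the kernel nor [Phi] has a sign, so a maximum principle for
    [h / Phi] is out of reach. This is what calls for a quantitative lower bound for [|Phi|], and
    for a uniqueness proof through Fourier modes.

    The recurrence expresses that an exact derivative integrates to zero over a period. Its
    coefficient [2 B + 1] vanishes at [B = - 1/2], that is at [s = 0], exactly where [I(B)] starts
    to diverge logarithmically; hence the bound on [Re B], and the separate treatment of [s = 0].
    The integral [I(B - 1)] may itself blow up, so the factor [(1 - r^2)^2] in front of it has to be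
    shown to win.

    For uniqueness, radii range over [(-1, 1)]: then [r = 0] is an interior point, and regularity
    there takes the place of an initial condition for the singular equation. The comparison solution
    with nonzero [k]-th mode comes from the existence half of the theorem, applied to [e^(ikt)].
    Equality of all modes gives equality of the functions because a continuous function with zero
    Fourier coefficients vanishes, which is proved with the kernels [(1 - cos t)^n]. *)

Lemma continuous_Rplus {U : UniformSpace} (f g : U -> R) (u : U) :
  continuous f u -> continuous g u -> continuous (fun v => f v + g v) u.
Proof. exact (continuous_plus (V := R_NormedModule) f g u). Qed.

Lemma continuous_Rminus {U : UniformSpace} (f g : U -> R) (u : U) :
  continuous f u -> continuous g u -> continuous (fun v => f v - g v) u.
Proof. exact (continuous_minus (V := R_NormedModule) f g u). Qed.

Lemma continuous_Ropp {U : UniformSpace} (f : U -> R) (u : U) :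
  continuous f u -> continuous (fun v => - f v) u.
Proof. exact (continuous_opp (V := R_NormedModule) f u). Qed.

Lemma continuous_Rmult {U : UniformSpace} (f g : U -> R) (u : U) :
  continuous f u -> continuous g u -> continuous (fun v => f v * g v) u.
Proof. exact (continuous_mult (K := R_AbsRing) f g u). Qed.

Lemma continuous_Rpow {U : UniformSpace} (f : U -> R) (n : nat) (u : U) :
  continuous f u -> continuous (fun v => f v ^ n) u.
Proof.
intros Hf; induction n as [|n IH]; simpl.
- apply continuous_const.
- now apply continuous_Rmult.
Qed.

Lemma continuous_Rinv_comp {U : UniformSpace} (f : U -> R) (u : U) :
  continuous f u -> f u <> 0 -> continuous (fun v => / f v) u.
Proof.
intros Hf H0; apply (continuous_comp f Rinv); [exact Hf|].
now apply continuous_Rinv.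
Qed.

Lemma continuous_Rdiv {U : UniformSpace} (f g : U -> R) (u : U) :
  continuous f u -> continuous g u -> g u <> 0 ->
  continuous (fun v => f v / g v) u.
Proof.
intros Hf Hg H0; apply continuous_Rmult; [exact Hf|].
now apply continuous_Rinv_comp.
Qed.

Lemma continuous_cos_comp {U : UniformSpace} (f : U -> R) (u : U) :
  continuous f u -> continuous (fun v => cos (f v)) u.
Proof.
intros Hf; apply (continuous_comp f cos); [exact Hf|apply continuous_cos].
Qed.

Lemma continuous_sin_comp {U : UniformSpace} (f : U -> R) (u : U) :
  continuous f u -> continuous (fun v => sin (f v)) u.
Proof.
intros Hf; apply (continuous_comp f sin); [exact Hf|apply continuous_sin].
Qed.

Lemma continuous_exp_comp {U : UniformSpace} (f : U -> R) (u : U) :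
  continuous f u -> continuous (fun v => exp (f v)) u.
Proof.
intros Hf; apply (continuous_comp f exp); [exact Hf|apply continuous_exp].
Qed.

Lemma continuous_ln_comp {U : UniformSpace} (f : U -> R) (u : U) :
  continuous f u -> 0 < f u -> continuous (fun v => ln (f v)) u.
Proof.
intros Hf H0; apply (continuous_comp f ln); [exact Hf|].
apply (ex_derive_continuous (V := R_NormedModule)); exists (/ f u).
now apply is_derive_ln.
Qed.

Lemma continuous_Re {U : UniformSpace} (f : U -> C) (u : U) :
  continuous f u -> continuous (fun v => Re (f v)) u.
Proof.
intros Hf; apply (continuous_comp f fst); [exact Hf|].
destruct (f u) as [a b]; apply (continuous_fst (U := R_UniformSpace) (V := R_UniformSpace)).
Qed.

Lemma continuous_Im {U : UniformSpace} (f : U -> C) (u : U) :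
  continuous f u -> continuous (fun v => Im (f v)) u.
Proof.
intros Hf; apply (continuous_comp f snd); [exact Hf|].
destruct (f u) as [a b]; apply (continuous_snd (U := R_UniformSpace) (V := R_UniformSpace)).
Qed.

Lemma continuous_pair_C {U : UniformSpace} (f g : U -> R) (u : U) :
  continuous f u -> continuous g u ->
  continuous (fun v => (f v, g v) : C) u.
Proof.
intros Hf Hg P [eps HP].
assert (H1 : locally u (fun v => ball (f u) eps (f v)))
  by exact (Hf (ball (f u) eps) (locally_ball (f u) eps)).
assert (H2 : locally u (fun v => ball (g u) eps (g v)))
  by exact (Hg (ball (g u) eps) (locally_ball (g u) eps)).
change (locally u (fun v => P (f v, g v))).
generalize (filter_and _ _ H1 H2); apply filter_imp.
intros v [H3 H4]; apply HP; now split.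
Qed.

Lemma continuous_C {U : UniformSpace} (f : U -> C) (u : U) :
  continuous (fun v => Re (f v)) u -> continuous (fun v => Im (f v)) u ->
  continuous f u.
Proof.
intros Hr Hi; apply continuous_ext with (fun v => (Re (f v), Im (f v))).
- intros v; now destruct (f v).
- now apply continuous_pair_C.
Qed.

Lemma continuous_Cplus {U : UniformSpace} (f g : U -> C) (u : U) :
  continuous f u -> continuous g u -> continuous (fun v => (f v + g v)%C) u.
Proof.
intros Hf Hg; apply continuous_C.
- exact (continuous_Rplus _ _ u (continuous_Re f u Hf) (continuous_Re g u Hg)).
- exact (continuous_Rplus _ _ u (continuous_Im f u Hf) (continuous_Im g u Hg)).
Qed.

Lemma continuous_Copp {U : UniformSpace} (f : U -> C) (u : U) :
  continuous f u -> continuous (fun v => (- f v)%C) u.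
Proof.
intros Hf; apply continuous_C.
- exact (continuous_Ropp _ u (continuous_Re f u Hf)).
- exact (continuous_Ropp _ u (continuous_Im f u Hf)).
Qed.

Lemma continuous_Cminus {U : UniformSpace} (f g : U -> C) (u : U) :
  continuous f u -> continuous g u -> continuous (fun v => (f v - g v)%C) u.
Proof.
intros Hf Hg; apply continuous_Cplus; [exact Hf|now apply continuous_Copp].
Qed.

Lemma continuous_Cmult {U : UniformSpace} (f g : U -> C) (u : U) :
  continuous f u -> continuous g u -> continuous (fun v => (f v * g v)%C) u.
Proof.
intros Hf Hg.
assert (H1 := continuous_Re f u Hf); assert (H2 := continuous_Im f u Hf).
assert (H3 := continuous_Re g u Hg); assert (H4 := continuous_Im g u Hg).
apply continuous_C.
- exact (continuous_Rminus _ _ u (continuous_Rmult _ _ u H1 H3) (continuous_Rmult _ _ u H2 H4)).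
- exact (continuous_Rplus _ _ u (continuous_Rmult _ _ u H1 H4) (continuous_Rmult _ _ u H2 H3)).
Qed.

Lemma continuous_RtoC {U : UniformSpace} (f : U -> R) (u : U) :
  continuous f u -> continuous (fun v => RtoC (f v)) u.
Proof. intros Hf; apply continuous_pair_C; [exact Hf|apply continuous_const]. Qed.

Lemma continuous_cis {U : UniformSpace} (f : U -> R) (u : U) :
  continuous f u -> continuous (fun v => cis (f v)) u.
Proof.
intros Hf; apply continuous_pair_C.
- now apply continuous_cos_comp.
- now apply continuous_sin_comp.
Qed.

Lemma continuous_Cexp {U : UniformSpace} (f : U -> C) (u : U) :
  continuous f u -> continuous (fun v => Cexp (f v)) u.
Proof.
intros Hf; apply continuous_Cmult.
- now apply continuous_RtoC, continuous_exp_comp, continuous_Re.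
- now apply continuous_cis, continuous_Im.
Qed.

Lemma continuous_Cmod {U : UniformSpace} (f : U -> C) (u : U) :
  continuous f u -> continuous (fun v => Cmod (f v)) u.
Proof.
intros Hf; apply (continuous_comp (fun v => Re (f v) ^ 2 + Im (f v) ^ 2) sqrt).
- apply continuous_Rplus.
  + now apply (continuous_Rpow (fun v => Re (f v))), continuous_Re.
  + now apply (continuous_Rpow (fun v => Im (f v))), continuous_Im.
- apply continuous_sqrt.
Qed.

Lemma continuous_Cpow {U : UniformSpace} (f : U -> C) (n : nat) (u : U) :
  continuous f u -> continuous (fun v => (f v ^ n)%C) u.
Proof.
intros Hf; induction n as [|n IH].
- apply continuous_const.
- apply continuous_ext with (fun v => (f v * f v ^ n)%C).
  + intros v; now rewrite Cpow_S.
  + now apply continuous_Cmult.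
Qed.

(** The goals that remain are the positivity of arguments of [ln] and the nonvanishing of
    denominators. The cases [Rplus ?c], [Rminus ?c], [Rmult ?c], [cos] and [sin] catch eta-reduced
    functions. *)
Ltac continuity_step :=
  match goal with
  | H : continuous ?f ?u |- continuous ?f ?u => exact H
  | |- continuous (fun _ => ?c) _ => apply continuous_const
  | |- continuous (fun v => v) _ => apply continuous_id
  | |- continuous cos _ => apply continuous_cos
  | |- continuous sin _ => apply continuous_sin
  | |- continuous (Rplus ?c) _ => apply (continuous_Rplus (fun _ => c) (fun v => v))
  | |- continuous (Rminus ?c) _ => apply (continuous_Rminus (fun _ => c) (fun v => v))
  | |- continuous (Rmult ?c) _ => apply (continuous_Rmult (fun _ => c) (fun v => v))
  | |- continuous (fun v => (_ + _)%R) _ => apply continuous_Rplus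
  | |- continuous (fun v => (_ - _)%R) _ => apply continuous_Rminus
  | |- continuous (fun v => (_ * _)%R) _ => apply continuous_Rmult
  | |- continuous (fun v => (_ / _)%R) _ => apply continuous_Rdiv
  | |- continuous (fun v => (- _)%R) _ => apply continuous_Ropp
  | |- continuous (fun v => (/ _)%R) _ => apply continuous_Rinv_comp
  | |- continuous (fun v => (_ ^ _)%R) _ => apply continuous_Rpow
  | |- continuous (fun v => cos _) _ => apply continuous_cos_comp
  | |- continuous (fun v => sin _) _ => apply continuous_sin_comp
  | |- continuous (fun v => exp _) _ => apply continuous_exp_comp
  | |- continuous (fun v => ln _) _ => apply continuous_ln_comp
  | |- continuous (fun v => Re _) _ => apply continuous_Re
  | |- continuous (fun v => Im _) _ => apply continuous_Im
  | |- continuous (fun v => Cmod _) _ => apply continuous_Cmod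
  | |- continuous (fun v => RtoC _) _ => apply continuous_RtoC
  | |- continuous (fun v => (_ + _)%C) _ => apply continuous_Cplus
  | |- continuous (fun v => (_ - _)%C) _ => apply continuous_Cminus
  | |- continuous (fun v => (- _)%C) _ => apply continuous_Copp
  | |- continuous (fun v => (_ * _)%C) _ => apply continuous_Cmult
  | |- continuous (fun v => cis _) _ => apply continuous_cis
  | |- continuous (fun v => Cexp _) _ => apply continuous_Cexp
  | |- continuous (fun v => (_, _)) _ => apply continuous_pair_C
  end.
Ltac continuity_tac := repeat continuity_step.

Notation is_derive_C := (is_derive (K := R_AbsRing) (V := C_R_NormedModule)).

Lemma is_derive_C_pair (f : R -> C) (x : R) (l : C) :
  is_derive (fun u => Re (f u)) x (Re l) ->
  is_derive (fun u => Im (f u)) x (Im l) -> is_derive_C f x l.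
Proof.
intros Hr Hi.
apply (is_derive_ext (V := C_R_NormedModule) (fun u => (Re (f u), Im (f u)))).
- intros u; now destruct (f u).
- assert (H := filterdiff_comp'_2 (K := R_AbsRing) (T := R_NormedModule)
    (U := R_NormedModule) (V := R_NormedModule) (W := C_R_NormedModule)
    (fun u => Re (f u)) (fun u => Im (f u)) (fun a b => (a, b)) x _ _
    (fun a b => (a, b)) Hr Hi).
  unfold is_derive; apply filterdiff_ext_lin with
    (fun y : R => (scal y (Re l), scal y (Im l)) : C).
  + apply H; apply filterdiff_ext with (fun u : R * R => u).
    * intros []; reflexivity.
    * eapply filterdiff_ext_lin; [apply filterdiff_id|].
      intros []; reflexivity.
  + intros y; now destruct l.
Qed.

Lemma is_derive_C_Re (f : R -> C) (x : R) (l : C) :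
  is_derive_C f x l -> is_derive (fun u => Re (f u)) x (Re l).
Proof.
intros H.
assert (H1 := filterdiff_comp' f (fst : C_R_NormedModule -> R_NormedModule) x _ fst H
  (filterdiff_linear _ is_linear_fst)).
eapply filterdiff_ext_lin; [exact H1|]; intros y; reflexivity.
Qed.

Lemma is_derive_C_Im (f : R -> C) (x : R) (l : C) :
  is_derive_C f x l -> is_derive (fun u => Im (f u)) x (Im l).
Proof.
intros H.
assert (H1 := filterdiff_comp' f (snd : C_R_NormedModule -> R_NormedModule) x _ snd H
  (filterdiff_linear _ is_linear_snd)).
eapply filterdiff_ext_lin; [exact H1|]; intros y; reflexivity.
Qed.

Lemma is_derive_C_continuous (f : R -> C) (x : R) (l : C) :
  is_derive_C f x l -> continuous f x.
Proof.
intros H; apply (ex_derive_continuous (V := C_R_NormedModule)); now exists l.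
Qed.

Lemma is_derive_Cplus (f g : R -> C) (x : R) (l m : C) :
  is_derive_C f x l -> is_derive_C g x m ->
  is_derive_C (fun u => (f u + g u)%C) x (l + m)%C.
Proof. exact (is_derive_plus (V := C_R_NormedModule) f g x l m). Qed.

Lemma is_derive_Cmult (f g : R -> C) (x : R) (l m : C) :
  is_derive_C f x l -> is_derive_C g x m ->
  is_derive_C (fun u => (f u * g u)%C) x (l * g x + f x * m)%C.
Proof.
intros Hf Hg.
assert (H1 := is_derive_C_Re _ _ _ Hf); assert (H2 := is_derive_C_Im _ _ _ Hf).
assert (H3 := is_derive_C_Re _ _ _ Hg); assert (H4 := is_derive_C_Im _ _ _ Hg).
assert (Hm : forall (p q : R -> R) (dp dq : R), is_derive p x dp -> is_derive q x dq ->
  is_derive (fun u => p u * q u) x (dp * q x + p x * dq)).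
{ intros p q dp dq Hp Hq; apply (is_derive_mult p q x dp dq Hp Hq); intros; apply Rmult_comm. }
apply is_derive_C_pair; simpl.
- evar_last.
  + exact (is_derive_minus (V := R_NormedModule) _ _ _ _ _
      (Hm _ _ _ _ H1 H3) (Hm _ _ _ _ H2 H4)).
  + unfold minus, plus, opp; simpl; unfold Re, Im; ring.
- evar_last.
  + exact (is_derive_plus (V := R_NormedModule) _ _ _ _ _
      (Hm _ _ _ _ H1 H4) (Hm _ _ _ _ H2 H3)).
  + unfold plus; simpl; unfold Re, Im; ring.
Qed.

Lemma is_derive_C_const (c : C) (x : R) : is_derive_C (fun _ => c) x (RtoC 0).
Proof. exact (is_derive_const (V := C_R_NormedModule) c x). Qed.

Lemma is_derive_Cscal (c : C) (f : R -> C) (x : R) (l : C) :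
  is_derive_C f x l -> is_derive_C (fun u => (c * f u)%C) x (c * l)%C.
Proof.
intros Hf; evar_last.
- apply is_derive_Cmult; [apply is_derive_C_const|exact Hf].
- simpl; ring.
Qed.

Lemma is_derive_RtoC (f : R -> R) (x l : R) :
  is_derive f x l -> is_derive_C (fun u => RtoC (f u)) x (RtoC l).
Proof.
intros Hf; apply is_derive_C_pair; [exact Hf|].
exact (is_derive_const (V := R_NormedModule) 0 x).
Qed.

Lemma is_derive_cis (f : R -> R) (x l : R) :
  is_derive f x l ->
  is_derive_C (fun u => cis (f u)) x (Ci * RtoC l * cis (f x))%C.
Proof.
intros Hf; apply is_derive_C_pair; simpl; evar_last.
- exact (is_derive_comp cos f x _ _ (is_derive_cos (f x)) Hf).
- unfold scal; simpl; unfold mult; simpl; ring.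
- exact (is_derive_comp sin f x _ _ (is_derive_sin (f x)) Hf).
- unfold scal; simpl; unfold mult; simpl; ring.
Qed.

Lemma is_derive_Cexp (f : R -> C) (x : R) (l : C) :
  is_derive_C f x l -> is_derive_C (fun u => Cexp (f u)) x (l * Cexp (f x))%C.
Proof.
intros Hf.
assert (H1 := is_derive_C_Re _ _ _ Hf); assert (H2 := is_derive_C_Im _ _ _ Hf).
evar_last.
- apply is_derive_Cmult; [apply is_derive_RtoC|apply is_derive_cis; exact H2].
  apply (is_derive_comp exp); [apply is_derive_exp|exact H1].
- unfold Cexp, scal; simpl; unfold mult; simpl.
  destruct l as [a b]; destruct (f x) as [c d]; simpl.
  unfold Cplus, Cmult, RtoC, Ci; simpl; f_equal; ring.
Qed.

(** * Integrals of complex-valued functions *)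

Notation CInt := (RInt (V := C_R_CompleteNormedModule)).

(** Lemmas on [RInt] leave equalities in the carrier of a normed module, which is convertible to [C]
    but must be displayed as [C] for [ring]. *)
Ltac C_ring := match goal with |- @eq _ ?a ?b => change (@eq C a b); ring end.

Lemma ex_CInt (f : R -> C) (a b : R) :
  (forall t, continuous f t) -> ex_RInt (V := C_R_CompleteNormedModule) f a b.
Proof. intros Hf; apply (ex_RInt_continuous (V := C_R_CompleteNormedModule)); auto. Qed.

Lemma ex_RInt_continuous_R (f : R -> R) (a b : R) :
  (forall t, continuous f t) -> ex_RInt f a b.
Proof. intros Hf; apply (ex_RInt_continuous (V := R_CompleteNormedModule)); auto. Qed.

Lemma CInt_pair (f : R -> C) (a b : R) : (forall t, continuous f t) ->
  CInt f a b = (RInt (fun t => Re (f t)) a b, RInt (fun t => Im (f t)) a b).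
Proof.
intros Hf; symmetry.
apply (RInt_fct_extend_pair (U := R_NormedModule) (V := R_NormedModule)
  (RInt (V := R_CompleteNormedModule)) (RInt (V := R_CompleteNormedModule))
  (fun f a b l => is_RInt_unique f a b l) (fun f a b l => is_RInt_unique f a b l)).
apply (RInt_correct (V := C_R_CompleteNormedModule)), ex_CInt, Hf.
Qed.

Lemma CInt_ext (f g : R -> C) (a b : R) :
  (forall t, f t = g t) -> CInt f a b = CInt g a b.
Proof. intros H; apply RInt_ext; intros; apply H. Qed.

Lemma CInt_plus (f g : R -> C) (a b : R) :
  (forall t, continuous f t) -> (forall t, continuous g t) ->
  CInt (fun t => f t + g t)%C a b = (CInt f a b + CInt g a b)%C.
Proof.
intros Hf Hg; apply (RInt_plus (V := C_R_CompleteNormedModule)); now apply ex_CInt.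
Qed.

Lemma CInt_minus (f g : R -> C) (a b : R) :
  (forall t, continuous f t) -> (forall t, continuous g t) ->
  CInt (fun t => f t - g t)%C a b = (CInt f a b - CInt g a b)%C.
Proof.
intros Hf Hg; apply (RInt_minus (V := C_R_CompleteNormedModule)); now apply ex_CInt.
Qed.

(** [C] is here a module over [R], so linearity of the integral covers real scalars; a complex
    scalar is split into components. *)
Lemma CInt_scal (c : C) (f : R -> C) (a b : R) : (forall t, continuous f t) ->
  CInt (fun t => c * f t)%C a b = (c * CInt f a b)%C.
Proof.
intros Hf.
assert (Hr : forall t, continuous (fun t => Re (f t)) t) by (intros; now apply continuous_Re).
assert (Hi : forall t, continuous (fun t => Im (f t)) t) by (intros; now apply continuous_Im).
rewrite !CInt_pair; [|exact Hf|intros; apply continuous_Cmult;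
  [apply continuous_const|apply Hf]].
assert (Hs : forall (k : R) (h : R -> R), (forall t, continuous h t) ->
  is_RInt (fun t => k * h t) a b (k * RInt h a b)).
{ intros k h Hh; apply (is_RInt_scal (V := R_NormedModule)).
  now apply (RInt_correct (V := R_CompleteNormedModule)), ex_RInt_continuous_R. }
destruct c as [p q]; unfold Cmult; simpl; f_equal; apply is_RInt_unique.
- apply (is_RInt_minus (V := R_NormedModule) (fun t => p * Re (f t)) (fun t => q * Im (f t)));
    now apply Hs.
- apply (is_RInt_plus (V := R_NormedModule) (fun t => p * Im (f t)) (fun t => q * Re (f t)));
    now apply Hs.
Qed.

Lemma CInt_RtoC (f : R -> R) (a b : R) : (forall t, continuous f t) ->
  CInt (fun t => RtoC (f t)) a b = RtoC (RInt f a b).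
Proof.
intros Hf; rewrite CInt_pair; [|intros; now apply continuous_RtoC].
unfold RtoC; simpl; f_equal; rewrite RInt_const; apply Rmult_0_r.
Qed.

Lemma CInt_const (c : C) (a b : R) : CInt (fun _ => c) a b = (RtoC (b - a) * c)%C.
Proof.
rewrite CInt_pair by (intros; apply continuous_const).
rewrite !RInt_const; destruct c as [p q]; unfold scal, Cmult, RtoC; simpl.
unfold mult; simpl; f_equal; ring.
Qed.

Lemma Cmod_CInt_le (f : R -> C) (g : R -> R) (a b : R) : a <= b ->
  (forall t, continuous f t) -> (forall t, continuous g t) ->
  (forall t, a <= t <= b -> Cmod (f t) <= g t) ->
  Cmod (CInt f a b) <= RInt g a b.
Proof.
intros Hab Hf Hg H.
assert (Hn : forall z : C, norm (z : C_R_CompleteNormedModule) = Cmod z).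
{ intros z; unfold norm, Cmod; simpl; unfold prod_norm; f_equal.
  unfold norm; simpl; unfold abs; simpl; f_equal; rewrite !Rmult_1_r;
    [rewrite <- Rabs_mult|rewrite <- Rabs_mult]; apply Rabs_pos_eq; apply Rle_0_sqr. }
rewrite <- Hn.
apply (norm_RInt_le (V := C_R_CompleteNormedModule) f g a b); [exact Hab| | |].
- intros t Ht; rewrite Hn; now apply H.
- now apply (RInt_correct (V := C_R_CompleteNormedModule)), ex_CInt.
- now apply (RInt_correct (V := R_CompleteNormedModule)), ex_RInt_continuous_R.
Qed.

Lemma CInt_derive (f df : R -> C) (a b : R) :
  (forall t, is_derive_C f t (df t)) -> (forall t, continuous df t) ->
  CInt df a b = (f b - f a)%C.
Proof.
intros Hf Hd; apply is_RInt_unique.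
apply (is_RInt_derive (V := C_R_CompleteNormedModule)); auto.
Qed.

(** * Integrals depending on a parameter *)

Definition jointly_continuous {U : UniformSpace} (D : U -> Prop) (f : U -> R -> C) :=
  forall u t, D u -> continuous (fun p : U * R => f (fst p) (snd p)) (u, t).

Lemma jointly_continuous_snd {U : UniformSpace} (D : U -> Prop) (f : U -> R -> C) :
  jointly_continuous D f -> forall u t, D u -> continuous (f u) t.
Proof.
intros H u t Hu.
apply (continuous_comp (V := prod_UniformSpace U R_UniformSpace)
  (fun s => (u, s)) (fun p : U * R => f (fst p) (snd p)) t); [|now apply H].
intros P [eps HP]; exists eps; intros s Hs; apply HP; split; [apply ball_center|exact Hs].
Qed.

(** Balls of the product uniform structure are squares, whence a factor [sqrt 2], rounded up to [2].
    This factor explains the extra halvings of [eps] in the estimates below. *)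
Lemma ball_Cmod (x y : C) (eps : posreal) : ball x eps y -> Cmod (y - x)%C < 2 * eps.
Proof.
intros H; apply Rlt_le_trans with (sqrt 2 * eps).
- now apply C_NormedModule_mixin_compat2.
- apply Rmult_le_compat_r; [apply Rlt_le, cond_pos|].
  apply Rsqr_incr_0_var; [|lra]; rewrite Rsqr_sqrt; unfold Rsqr; lra.
Qed.

Lemma Cmod_ball (x y : C) (eps : posreal) : Cmod (y - x)%C < eps -> ball x eps y.
Proof. apply C_NormedModule_mixin_compat1. Qed.

(** Joint continuity gives a neighbourhood of [u] and an interval around each [t]; finitely many of
    these intervals cover [[a, b]], so [f v] is uniformly close to [f u] for [v] near [u]. *)
Lemma CInt_param_continuous {U : UniformSpace} (D : U -> Prop) (f : U -> R -> C)
    (a b : R) (u : U) :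
  a <= b -> locally u D -> jointly_continuous D f ->
  continuous (fun v => CInt (f v) a b) u.
Proof.
intros Hab HD Hf P [eps HP].
assert (Hu : D u) by now apply locally_singleton.
(* Two values are compared through a third one, each time with the factor [2] of [ball_Cmod], hence
   the [4]; the [+ 1] keeps the denominator positive when [a = b]. *)
assert (He : 0 < eps / (4 * (b - a + 1))).
{ apply Rdiv_lt_0_compat; [apply cond_pos|lra]. }
set (e := mkposreal _ He).
assert (Hd : forall t, exists d : posreal, forall v s, ball u d v -> ball t d s ->
  ball (f u t) e (f v s)).
{ intros t; destruct (Hf u t Hu _ (locally_ball (f u t) e)) as [d H].
  exists d; intros v s Hv Hs; apply (H (v, s)); now split. }
pose (delta t := proj1_sig (constructive_indefinite_description _ (Hd t))).
assert (Hdelta : forall t v s, ball u (delta t) v -> ball t (delta t) s ->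
  ball (f u t) e (f v s)).
{ intros t; exact (proj2_sig (constructive_indefinite_description _ (Hd t))). }
clearbody delta; clear Hd.
destruct (compactness_value_1d a b delta) as [d Hd].
destruct HD as [d' HD].
assert (Hm : 0 < Rmin d d') by (apply Rmin_pos; apply cond_pos).
exists (mkposreal _ Hm); intros v Hv; apply HP.
assert (Hvd : ball u d v) by (eapply ball_le; [|exact Hv]; apply Rmin_l).
assert (Hvd' : D v) by (apply HD; eapply ball_le; [|exact Hv]; apply Rmin_r).
apply Cmod_ball.
assert (Hcu := jointly_continuous_snd D f Hf).
rewrite <- CInt_minus by (intros; now apply Hcu).
apply Rle_lt_trans with (RInt (fun _ => 4 * e) a b).
- apply Cmod_CInt_le; [exact Hab| |intros; apply continuous_const|].
  + intros t; apply continuous_Cminus; now apply Hcu.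
  (* [compactness_value_1d] provides the covering point [t0] under a double negation only, so the
     inequality is proved by contradiction. *)
  + intros t Ht; apply Rnot_lt_le; intros Hlt; apply (Hd t Ht); intros [t0 (Ht0 & Htt & Hdt)].
    assert (H1 : ball (f u t0) e (f v t)).
    { apply Hdelta; [eapply ball_le; [exact Hdt|exact Hvd]|exact Htt]. }
    assert (H2 : ball (f u t0) e (f u t)).
    { apply Hdelta; [apply ball_center|exact Htt]. }
    apply ball_Cmod in H1; apply ball_Cmod in H2.
    assert (H3 := Cmod_triangle (f v t - f u t0) (- (f u t - f u t0))).
    rewrite Cmod_opp in H3.
    replace (f v t - f u t0 + - (f u t - f u t0))%C with (f v t - f u t)%C in H3 by ring.
    lra.
- rewrite RInt_const; unfold scal; simpl; unfold mult; simpl.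
  replace ((b - a) * (4 * (eps / (4 * (b - a + 1))))) with (eps * ((b - a) / (b - a + 1)))
    by (field; lra).
  assert (0 < eps) by apply cond_pos.
  assert ((b - a) / (b - a + 1) < 1) by (apply Rlt_div_l; lra).
  nra.
Qed.

Lemma continuity_2d_pt_continuous (f : R -> R -> R) (x t : R) :
  continuous (fun p : R * R => f (fst p) (snd p)) (x, t) -> continuity_2d_pt f x t.
Proof. intros H; now apply continuity_2d_pt_filterlim. Qed.

Lemma is_derive_RInt_param_continuous (D : R -> Prop) (f f' : R -> R -> R) (a b u : R) :
  locally u D ->
  (forall v t, D v -> continuous (f v) t) ->
  (forall v t, D v -> is_derive (fun w => f w t) v (f' v t)) ->
  (forall t, continuous (fun p : R * R => f' (fst p) (snd p)) (u, t)) ->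
  is_derive (fun v => RInt (f v) a b) u (RInt (f' u) a b).
Proof.
intros HD Hf Hd Hc.
assert (Hu : D u) by now apply locally_singleton.
rewrite (RInt_ext (f' u) (fun t => Derive (fun w => f w t) u)).
2:{ intros t _; symmetry; now apply is_derive_unique, Hd. }
apply (is_derive_RInt_param f).
- revert HD; apply filter_imp; intros v Hv t _; eexists; now apply Hd.
- intros t _; apply continuity_2d_pt_ext_loc with f'.
  + destruct HD as [d HD]; exists d; intros v s Hv _; symmetry.
    apply is_derive_unique, Hd, HD, Hv.
  + apply continuity_2d_pt_continuous, Hc.
- revert HD; apply filter_imp; intros v Hv; apply ex_RInt_continuous_R; intros; now apply Hf.
Qed.

Lemma is_derive_CInt_param (D : R -> Prop) (f f' : R -> R -> C) (a b u : R) :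
  locally u D ->
  (forall v t, D v -> continuous (f v) t) ->
  (forall v t, D v -> is_derive_C (fun w => f w t) v (f' v t)) ->
  jointly_continuous D f' ->
  is_derive_C (fun v => CInt (f v) a b) u (CInt (f' u) a b).
Proof.
intros HD Hf Hd Hc.
assert (Hu : D u) by now apply locally_singleton.
rewrite CInt_pair by (intros; now apply (jointly_continuous_snd D f' Hc)).
apply (is_derive_ext_loc (V := C_R_NormedModule)
  (fun v => (RInt (fun t => Re (f v t)) a b, RInt (fun t => Im (f v t)) a b) : C)).
{ revert HD; apply filter_imp; intros v Hv; symmetry; apply CInt_pair.
  intros; now apply Hf. }
apply is_derive_C_pair; simpl.
- apply (is_derive_RInt_param_continuous D (fun v t => Re (f v t)) (fun v t => Re (f' v t)));
    [exact HD| | |].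
  + intros v t Hv; now apply continuous_Re, Hf.
  + intros v t Hv; now apply (is_derive_C_Re (fun w => f w t)), Hd.
  + intros t; now apply (continuous_Re (U := prod_UniformSpace R_UniformSpace R_UniformSpace)
      (fun p => f' (fst p) (snd p))), Hc.
- apply (is_derive_RInt_param_continuous D (fun v t => Im (f v t)) (fun v t => Im (f' v t)));
    [exact HD| | |].
  + intros v t Hv; now apply continuous_Im, Hf.
  + intros v t Hv; now apply (is_derive_C_Im (fun w => f w t)), Hd.
  + intros t; now apply (continuous_Im (U := prod_UniformSpace R_UniformSpace R_UniformSpace)
      (fun p => f' (fst p) (snd p))), Hc.
Qed.

(** * Partial derivatives on the disk *)

Lemma in_disk_gap (z : C) : in_disk z <-> 0 < 1 - Re z ^ 2 - Im z ^ 2.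
Proof.
unfold in_disk; assert (H := Cmod2_alt z); assert (H0 := Cmod_ge_0 z); split; intros; nra.
Qed.

Lemma open_in_disk : open in_disk.
Proof.
apply open_ext with (fun z : C => Cmod z < 1); [reflexivity|].
apply (open_comp Cmod (fun r => r < 1)); [|apply open_lt].
intros z _; apply (continuous_Cmod (fun w => w)), continuous_id.
Qed.

Lemma locally_in_disk_x (z : C) : in_disk z -> locally (Re z) (fun x => in_disk (x, Im z)).
Proof.
intros Hz; assert (H : continuous (fun x : R => (x, Im z) : C) (Re z)).
{ apply continuous_pair_C; [apply continuous_id|apply continuous_const]. }
apply (H in_disk), open_in_disk; now rewrite <- surjective_pairing.
Qed.

Lemma locally_in_disk_y (z : C) : in_disk z -> locally (Im z) (fun y => in_disk (Re z, y)).
Proof.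
intros Hz; assert (H : continuous (fun y : R => (Re z, y) : C) (Im z)).
{ apply continuous_pair_C; [apply continuous_const|apply continuous_id]. }
apply (H in_disk), open_in_disk; now rewrite <- surjective_pairing.
Qed.

Lemma partial_x_eq (h : C -> C) (z l : C) :
  is_derive_C (fun x => h (x, Im z)) (Re z) l -> partial_x h z = l.
Proof.
intros H; unfold partial_x; rewrite (surjective_pairing l); f_equal; apply is_derive_unique.
- exact (is_derive_C_Re _ _ _ H).
- exact (is_derive_C_Im _ _ _ H).
Qed.

Lemma partial_y_eq (h : C -> C) (z l : C) :
  is_derive_C (fun y => h (Re z, y)) (Im z) l -> partial_y h z = l.
Proof.
intros H; unfold partial_y; rewrite (surjective_pairing l); f_equal; apply is_derive_unique.
- exact (is_derive_C_Re _ _ _ H).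
- exact (is_derive_C_Im _ _ _ H).
Qed.

Lemma C1_partial_x (h : C -> C) (z : C) : C1_on_disk h -> in_disk z ->
  is_derive_C (fun x => h (x, Im z)) (Re z) (partial_x h z).
Proof.
intros Hh Hz; destruct (Hh z Hz) as [[l Hl] _].
now rewrite (partial_x_eq h z l).
Qed.

Lemma C1_partial_y (h : C -> C) (z : C) : C1_on_disk h -> in_disk z ->
  is_derive_C (fun y => h (Re z, y)) (Im z) (partial_y h z).
Proof.
intros Hh Hz; destruct (Hh z Hz) as (_ & [l Hl] & _).
now rewrite (partial_y_eq h z l).
Qed.

Lemma C1_intro (h hx hy : C -> C) :
  (forall z, in_disk z -> is_derive_C (fun x => h (x, Im z)) (Re z) (hx z)) ->
  (forall z, in_disk z -> is_derive_C (fun y => h (Re z, y)) (Im z) (hy z)) ->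
  (forall z, in_disk z -> continuous hx z) ->
  (forall z, in_disk z -> continuous hy z) ->
  C1_on_disk h /\
  (forall z, in_disk z -> partial_x h z = hx z) /\
  (forall z, in_disk z -> partial_y h z = hy z).
Proof.
intros Hx Hy Hcx Hcy.
assert (Ex : forall z, in_disk z -> partial_x h z = hx z) by (intros; now apply partial_x_eq, Hx).
assert (Ey : forall z, in_disk z -> partial_y h z = hy z) by (intros; now apply partial_y_eq, Hy).
split; [|now split].
intros z Hz; split; [|split; [|split]].
- eexists; now apply Hx.
- eexists; now apply Hy.
- apply continuous_ext_loc with hx; [|now apply Hcx].
  generalize (open_in_disk z Hz); apply filter_imp; intros w Hw; symmetry; now apply Ex.
- apply continuous_ext_loc with hy; [|now apply Hcy].
  generalize (open_in_disk z Hz); apply filter_imp; intros w Hw; symmetry; now apply Ey.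
Qed.

(** The disk is open, so partial derivatives at its points see only values inside it. This lets a
    formula valid in the disk alone stand for the function. *)
Lemma C1_ext (h k : C -> C) : (forall z, in_disk z -> h z = k z) -> C1_on_disk h ->
  C1_on_disk k /\
  (forall z, in_disk z -> partial_x k z = partial_x h z) /\
  (forall z, in_disk z -> partial_y k z = partial_y h z).
Proof.
intros E Hh; apply C1_intro.
- intros z Hz; apply (is_derive_ext_loc (V := C_R_NormedModule) (fun x => h (x, Im z))).
  + generalize (locally_in_disk_x z Hz); apply filter_imp; intros; now apply E.
  + now apply C1_partial_x.
- intros z Hz; apply (is_derive_ext_loc (V := C_R_NormedModule) (fun y => h (Re z, y))).
  + generalize (locally_in_disk_y z Hz); apply filter_imp; intros; now apply E.
  + now apply C1_partial_y.
- intros z Hz; now destruct (Hh z Hz) as (_ & _ & H & _).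
- intros z Hz; now destruct (Hh z Hz) as (_ & _ & _ & H).
Qed.

(** [partial_x h] agrees with the candidate [hx] on the disk only, so second derivatives are
    computed on the candidates and transferred by [C1_ext]. *)
Lemma C2_intro (h hx hy hxx hxy hyx hyy : C -> C) :
  (forall z, in_disk z -> is_derive_C (fun x => h (x, Im z)) (Re z) (hx z)) ->
  (forall z, in_disk z -> is_derive_C (fun y => h (Re z, y)) (Im z) (hy z)) ->
  (forall z, in_disk z -> is_derive_C (fun x => hx (x, Im z)) (Re z) (hxx z)) ->
  (forall z, in_disk z -> is_derive_C (fun y => hx (Re z, y)) (Im z) (hxy z)) ->
  (forall z, in_disk z -> is_derive_C (fun x => hy (x, Im z)) (Re z) (hyx z)) ->
  (forall z, in_disk z -> is_derive_C (fun y => hy (Re z, y)) (Im z) (hyy z)) ->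
  (forall z, in_disk z -> continuous hx z /\ continuous hy z /\ continuous hxx z /\
     continuous hxy z /\ continuous hyx z /\ continuous hyy z) ->
  C2_on_disk h /\ forall z, in_disk z ->
    partial_x (partial_x h) z = hxx z /\ partial_y (partial_y h) z = hyy z.
Proof.
intros Hx Hy Hxx Hxy Hyx Hyy Hc.
assert (Cx : forall z, in_disk z -> continuous hx z) by (intros z Hz; exact (proj1 (Hc z Hz))).
assert (Cy : forall z, in_disk z -> continuous hy z)
  by (intros z Hz; exact (proj1 (proj2 (Hc z Hz)))).
destruct (C1_intro h hx hy Hx Hy Cx Cy) as (H1 & Ex & Ey).
destruct (C1_intro hx hxx hxy Hxx Hxy) as (H2 & Exx & _).
{ intros z Hz; exact (proj1 (proj2 (proj2 (Hc z Hz)))). }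
{ intros z Hz; exact (proj1 (proj2 (proj2 (proj2 (Hc z Hz))))). }
destruct (C1_intro hy hyx hyy Hyx Hyy) as (H3 & _ & Eyy).
{ intros z Hz; exact (proj1 (proj2 (proj2 (proj2 (proj2 (Hc z Hz)))))). }
{ intros z Hz; exact (proj2 (proj2 (proj2 (proj2 (proj2 (Hc z Hz)))))). }
destruct (C1_ext hx (partial_x h)) as (H4 & Fxx & _); [intros; now rewrite Ex|exact H2|].
destruct (C1_ext hy (partial_y h)) as (H5 & _ & Fyy); [intros; now rewrite Ey|exact H3|].
split; [now split|].
intros z Hz; now rewrite Fxx, Fyy, Exx, Eyy.
Qed.

(** * Powers of the Poisson kernel *)

Definition gap (z : C) : R := 1 - Re z ^ 2 - Im z ^ 2.
Definition chord_sq (z : C) (t : R) : R := (cos t - Re z) ^ 2 + (sin t - Im z) ^ 2.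
Definition log_Poisson (z : C) (t : R) : R := ln (gap z) - ln (chord_sq z t).

Lemma cos_sin_sq (t : R) : cos t ^ 2 + sin t ^ 2 = 1.
Proof. assert (H := sin2_cos2 t); unfold Rsqr in H; lra. Qed.

Lemma chord_sq_pos (z : C) (t : R) : in_disk z -> 0 < chord_sq z t.
Proof.
intros Hz; apply in_disk_gap in Hz; assert (H := cos_sin_sq t); unfold chord_sq.
destruct (Req_dec (cos t - Re z) 0) as [H1|H1].
- replace (cos t) with (Re z) in H |- * by lra; nra.
- assert (0 < (cos t - Re z) ^ 2) by (apply pow2_gt_0, H1).
  assert (0 <= (sin t - Im z) ^ 2) by apply pow2_ge_0; lra.
Qed.

Lemma Poisson_gap (z : C) (t : R) : Poisson z (cis t) = gap z / chord_sq z t.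
Proof.
unfold Poisson, gap, chord_sq; rewrite !Cmod2_alt; simpl; f_equal; ring.
Qed.

Lemma ln_Poisson (z : C) (t : R) : in_disk z -> ln (Poisson z (cis t)) = log_Poisson z t.
Proof.
intros Hz; rewrite Poisson_gap; apply ln_div; [now apply in_disk_gap|now apply chord_sq_pos].
Qed.

Definition log_Poisson_x (z : C) (t : R) : R :=
  - (2 * Re z) / gap z + 2 * (cos t - Re z) / chord_sq z t.
Definition log_Poisson_y (z : C) (t : R) : R :=
  - (2 * Im z) / gap z + 2 * (sin t - Im z) / chord_sq z t.
Definition log_Poisson_xx (z : C) (t : R) : R :=
  - 2 / gap z - 4 * Re z ^ 2 / gap z ^ 2 - 2 / chord_sq z t
  + 4 * (cos t - Re z) ^ 2 / chord_sq z t ^ 2.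
Definition log_Poisson_xy (z : C) (t : R) : R :=
  - (4 * Re z * Im z) / gap z ^ 2
  + 4 * (cos t - Re z) * (sin t - Im z) / chord_sq z t ^ 2.
Definition log_Poisson_yy (z : C) (t : R) : R :=
  - 2 / gap z - 4 * Im z ^ 2 / gap z ^ 2 - 2 / chord_sq z t
  + 4 * (sin t - Im z) ^ 2 / chord_sq z t ^ 2.

Lemma is_derive_log_Poisson (z : C) (t : R) : in_disk z ->
  is_derive (fun x => log_Poisson (x, Im z) t) (Re z) (log_Poisson_x z t) /\
  is_derive (fun y => log_Poisson (Re z, y) t) (Im z) (log_Poisson_y z t) /\
  is_derive (fun x => log_Poisson_x (x, Im z) t) (Re z) (log_Poisson_xx z t) /\
  is_derive (fun y => log_Poisson_x (Re z, y) t) (Im z) (log_Poisson_xy z t) /\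
  is_derive (fun x => log_Poisson_y (x, Im z) t) (Re z) (log_Poisson_xy z t) /\
  is_derive (fun y => log_Poisson_y (Re z, y) t) (Im z) (log_Poisson_yy z t).
Proof.
intros Hz; assert (HQ := chord_sq_pos z t Hz); apply in_disk_gap in Hz; fold (gap z) in Hz.
unfold log_Poisson, log_Poisson_x, log_Poisson_y, log_Poisson_xx, log_Poisson_xy,
  log_Poisson_yy, gap, chord_sq in *.
destruct z as [x y]; simpl in *.
refine (conj _ (conj _ (conj _ (conj _ (conj _ _))))); auto_derive.
all: repeat split; simpl in *; try lra; try (apply Rgt_not_eq; lra).
all: field; split; apply Rgt_not_eq; lra.
Qed.

Lemma continuous_log_Poisson (z : C) (t : R) : in_disk z ->
  let jc f := continuous (T := prod_UniformSpace C_UniformSpace R_UniformSpace)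
    (fun p : C * R => f (fst p) (snd p)) (z, t) in
  jc log_Poisson /\ jc log_Poisson_x /\ jc log_Poisson_y /\ jc log_Poisson_xx /\
  jc log_Poisson_xy /\ jc log_Poisson_yy.
Proof.
intros Hz jc.
assert (HQ := chord_sq_pos z t Hz); apply in_disk_gap in Hz; fold (gap z) in Hz.
assert (Hf : continuous (T := prod_UniformSpace C_UniformSpace R_UniformSpace)
  (fun p : C * R => fst p) (z, t)) by apply continuous_fst.
assert (Hs : continuous (T := prod_UniformSpace C_UniformSpace R_UniformSpace)
  (fun p : C * R => snd p) (z, t)) by apply continuous_snd.
assert (Hr : jc (fun w _ => Re w)) by (now apply (continuous_Re fst)).
assert (Hi : jc (fun w _ => Im w)) by (now apply (continuous_Im fst)).
assert (Hg : jc (fun w _ => gap w)).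
{ unfold jc, gap in *; continuity_tac. }
assert (Hc : jc chord_sq).
{ unfold jc, chord_sq in *; continuity_tac. }
assert (Hn : gap z <> 0 /\ chord_sq z t <> 0 /\ gap z ^ 2 <> 0 /\ chord_sq z t ^ 2 <> 0).
{ repeat split; try apply pow_nonzero; apply Rgt_not_eq; assumption. }
destruct Hn as (H1 & H2 & H3 & H4).
unfold jc, log_Poisson, log_Poisson_x, log_Poisson_y, log_Poisson_xx, log_Poisson_xy,
  log_Poisson_yy in *; repeat split; continuity_tac; assumption.
Qed.

Definition kernel (A : C) (z : C) (t : R) : C := Cexp (A * RtoC (log_Poisson z t))%C.

Lemma Poisson_pow_kernel (lambda z : C) (t : R) : in_disk z ->
  Poisson_pow lambda z (cis t) = kernel (spectral lambda + RtoC (1 / 2))%C z t.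
Proof. intros Hz; unfold Poisson_pow, kernel; now rewrite ln_Poisson. Qed.

(* First and second derivatives of [exp (A w)], where [w] has the partial derivatives
   [p], [q] and [pq]. *)
Definition kernel1 (A : C) (p : C -> R -> R) (z : C) (t : R) : C :=
  (A * RtoC (p z t) * kernel A z t)%C.
Definition kernel2 (A : C) (p q pq : C -> R -> R) (z : C) (t : R) : C :=
  ((A * RtoC (pq z t) + A * A * RtoC (p z t * q z t)) * kernel A z t)%C.

Lemma is_derive_kernel (A : C) (c : R -> C) (t u dw : R) :
  is_derive (fun v => log_Poisson (c v) t) u dw ->
  is_derive_C (fun v => kernel A (c v) t) u (A * RtoC dw * kernel A (c u) t)%C.
Proof. intros H; apply is_derive_Cexp, is_derive_Cscal, is_derive_RtoC, H. Qed.

Lemma is_derive_kernel1 (A : C) (p : C -> R -> R) (c : R -> C) (t u dw dp : R) :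
  is_derive (fun v => log_Poisson (c v) t) u dw ->
  is_derive (fun v => p (c v) t) u dp ->
  is_derive_C (fun v => kernel1 A p (c v) t) u
    ((A * RtoC dp + A * A * RtoC (p (c u) t * dw)) * kernel A (c u) t)%C.
Proof.
intros Hw Hp; evar_last.
- apply is_derive_Cmult; [apply is_derive_Cscal, is_derive_RtoC, Hp|].
  apply is_derive_kernel, Hw.
- simpl; rewrite RtoC_mult; ring.
Qed.

Lemma jointly_continuous_kernels (A : C) :
  let jc f := jointly_continuous (U := C_UniformSpace) in_disk f in
  jc (kernel A) /\
  jc (kernel1 A log_Poisson_x) /\ jc (kernel1 A log_Poisson_y) /\
  jc (kernel2 A log_Poisson_x log_Poisson_x log_Poisson_xx) /\
  jc (kernel2 A log_Poisson_x log_Poisson_y log_Poisson_xy) /\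
  jc (kernel2 A log_Poisson_y log_Poisson_x log_Poisson_xy) /\
  jc (kernel2 A log_Poisson_y log_Poisson_y log_Poisson_yy).
Proof.
intros jc.
assert (H0 : jc (kernel A)).
{ intros z t Hz; destruct (continuous_log_Poisson z t Hz) as (H1 & _).
  unfold kernel; continuity_tac. }
split; [exact H0|].
repeat split; intros z t Hz;
  destruct (continuous_log_Poisson z t Hz) as (H1 & H2 & H3 & H4 & H5 & H6);
  specialize (H0 z t Hz); unfold kernel1, kernel2; continuity_tac.
Qed.

(** With [w = ln P], these are the Laplacian and the squared gradient of [w]: [ln |e^(it) - z|^2] is
    harmonic, and [ln (1 - |z|^2)] has Laplacian [- 4 / gap^2]. *)
Lemma log_Poisson_laplacian (z : C) (t : R) : in_disk z ->
  log_Poisson_xx z t + log_Poisson_yy z t = - (4 / gap z ^ 2) /\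
  log_Poisson_x z t ^ 2 + log_Poisson_y z t ^ 2 = 4 / gap z ^ 2.
Proof.
intros Hz; assert (HQ := chord_sq_pos z t Hz); apply in_disk_gap in Hz; fold (gap z) in Hz.
assert (Hcs := cos_sin_sq t).
(* Since [|e^(it)| = 1], the inner product of [z] and [e^(it)] is a function of [gap] and
   [chord_sq], so both identities become rational in these two quantities. *)
assert (Es : chord_sq z t = 2 - gap z - 2 * (cos t * Re z + sin t * Im z)).
{ unfold chord_sq, gap; lra. }
unfold log_Poisson_xx, log_Poisson_yy, log_Poisson_x, log_Poisson_y; split.
- replace ((sin t - Im z) ^ 2) with (chord_sq z t - (cos t - Re z) ^ 2)
    by (unfold chord_sq; ring).
  replace (Im z ^ 2) with (1 - gap z - Re z ^ 2) by (unfold gap; ring).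
  field; lra.
- replace ((- (2 * Re z) / gap z + 2 * (cos t - Re z) / chord_sq z t) ^ 2 +
    (- (2 * Im z) / gap z + 2 * (sin t - Im z) / chord_sq z t) ^ 2)
    with (4 * (Re z ^ 2 + Im z ^ 2) / gap z ^ 2
      + 4 * ((cos t - Re z) ^ 2 + (sin t - Im z) ^ 2) / chord_sq z t ^ 2
      - 8 * ((cos t * Re z + sin t * Im z) - (Re z ^ 2 + Im z ^ 2)) / (gap z * chord_sq z t))
    by (field; lra).
  fold (chord_sq z t).
  replace (Re z ^ 2 + Im z ^ 2) with (1 - gap z) by (unfold gap; ring).
  replace (cos t * Re z + sin t * Im z) with ((2 - gap z - chord_sq z t) / 2) by lra.
  field; lra.
Qed.

(** The Laplacian of [exp (A w)] is [(A * Lap w + A^2 * |grad w|^2) * exp (A w)]; here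
    [Lap w = - |grad w|^2], which produces [A^2 - A]. *)
Lemma kernel_eigenfunction (A lambda z : C) (t : R) : in_disk z ->
  (A * (A - RtoC 1) = lambda)%C ->
  (RtoC (gap z ^ 2 / 4) *
    (kernel2 A log_Poisson_x log_Poisson_x log_Poisson_xx z t +
     kernel2 A log_Poisson_y log_Poisson_y log_Poisson_yy z t) = lambda * kernel A z t)%C.
Proof.
intros Hz HA; destruct (log_Poisson_laplacian z t Hz) as [H1 H2].
assert (Hg : gap z <> 0) by (apply Rgt_not_eq, in_disk_gap, Hz).
unfold kernel2.
transitivity ((A * RtoC (gap z ^ 2 / 4 * (log_Poisson_xx z t + log_Poisson_yy z t)) +
  A * A * RtoC (gap z ^ 2 / 4 * (log_Poisson_x z t ^ 2 + log_Poisson_y z t ^ 2))) *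
  kernel A z t)%C.
- replace (log_Poisson_x z t ^ 2) with (log_Poisson_x z t * log_Poisson_x z t) by ring.
  replace (log_Poisson_y z t ^ 2) with (log_Poisson_y z t * log_Poisson_y z t) by ring.
  rewrite !(RtoC_mult (gap z ^ 2 / 4)), !RtoC_plus; ring.
- rewrite H1, H2, <- HA.
  replace (gap z ^ 2 / 4 * - (4 / gap z ^ 2)) with (- (1)) by (field; exact Hg).
  replace (gap z ^ 2 / 4 * (4 / gap z ^ 2)) with 1 by (field; exact Hg).
  rewrite RtoC_opp; ring.
Qed.

Definition circle_transform (k : C -> R -> C) (c : R -> C) (z : C) : C :=
  (RtoC (/ (2 * PI)) * CInt (fun t => k z t * c t)%C 0 (2 * PI))%C.

Lemma jointly_continuous_mult (c : R -> C) (Hc : forall t, continuous c t)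
    {U : UniformSpace} (D : U -> Prop) (k : U -> R -> C) :
  jointly_continuous D k -> jointly_continuous D (fun u t => k u t * c t)%C.
Proof.
intros Hk u t Hu.
apply (continuous_Cmult (U := prod_UniformSpace U R_UniformSpace)
  (fun p => k (fst p) (snd p)) (fun p => c (snd p))); [now apply Hk|].
apply (continuous_comp (U := prod_UniformSpace U R_UniformSpace) snd c); [|apply Hc].
apply continuous_snd.
Qed.

Lemma continuous_circle_transform (c : R -> C) (Hc : forall t, continuous c t)
    (k : C -> R -> C) (z : C) :
  jointly_continuous (U := C_UniformSpace) in_disk k -> in_disk z ->
  continuous (circle_transform k c) z.
Proof.
intros Hk Hz; apply continuous_Cmult; [apply continuous_const|].
apply (CInt_param_continuous in_disk (fun z t => k z t * c t)%C).
- assert (H := PI_RGT_0); lra.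
- apply open_in_disk, Hz.
- now apply jointly_continuous_mult.
Qed.

(** The curve [gamma] will be a horizontal or a vertical line, so that both partial derivatives come
    from one statement. *)
Lemma is_derive_circle_transform (c : R -> C) (Hc : forall t, continuous c t)
    (k k' : C -> R -> C) (gamma : R -> C) (u : R) :
  (forall v, continuous gamma v) ->
  in_disk (gamma u) ->
  jointly_continuous (U := C_UniformSpace) in_disk k ->
  jointly_continuous (U := C_UniformSpace) in_disk k' ->
  (forall v t, in_disk (gamma v) -> is_derive_C (fun w => k (gamma w) t) v (k' (gamma v) t)) ->
  is_derive_C (fun v => circle_transform k c (gamma v)) u (circle_transform k' c (gamma u)).
Proof.
intros Hg Hu Hk Hk' Hd; apply is_derive_Cscal.
assert (Hj : forall m, jointly_continuous (U := C_UniformSpace) in_disk m ->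
  jointly_continuous (U := R_UniformSpace) (fun v => in_disk (gamma v))
    (fun v t => m (gamma v) t * c t)%C).
{ intros m Hm v t Hv.
  apply (continuous_comp_2 (U := prod_UniformSpace R_UniformSpace R_UniformSpace)
    (V := C_UniformSpace) (W := R_UniformSpace)
    (fun p => gamma (fst p)) snd (fun z t => m z t * c t)%C).
  - apply (continuous_comp (U := prod_UniformSpace R_UniformSpace R_UniformSpace) fst gamma);
      [apply continuous_fst|apply Hg].
  - apply continuous_snd.
  - apply (jointly_continuous_mult c Hc in_disk m Hm), Hv. }
apply (is_derive_CInt_param (fun v => in_disk (gamma v))
  (fun v t => k (gamma v) t * c t)%C (fun v t => k' (gamma v) t * c t)%C).
- apply (Hg u in_disk), open_in_disk, Hu.
- intros v t Hv.
  now apply (jointly_continuous_snd (U := R_UniformSpace) (fun v => in_disk (gamma v))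
    (fun v t => k (gamma v) t * c t)%C (Hj k Hk) v t).
- intros v t Hv; evar_last.
  + apply is_derive_Cmult; [now apply Hd|apply is_derive_C_const].
  + simpl; ring.
- now apply Hj.
Qed.

Lemma circle_transform_harmonic (A lambda : C) (c : R -> C) :
  (A * (A - RtoC 1) = lambda)%C -> (forall t, continuous c t) ->
  lambda_harmonic lambda (circle_transform (kernel A) c).
Proof.
intros HA Hc.
destruct (jointly_continuous_kernels A) as (J0 & Jx & Jy & Jxx & Jxy & Jyx & Jyy).
assert (Dx : forall k k', jointly_continuous (U := C_UniformSpace) in_disk k ->
  jointly_continuous (U := C_UniformSpace) in_disk k' ->
  (forall w t, in_disk w -> is_derive_C (fun x => k (x, Im w) t) (Re w) (k' w t)) ->
  forall z, in_disk z ->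
  is_derive_C (fun x => circle_transform k c (x, Im z)) (Re z) (circle_transform k' c z)).
{ intros k k' Hk Hk' Hd [x y] Hz.
  apply (is_derive_circle_transform c Hc k k' (fun v => (v, y)) x); try assumption.
  - intros v; apply continuous_pair_C; [apply continuous_id|apply continuous_const].
  - intros v t Hv; exact (Hd _ t Hv). }
assert (Dy : forall k k', jointly_continuous (U := C_UniformSpace) in_disk k ->
  jointly_continuous (U := C_UniformSpace) in_disk k' ->
  (forall w t, in_disk w -> is_derive_C (fun y => k (Re w, y) t) (Im w) (k' w t)) ->
  forall z, in_disk z ->
  is_derive_C (fun y => circle_transform k c (Re z, y)) (Im z) (circle_transform k' c z)).
{ intros k k' Hk Hk' Hd [x y] Hz.
  apply (is_derive_circle_transform c Hc k k' (fun v => (x, v)) y); try assumption.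
  - intros v; apply continuous_pair_C; [apply continuous_const|apply continuous_id].
  - intros v t Hv; exact (Hd _ t Hv). }
destruct (C2_intro (circle_transform (kernel A) c)
  (circle_transform (kernel1 A log_Poisson_x) c)
  (circle_transform (kernel1 A log_Poisson_y) c)
  (circle_transform (kernel2 A log_Poisson_x log_Poisson_x log_Poisson_xx) c)
  (circle_transform (kernel2 A log_Poisson_x log_Poisson_y log_Poisson_xy) c)
  (circle_transform (kernel2 A log_Poisson_y log_Poisson_x log_Poisson_xy) c)
  (circle_transform (kernel2 A log_Poisson_y log_Poisson_y log_Poisson_yy) c)) as [H2 HL].
- apply Dx; auto; intros [x y] t Hw.
  destruct (is_derive_log_Poisson (x, y) t Hw) as (H1 & H2 & _).
  exact (is_derive_kernel A (fun v => (v, y)) t x _ H1).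
- apply Dy; auto; intros [x y] t Hw.
  destruct (is_derive_log_Poisson (x, y) t Hw) as (H1 & H2 & _).
  exact (is_derive_kernel A (fun v => (x, v)) t y _ H2).
- apply Dx; auto; intros [x y] t Hw.
  destruct (is_derive_log_Poisson (x, y) t Hw) as (H1 & H2 & H3 & H4 & H5 & H6).
  exact (is_derive_kernel1 A log_Poisson_x (fun v => (v, y)) t x _ _ H1 H3).
- apply Dy; auto; intros [x y] t Hw.
  destruct (is_derive_log_Poisson (x, y) t Hw) as (H1 & H2 & H3 & H4 & H5 & H6).
  exact (is_derive_kernel1 A log_Poisson_x (fun v => (x, v)) t y _ _ H2 H4).
- apply Dx; auto; intros [x y] t Hw.
  destruct (is_derive_log_Poisson (x, y) t Hw) as (H1 & H2 & H3 & H4 & H5 & H6).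
  exact (is_derive_kernel1 A log_Poisson_y (fun v => (v, y)) t x _ _ H1 H5).
- apply Dy; auto; intros [x y] t Hw.
  destruct (is_derive_log_Poisson (x, y) t Hw) as (H1 & H2 & H3 & H4 & H5 & H6).
  exact (is_derive_kernel1 A log_Poisson_y (fun v => (x, v)) t y _ _ H2 H6).
- intros z Hz; repeat split; now apply continuous_circle_transform.
- split; [exact H2|]; intros z Hz; unfold hyp_laplacian.
  destruct (HL z Hz) as [-> ->].
  replace (1 - Cmod z ^ 2) with (gap z) by (unfold gap; rewrite Cmod2_alt; ring).
  assert (Hs : forall k, jointly_continuous (U := C_UniformSpace) in_disk k ->
    forall t, continuous (fun t => k z t * c t)%C t).
  { intros k Hk t; apply continuous_Cmult; [|apply Hc].
    now apply (jointly_continuous_snd (U := C_UniformSpace) in_disk k Hk z t). }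
  assert (Sx := Hs _ Jxx); assert (Sy := Hs _ Jyy); assert (S0 := Hs _ J0).
  set (fx := fun t => (kernel2 A log_Poisson_x log_Poisson_x log_Poisson_xx z t * c t)%C).
  set (fy := fun t => (kernel2 A log_Poisson_y log_Poisson_y log_Poisson_yy z t * c t)%C).
  set (f0 := fun t => (kernel A z t * c t)%C).
  assert (E : (RtoC (gap z ^ 2 / 4) * (CInt fx 0 (2 * PI) + CInt fy 0 (2 * PI)) =
    lambda * CInt f0 0 (2 * PI))%C).
  { rewrite <- (CInt_plus fx fy 0 (2 * PI) Sx Sy), <- (CInt_scal lambda f0 0 (2 * PI) S0).
    rewrite <- CInt_scal by (intros t; apply continuous_Cplus; [apply Sx|apply Sy]).
    apply CInt_ext; intros t; unfold fx, fy, f0.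
    rewrite Cmult_assoc, <- (kernel_eigenfunction A lambda z t Hz HA); ring. }
  change (RtoC (gap z ^ 2 / 4) * (RtoC (/ (2 * PI)) * CInt fx 0 (2 * PI) +
    RtoC (/ (2 * PI)) * CInt fy 0 (2 * PI)) =
    lambda * (RtoC (/ (2 * PI)) * CInt f0 0 (2 * PI)))%C.
  rewrite <- Cmult_plus_distr_l, Cmult_assoc, (Cmult_comm (RtoC (gap z ^ 2 / 4))).
  rewrite <- Cmult_assoc, E; ring.
Qed.

(** * The spectral parameter *)

Lemma cis_plus (s t : R) : cis (s + t) = (cis s * cis t)%C.
Proof. unfold cis, Cmult; simpl; rewrite cos_plus, sin_plus; f_equal; ring. Qed.

Lemma cis_0 : cis 0 = RtoC 1.
Proof. unfold cis; now rewrite cos_0, sin_0. Qed.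

Lemma cis_2PI_plus (t : R) : cis (t + 2 * PI) = cis t.
Proof. 
unfold cis; f_equal.
- rewrite <- (cos_period t 1); f_equal; simpl; ring.
- rewrite <- (sin_period t 1); f_equal; simpl; ring.
 Qed.

Lemma Cexp_plus (u v : C) : Cexp (u + v)%C = (Cexp u * Cexp v)%C.
Proof.
unfold Cexp; rewrite re_plus, im_plus, exp_plus, cis_plus, RtoC_mult; ring.
Qed.

Lemma Cexp_RtoC (x : R) : Cexp (RtoC x) = RtoC (exp x).
Proof. unfold Cexp; simpl; rewrite cis_0; ring. Qed.

Lemma Cmod_Cexp (w : C) : Cmod (Cexp w) = exp (Re w).
Proof. unfold Cexp; apply Cmod_polar, Rlt_le, exp_pos. Qed.

(** The angle [acos (Re z / |z|)] has sine [|Im z| / |z|], and the case distinction in [Carg]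
    restores the sign of [Im z]. *)
Lemma polar_Carg (z : C) : z <> RtoC 0 -> z = (RtoC (Cmod z) * cis (Carg z))%C.
Proof.
intros Hz; apply Cmod_gt_0 in Hz; assert (H2 := Cmod2_alt z).
set (m := Cmod z) in *; set (x := Re z) in *; set (y := Im z) in *.
assert (Hx : -1 <= x / m <= 1).
{ split; [apply Rle_div_r|apply Rle_div_l]; nra. }
assert (Hs : sin (acos (x / m)) = Rabs y / m).
{ rewrite sin_acos by exact Hx.
  replace (1 - (x / m)²) with ((y / m)²).
  - rewrite sqrt_Rsqr_abs; unfold Rdiv; rewrite Rabs_mult, Rabs_inv, (Rabs_pos_eq m) by lra.
    reflexivity.
  - unfold Rsqr; apply Rmult_eq_reg_r with (m ^ 2); [|nra].
    transitivity (y ^ 2); [field; lra|]; transitivity (m ^ 2 - x ^ 2); [lra|field; lra]. }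
assert (Hcos : cos (acos (x / m)) = x / m) by now apply cos_acos.
unfold Carg; fold m x y; unfold cis.
destruct (Rle_dec 0 y) as [Hy|Hy].
- rewrite Hs, Hcos, (Rabs_pos_eq y) by exact Hy.
  rewrite (surjective_pairing z); unfold Cmult; simpl; fold (Re z) (Im z); fold x y.
  f_equal; field; lra.
- rewrite cos_neg, sin_neg, Hs, Hcos, (Rabs_left1 y) by lra.
  rewrite (surjective_pairing z); unfold Cmult; simpl; fold (Re z) (Im z); fold x y.
  f_equal; field; lra.
Qed.

Lemma Csqrt_sq (z : C) : (Csqrt z * Csqrt z)%C = z.
Proof.
unfold Csqrt.
replace (RtoC (sqrt (Cmod z)) * cis (Carg z / 2) * (RtoC (sqrt (Cmod z)) * cis (Carg z / 2)))%C
  with (RtoC (sqrt (Cmod z) * sqrt (Cmod z)) * (cis (Carg z / 2) * cis (Carg z / 2)))%C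
  by (rewrite RtoC_mult; ring).
rewrite sqrt_sqrt by apply Cmod_ge_0; rewrite <- cis_plus.
replace (Carg z / 2 + Carg z / 2) with (Carg z) by field.
destruct (Ceq_dec z (RtoC 0)) as [->|Hz].
- rewrite Cmod_0; ring.
- symmetry; now apply polar_Carg.
Qed.

(** Half of the principal argument lies in [[- PI / 2, PI / 2]]. *)
Lemma Re_Csqrt_ge_0 (z : C) : 0 <= Re (Csqrt z).
Proof.
unfold Csqrt; rewrite re_scal_l; apply Rmult_le_pos; [apply sqrt_pos|].
unfold cis; simpl; assert (H := acos_bound (Re z / Cmod z)).
unfold Carg; destruct (Rle_dec 0 (Im z)); apply cos_ge_0; lra.
Qed.

Lemma spectral_eigenvalue (lambda : C) : let A := (spectral lambda + RtoC (1 / 2))%C in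
  (A * (A - RtoC 1))%C = lambda.
Proof.
intros A; assert (H := Csqrt_sq (lambda + RtoC (1 / 4))%C); fold (spectral lambda) in H.
transitivity (spectral lambda * spectral lambda - RtoC (1 / 4))%C.
- unfold A; destruct (spectral lambda) as [p q].
  unfold Cminus, Cplus, Copp, Cmult, RtoC; simpl; f_equal; field.
- rewrite H; ring.
Qed.

(** If [s = i q] with [q <> 0], then [lambda + 1/4 = - q^2] is a negative real number, which is
    excluded. *)
Lemma spectral_cases (lambda : C) : ~ (Im lambda = 0 /\ Re lambda < - (1 / 4)) ->
  0 < Re (spectral lambda) \/ spectral lambda = RtoC 0.
Proof.
intros H; assert (H0 := Re_Csqrt_ge_0 (lambda + RtoC (1 / 4))%C).
assert (H1 := Csqrt_sq (lambda + RtoC (1 / 4))%C).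
fold (spectral lambda) in H0, H1.
destruct H0 as [H0|H0]; [now left|right].
destruct (spectral lambda) as [p q]; destruct lambda as [l m]; simpl in *; subst p.
unfold Cmult, Cplus, RtoC in H1; simpl in H1; injection H1; intros E1 E2.
unfold RtoC; f_equal.
destruct (Req_dec q 0) as [|Hq]; [easy|exfalso; apply H].
assert (0 < q * q) by nra; split; lra.
Qed.

(** * Asymptotics of the spherical function *)

Definition cpow (x : R) (B : C) : C := Cexp (B * RtoC (ln x))%C.

Lemma cpow_plus (x : R) (B D : C) : cpow x (B + D)%C = (cpow x B * cpow x D)%C.
Proof. unfold cpow; now rewrite Cmult_plus_distr_r, Cexp_plus. Qed.

Lemma cpow_RtoC (x b : R) : cpow x (RtoC b) = RtoC (Rpower x b).
Proof. unfold cpow, Rpower; now rewrite <- RtoC_mult, Cexp_RtoC. Qed.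

Lemma cpow_S (x : R) (B : C) : 0 < x -> cpow x (B + RtoC 1)%C = (RtoC x * cpow x B)%C.
Proof. intros Hx; rewrite cpow_plus, cpow_RtoC, Rpower_1 by exact Hx; ring. Qed.

Lemma cpow_P (x : R) (B : C) : 0 < x -> cpow x (B - RtoC 1)%C = (RtoC (/ x) * cpow x B)%C.
Proof.
intros Hx; unfold Cminus; rewrite cpow_plus, <- RtoC_opp, cpow_RtoC, Rpower_Ropp, Rpower_1
  by exact Hx; ring.
Qed.

Lemma cpow_mult (x y : R) (B : C) : 0 < x -> 0 < y -> cpow (x * y) B = (cpow x B * cpow y B)%C.
Proof.
intros Hx Hy; unfold cpow; now rewrite ln_mult, RtoC_plus, Cmult_plus_distr_l, Cexp_plus.
Qed.

Lemma Cmod_cpow (x : R) (B : C) : Cmod (cpow x B) = Rpower x (Re B).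
Proof. unfold cpow, Rpower; rewrite Cmod_Cexp, re_scal_r; reflexivity. Qed.

(* [|1 + r e^(it)|^2] *)
Definition qf (r t : R) : R := 1 + 2 * r * cos t + r ^ 2.
Definition Icpow (B : C) (r : R) : C := CInt (fun t => cpow (qf r t) B) 0 (2 * PI).
Definition Irpow (b r : R) : R := RInt (fun t => Rpower (qf r t) b) 0 (2 * PI).

Lemma qf_bounds (r t : R) : 0 <= r -> (1 - r) ^ 2 <= qf r t <= (1 + r) ^ 2.
Proof. intros Hr; unfold qf; assert (H := COS_bound t); split; nra. Qed.

Lemma qf_pos (r t : R) : 0 <= r < 1 -> 0 < qf r t.
Proof.
intros Hr; assert (H := qf_bounds r t); assert (0 < (1 - r) ^ 2) by (apply pow2_gt_0; lra); lra.
Qed.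

Lemma continuous_qf (r t : R) : continuous (qf r) t.
Proof. unfold qf; continuity_tac. Qed.

Lemma continuous_cpow_qf (B : C) (r t : R) : 0 <= r < 1 ->
  continuous (fun t => cpow (qf r t) B) t.
Proof.
intros Hr; assert (H := continuous_qf r t); unfold cpow; continuity_tac; now apply qf_pos.
Qed.

Lemma continuous_Rpower_qf (b r t : R) : 0 <= r < 1 ->
  continuous (fun t => Rpower (qf r t) b) t.
Proof.
intros Hr; assert (H := continuous_qf r t); unfold Rpower; continuity_tac; now apply qf_pos.
Qed.

Lemma Icpow_RtoC (b r : R) : 0 <= r < 1 -> Icpow (RtoC b) r = RtoC (Irpow b r).
Proof.
intros Hr; unfold Icpow, Irpow; rewrite <- CInt_RtoC.
- apply CInt_ext; intros t; apply cpow_RtoC.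
- intros t; now apply continuous_Rpower_qf.
Qed.

(* Integrate the derivative of [2 r sin t * q^B] over a period. *)
Lemma Icpow_recurrence (B : C) (r : R) : 0 <= r < 1 ->
  ((RtoC 2 * B + RtoC 1) * RtoC (1 + r ^ 2) * Icpow B r =
   (B + RtoC 1) * Icpow (B + RtoC 1) r + B * RtoC ((1 - r ^ 2) ^ 2) * Icpow (B - RtoC 1) r)%C.
Proof.
intros Hr.
set (df := fun t => ((B + RtoC 1) * cpow (qf r t) (B + RtoC 1) -
  (RtoC 2 * B + RtoC 1) * RtoC (1 + r ^ 2) * cpow (qf r t) B +
  B * RtoC ((1 - r ^ 2) ^ 2) * cpow (qf r t) (B - RtoC 1))%C).
assert (Hc : forall D t, continuous (fun t => cpow (qf r t) D) t)
  by (intros; now apply continuous_cpow_qf).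
assert (Hs : forall k D t, continuous (fun t => k * cpow (qf r t) D)%C t)
  by (intros; apply continuous_Cmult; [apply continuous_const|apply Hc]).
assert (H : RtoC 0 = CInt df 0 (2 * PI)).
{ rewrite (CInt_derive (fun t => RtoC (2 * r * sin t) * cpow (qf r t) B)%C df).
  - rewrite sin_2PI, sin_0, Rmult_0_r; ring.
  - intros t; assert (Hq := qf_pos r t Hr); evar_last.
    + apply is_derive_Cmult.
      * apply is_derive_RtoC; auto_derive; [easy|reflexivity].
      * apply is_derive_Cexp, is_derive_Cscal, is_derive_RtoC.
        apply (is_derive_comp ln (qf r)); [now apply is_derive_ln|].
        unfold qf; auto_derive; [easy|reflexivity].
    + unfold df; rewrite cpow_S, cpow_P by exact Hq; unfold cpow.
      set (E := Cexp _); unfold scal; simpl; unfold mult; simpl.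
      change (r * (r * 1)) with (r ^ 2).
      change ((1 - r ^ 2) * ((1 - r ^ 2) * 1)) with ((1 - r ^ 2) ^ 2).
      set (q := qf r t) in *.
      (* This eliminates the angle: [(2 r sin t)^2 / q] becomes
         [- q + 2 (1 + r^2) - (1 - r^2)^2 / q], so only the powers [B + 1], [B] and [B - 1] of [q]
         occur. *)
      assert (Ec : 2 * r * cos t = q - (1 + r ^ 2)) by (unfold q, qf; ring).
      transitivity ((RtoC (2 * r * cos t) +
        B * RtoC (- ((2 * r) ^ 2 * (1 - cos t ^ 2) / q))) * E)%C.
      * assert (Es : 1 - cos t ^ 2 = sin t ^ 2) by (rewrite <- (cos_sin_sq t); ring).
        replace (- ((2 * r) ^ 2 * (1 - cos t ^ 2) / q))
          with ((2 * r * sin t) * (2 * r * (1 * - sin t) * / q)) by (rewrite Es; field; lra).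
        rewrite (RtoC_mult (2 * r * sin t)), Rmult_1_l.
        ring.
      * replace (- ((2 * r) ^ 2 * (1 - cos t ^ 2) / q))
          with (q - 2 * (1 + r ^ 2) + (1 - r ^ 2) ^ 2 * / q).
        2:{ replace ((2 * r) ^ 2 * (1 - cos t ^ 2)) with ((2 * r) ^ 2 - (2 * r * cos t) ^ 2) by ring.
            rewrite Ec; field; lra. }
        rewrite Ec.
        rewrite (RtoC_plus _ ((1 - r ^ 2) ^ 2 * / q)), (RtoC_mult ((1 - r ^ 2) ^ 2)).
        rewrite !RtoC_minus, (RtoC_mult 2); ring.
  - intros t; apply continuous_Cplus; [apply continuous_Cminus|]; apply Hs. }
unfold df in H.
rewrite CInt_plus in H; [|intros t; apply continuous_Cminus; apply Hs|intros; apply Hs].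
rewrite CInt_minus in H; [|intros; apply Hs|intros; apply Hs].
rewrite !CInt_scal in H by (intros; apply Hc).
fold (Icpow (B + RtoC 1)%C r) (Icpow (B - RtoC 1)%C r) (Icpow B r) in H.
transitivity ((RtoC 2 * B + RtoC 1) * RtoC (1 + r ^ 2) * Icpow B r + RtoC 0)%C; [ring|].
rewrite H; ring.
Qed.

Lemma Irpow_recurrence (b r : R) : 0 <= r < 1 ->
  (2 * b + 1) * (1 + r ^ 2) * Irpow b r =
  (b + 1) * Irpow (b + 1) r + b * (1 - r ^ 2) ^ 2 * Irpow (b - 1) r.
Proof.
intros Hr; apply RtoC_inj; assert (H := Icpow_recurrence (RtoC b) r Hr).
rewrite <- RtoC_plus, <- RtoC_minus, !Icpow_RtoC in H by exact Hr.
rewrite RtoC_plus, !RtoC_mult, (RtoC_plus (2 * b)), RtoC_mult, H; ring.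
Qed.

Lemma at_left_1_intro (r0 : R) (P : R -> Prop) : r0 < 1 ->
  (forall r, r0 < r < 1 -> P r) -> at_left 1 P.
Proof.
intros H0 HP; assert (Hd : 0 < 1 - r0) by lra; exists (mkposreal _ Hd).
intros r Hr Hr1; apply HP; split; [|exact Hr1].
apply Rabs_lt_between' in Hr; simpl in Hr; lra.
Qed.

Lemma at_left_1_elim (P : R -> Prop) : at_left 1 P ->
  exists r0, 0 <= r0 < 1 /\ forall r, r0 < r < 1 -> P r.
Proof.
intros [d Hd]; exists (Rmax 0 (1 - d)); assert (0 < d) by apply cond_pos; split.
- split; [apply Rmax_l|apply Rmax_lub_lt; lra].
- intros r Hr; apply Hd; [|easy].
  assert (1 - d <= Rmax 0 (1 - d)) by apply Rmax_r.
  apply Rabs_lt_between'; lra.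
Qed.

Lemma at_left_1_range : at_left 1 (fun r => 0 <= r < 1).
Proof. apply at_left_1_intro with 0; [lra|]; intros; lra. Qed.

Lemma at_left_1_small (f : R -> R) (eps : R) : continuous f 1 -> f 1 < eps ->
  at_left 1 (fun r => f r < eps).
Proof.
intros Hf He; apply filter_le_within.
apply (Hf (fun y => y < eps)), open_lt, He.
Qed.

Lemma Rpower_base_le (x y b : R) : 0 <= b -> 0 < x <= y -> Rpower x b <= Rpower y b.
Proof. intros Hb Hx; now apply Rle_Rpower_l. Qed.

Lemma Rpower_pos (x b : R) : 0 < Rpower x b.
Proof. apply exp_pos. Qed.

Lemma Rpower_small (k eps : R) : 0 < k -> 0 < eps -> at_left 1 (fun r => Rpower (1 - r) k < eps).
Proof.
intros Hk He; apply at_left_1_intro with (1 - Rpower eps (/ k)).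
- assert (H := Rpower_pos eps (/ k)); lra.
- intros r Hr; replace eps with (Rpower (Rpower eps (/ k)) k).
  + apply Rlt_Rpower_l; [exact Hk|lra].
  + rewrite Rpower_mult, Rinv_l, Rpower_1 by lra; reflexivity.
Qed.

Lemma Irpow_le (b r : R) (f : R -> R) : 0 <= r < 1 -> (forall t, continuous f t) ->
  (forall t, Rpower (qf r t) b <= f t) -> Irpow b r <= RInt f 0 (2 * PI).
Proof.
intros Hr Hf H; assert (Hpi := PI_RGT_0); apply RInt_le; [lra| | |intros; apply H].
- apply ex_RInt_continuous_R; intros; now apply continuous_Rpower_qf.
- now apply ex_RInt_continuous_R.
Qed.

Lemma Irpow_ge (b r : R) (f : R -> R) : 0 <= r < 1 -> (forall t, continuous f t) ->
  (forall t, f t <= Rpower (qf r t) b) -> RInt f 0 (2 * PI) <= Irpow b r.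
Proof.
intros Hr Hf H; assert (Hpi := PI_RGT_0); apply RInt_le; [lra| | |intros; apply H].
- now apply ex_RInt_continuous_R.
- apply ex_RInt_continuous_R; intros; now apply continuous_Rpower_qf.
Qed.

Lemma RInt_0_2PI_const (c : R) : RInt (fun _ => c) 0 (2 * PI) = 2 * PI * c.
Proof. rewrite RInt_const; unfold scal; simpl; unfold mult; simpl; ring. Qed.

Lemma Irpow_ge_0 (b r : R) : 0 <= r < 1 -> 0 <= Irpow b r.
Proof.
intros Hr; apply Rle_trans with (RInt (fun _ => 0) 0 (2 * PI)).
- rewrite RInt_0_2PI_const; lra.
- apply Irpow_ge; [exact Hr|intros; apply continuous_const|].
  intros t; apply Rlt_le, Rpower_pos.
Qed.

Lemma Irpow_upper_nonneg (b r : R) : 0 <= b -> 0 <= r < 1 -> Irpow b r <= 2 * PI * Rpower 4 b.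
Proof.
intros Hb Hr; rewrite <- RInt_0_2PI_const.
apply Irpow_le; [exact Hr|intros; apply continuous_const|].
intros t; apply Rpower_base_le; [exact Hb|split; [now apply qf_pos|]].
assert (H := qf_bounds r t); nra.
Qed.

(* For [-1/2 < b < 0] the last term of the recurrence is nonpositive. *)
Lemma Irpow_bounded (b : R) : - (1 / 2) < b ->
  exists M, forall r, 0 <= r < 1 -> Irpow b r <= M.
Proof.
intros Hb; destruct (Rle_dec 0 b) as [H0|H0].
- exists (2 * PI * Rpower 4 b); intros r Hr; now apply Irpow_upper_nonneg.
- exists ((b + 1) * (2 * PI * Rpower 4 (b + 1)) / (2 * b + 1)); intros r Hr.
  apply Rle_div_r; [lra|].
  assert (H := Irpow_recurrence b r Hr).
  assert (H1 := Irpow_upper_nonneg (b + 1) r ltac:(lra) Hr).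
  assert (H2 := Irpow_ge_0 b r Hr); assert (H3 := Irpow_ge_0 (b - 1) r Hr).
  assert (H4 : 0 <= (1 - r ^ 2) ^ 2 * Irpow (b - 1) r)
    by (apply Rmult_le_pos; [apply pow2_ge_0|exact H3]).
  assert (H5 : (b + 1) * Irpow (b + 1) r <= (b + 1) * (2 * PI * Rpower 4 (b + 1)))
    by (apply Rmult_le_compat_l; lra).
  assert (H6 : 0 <= r ^ 2 * ((2 * b + 1) * Irpow b r)).
  { apply Rmult_le_pos; [apply pow2_ge_0|apply Rmult_le_pos; lra]. }
  assert (H7 : b * (1 - r ^ 2) ^ 2 * Irpow (b - 1) r <= 0) by nra.
  nra.
Qed.

(** For [b >= 1] one has [q^b >= q - 1], whether [q >= 1] or not, and [q - 1 = 2 r cos t + r^2] has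
    integral [2 PI r^2]. *)
Lemma Irpow_lower (b r : R) : 1 <= b -> 0 <= r < 1 -> 2 * PI * r ^ 2 <= Irpow b r.
Proof.
intros Hb Hr.
replace (2 * PI * r ^ 2) with (RInt (fun t => 2 * r * cos t + r ^ 2) 0 (2 * PI)).
- apply Irpow_ge; [exact Hr|intros; continuity_tac|].
  intros t; replace (2 * r * cos t + r ^ 2) with (qf r t - 1) by (unfold qf; ring).
  assert (Hq := qf_pos r t Hr); destruct (Rle_dec 1 (qf r t)) as [H1|H1].
  + apply Rle_trans with (Rpower (qf r t) 1); [rewrite Rpower_1 by exact Hq; lra|].
    now apply Rle_Rpower.
  + assert (H2 := Rpower_pos (qf r t) b); lra.
- apply is_RInt_unique; evar_last.
  + apply (is_RInt_derive (fun t => 2 * r * sin t + r ^ 2 * t)).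
    * intros t _; auto_derive; [easy|ring].
    * intros t _; continuity_tac.
  + unfold minus, plus, opp; simpl; rewrite sin_2PI, sin_0; ring.
Qed.

Lemma Rabs_sin_le (x : R) : Rabs (sin x) <= Rabs x.
Proof.
assert (H : forall y, 0 < y -> Rabs (sin y) <= y).
{ intros y Hy; apply Rabs_le; split; [|apply Rlt_le, sin_lt_x, Hy].
  destruct (Rle_dec y PI) as [H|H].
  - assert (0 <= sin y) by (apply sin_ge_0; lra); lra.
  - assert (H1 := SIN_bound y); assert (H2 := PI2_1); lra. }
destruct (Rtotal_order x 0) as [Hx|[->|Hx]].
- rewrite <- Rabs_Ropp, <- sin_neg, (Rabs_left x Hx); apply H; lra.
- rewrite sin_0; lra.
- rewrite (Rabs_pos_eq x) by lra; now apply H.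
Qed.

(** A chord is no longer than its arc: its squared length is [4 sin^2 ((s - t) / 2)]. *)
Lemma Cmod_cis_minus (s t : R) : Cmod (cis s - cis t)%C <= Rabs (s - t).
Proof.
apply Rsqr_incr_0_var; [|apply Rabs_pos].
rewrite <- Rsqr_abs; unfold Rsqr at 1; replace (Cmod (cis s - cis t)%C * _)
  with (Cmod (cis s - cis t)%C ^ 2) by ring.
rewrite Cmod2_alt; unfold cis; simpl.
assert (Hh : 1 - cos (s - t) = 2 * sin ((s - t) / 2) ^ 2).
{ replace (s - t) with (2 * ((s - t) / 2)) at 1 by field.
  rewrite cos_2a_sin; ring. }
rewrite cos_minus in Hh.
assert (H1 := cos_sin_sq s); assert (H2 := cos_sin_sq t).
assert (H3 : Rsqr (sin ((s - t) / 2)) <= Rsqr ((s - t) / 2)) by (apply Rsqr_le_abs_1, Rabs_sin_le).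
unfold Rsqr in *; nra.
Qed.

(* Rotating [q^B] by the phase of [(1+r)^(2B)] leaves the phase [Im B * ln (q / (1+r)^2)],
   which [q^(Re B)] weighs little when [Re B] is large, since [- ln x <= 1 / x - 1]. *)
Lemma Icpow_lower_phase (B : C) (r : R) : 0 <= r < 1 ->
  Irpow (Re B) r - Rabs (Im B) * ((1 + r) ^ 2 * Irpow (Re B - 1) r - Irpow (Re B) r)
    <= Cmod (Icpow B r).
Proof.
intros Hr; set (b := Re B); set (y := Im B); set (N := (1 + r) ^ 2).
assert (HN : 0 < N) by (unfold N; apply pow_lt; lra).
set (w := cis (- (y * ln N))).
assert (Hw : Cmod w = 1) by apply Cmod_cis.
assert (Hc := fun D t => continuous_cpow_qf D r t Hr).
assert (Hcr := fun D t => continuous_Rpower_qf D r t Hr).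
assert (E : Cmod (w * Icpow B r - RtoC (Irpow b r))%C <=
  Rabs y * (N * Irpow (b - 1) r - Irpow b r)).
{ unfold Icpow at 1, Irpow at 1.
  rewrite <- CInt_scal, <- CInt_RtoC, <- CInt_minus; try (intros; auto).
  2:{ apply continuous_Cmult; [apply continuous_const|apply Hc]. }
  2:{ apply continuous_RtoC, Hcr. }
  replace (Rabs y * (N * Irpow (b - 1) r - Irpow b r)) with
    (RInt (fun t => Rabs y * (N * Rpower (qf r t) (b - 1) - Rpower (qf r t) b)) 0 (2 * PI)).
  2:{ apply is_RInt_unique, (is_RInt_scal (V := R_NormedModule)).
      apply (is_RInt_minus (V := R_NormedModule)
        (fun t => N * Rpower (qf r t) (b - 1)) (fun t => Rpower (qf r t) b)).
      - apply (is_RInt_scal (V := R_NormedModule)).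
        apply (RInt_correct (V := R_CompleteNormedModule)), ex_RInt_continuous_R; auto.
      - apply (RInt_correct (V := R_CompleteNormedModule)), ex_RInt_continuous_R; auto. }
  assert (Hpi := PI_RGT_0); apply Cmod_CInt_le; [lra| | |].
  - intros t; apply continuous_Cminus.
    + apply continuous_Cmult; [apply continuous_const|apply Hc].
    + apply continuous_RtoC, Hcr.
  - intros t; assert (H1 := Hcr (b - 1) t); assert (H2 := Hcr b t); continuity_tac.
  - intros t _; assert (Hq := qf_pos r t Hr); set (q := qf r t) in *.
    assert (HqN : q <= N) by (apply qf_bounds; lra).
    replace (w * cpow q B - RtoC (Rpower q b))%C with
      (RtoC (Rpower q b) * (cis (y * ln (q / N)) - cis 0))%C.
    2:{ rewrite cis_0; unfold cpow, Cexp; rewrite re_scal_r, im_scal_r; fold b y.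
        fold (Rpower q b); unfold w; rewrite ln_div by assumption.
        replace (y * (ln q - ln N)) with (- (y * ln N) + y * ln q) by ring.
        rewrite cis_plus; ring. }
    rewrite Cmod_mult, Cmod_R, (Rabs_pos_eq (Rpower q b)) by apply Rlt_le, Rpower_pos.
    assert (H1 := Cmod_cis_minus (y * ln (q / N)) 0).
    rewrite Rminus_0_r, Rabs_mult in H1.
    assert (H2 : Rabs (ln (q / N)) <= N / q - 1).
    { assert (Hle : ln (q / N) <= 0).
      { rewrite <- ln_1; apply ln_le; [now apply Rdiv_lt_0_compat|].
        apply Rle_div_l; lra. }
      rewrite Rabs_left1 by exact Hle; rewrite <- ln_Rinv by now apply Rdiv_lt_0_compat.
      replace (/ (q / N)) with (N / q) by (field; lra).
      assert (H3 := exp_ineq1_le (ln (N / q))).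
      rewrite exp_ln in H3 by now apply Rdiv_lt_0_compat. lra. }
    replace (N * Rpower q (b - 1) - Rpower q b) with (Rpower q b * (N / q - 1)).
    2:{ unfold Rminus at 3; rewrite Rpower_plus, Rpower_Ropp, Rpower_1 by exact Hq; field; lra. }
    assert (H3 := Rpower_pos q b); assert (H4 := Rabs_pos y).
    apply Rle_trans with (Rpower q b * (Rabs y * (N / q - 1))); [|lra].
    apply Rmult_le_compat_l; [lra|]; apply Rle_trans with (1 := H1).
    now apply Rmult_le_compat_l. }
assert (H1 := Cmod_triangle (w * Icpow B r) (- (w * Icpow B r - RtoC (Irpow b r)))).
replace (w * Icpow B r + - (w * Icpow B r - RtoC (Irpow b r)))%C with (RtoC (Irpow b r)) in H1
  by ring.
rewrite Cmod_opp, Cmod_mult, Hw, Cmod_R, Rabs_pos_eq in H1 by now apply Irpow_ge_0.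
lra.
Qed.

(** * Lower bounds for the complex integral near [r = 1] *)

Definition bounded_below (f : R -> C) : Prop :=
  exists c, 0 < c /\ at_left 1 (fun r => c <= Cmod (f r)).

(** By the recurrence at [b - 1], the loss [(1 + r)^2 I(b - 1) - I(b)] in [Icpow_lower_phase] is at
    most [I(b) / (2 b - 1)] up to a multiple of [(1 - r^2)^2]. Since [|Im B| / (2 b - 1) <= 1/2],
    half of [I(b)] survives. *)
Lemma Icpow_bounded_below_large (B : C) : 2 + Rabs (Im B) <= Re B -> bounded_below (Icpow B).
Proof.
intros HB; set (b := Re B) in *; set (y := Rabs (Im B)) in *.
assert (Hy : 0 <= y) by apply Rabs_pos.
destruct (Irpow_bounded (b - 2)) as [M HM]; [lra|].
assert (Hpi := PI_RGT_0).
(* The first summand is the neglected last term of the recurrence; the second one is the defect of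
   [I(b) / 2 >= PI r^2] from [PI]. Both vanish at [r = 1]. *)
set (err := fun r : R => 2 * y * ((b - 1) / (2 * b - 1) * (1 - r ^ 2) ^ 2 * Rabs M)
  + PI * (1 - r ^ 2)).
exists (PI / 2); split; [lra|].
assert (Herr : at_left 1 (fun r => err r < PI / 2)).
{ apply at_left_1_small; [unfold err; continuity_tac|unfold err; simpl; lra]. }
generalize (filter_and _ _ at_left_1_range Herr); apply filter_imp; clear Herr.
intros r [Hr He].
assert (H := Icpow_lower_phase B r Hr); fold b y in H.
assert (Hrec := Irpow_recurrence (b - 1) r Hr).
replace (b - 1 + 1) with b in Hrec by ring; replace (b - 1 - 1) with (b - 2) in Hrec by ring.
assert (HI := Irpow_lower b r ltac:(lra) Hr).
specialize (HM r Hr); assert (H2 := Irpow_ge_0 (b - 2) r Hr).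
assert (H1 := Irpow_ge_0 (b - 1) r Hr).
assert (HMa := Rle_abs M).
set (I0 := Irpow b r) in *; set (I1 := Irpow (b - 1) r) in *; set (I2 := Irpow (b - 2) r) in *.
set (d := (1 - r ^ 2) ^ 2) in *.
assert (Hd : 0 <= d) by apply pow2_ge_0.
assert (HN : (1 + r) ^ 2 * I1 <= 2 * ((1 + r ^ 2) * I1)).
{ rewrite <- Rmult_assoc; apply Rmult_le_compat_r; [exact H1|nra]. }
assert (HdI : (b - 1) * d * I2 <= (b - 1) * d * Rabs M).
{ apply Rmult_le_compat_l; [apply Rmult_le_pos; lra|lra]. }
assert (Hk : (1 + r ^ 2) * I1 <= (b * I0 + (b - 1) * d * Rabs M) / (2 * b - 1)).
{ apply -> Rle_div_r; [|lra].
  replace (2 * (b - 1) + 1) with (2 * b - 1) in Hrec by ring.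
  replace ((1 + r ^ 2) * I1 * (2 * b - 1)) with ((2 * b - 1) * (1 + r ^ 2) * I1) by ring.
  rewrite Hrec; lra. }
assert (Hdiff : (1 + r) ^ 2 * I1 - I0 <= I0 / (2 * b - 1)
  + 2 * ((b - 1) / (2 * b - 1) * d * Rabs M)).
{ apply Rle_trans with (2 * ((b * I0 + (b - 1) * d * Rabs M) / (2 * b - 1)) - I0); [lra|].
  apply Req_le; field; lra. }
assert (Hyb : y * (I0 / (2 * b - 1)) <= I0 / 2).
{ assert (0 <= I0) by (apply Irpow_ge_0, Hr).
  assert (y / (2 * b - 1) <= 1 / 2) by (apply Rle_div_l; lra).
  replace (y * (I0 / (2 * b - 1))) with (y / (2 * b - 1) * I0) by (field; lra); nra. }
assert (Hfin : y * ((1 + r) ^ 2 * I1 - I0) <= I0 / 2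
  + 2 * y * ((b - 1) / (2 * b - 1) * d * Rabs M)).
{ apply Rle_trans with (y * (I0 / (2 * b - 1) + 2 * ((b - 1) / (2 * b - 1) * d * Rabs M))).
  - now apply Rmult_le_compat_l.
  - lra. }
unfold err in He; fold d in He; nra.
Qed.

(** In the recurrence, [I(B + 1)] is bounded below and the term in [I(B - 1)] is of order
    [(1 - r)^(2k)] for some [k > 0]. To see this, part of the exponent [b - 1] is traded for a power
    of [1 - r], which leaves the exponent [b - k > - 1/2] whose integral is bounded. *)
Lemma Icpow_bounded_below_step (B : C) : - (1 / 2) < Re B ->
  bounded_below (Icpow (B + RtoC 1)%C) -> bounded_below (Icpow B).
Proof.
intros HB [c [Hc0 Hc]]; set (b := Re B) in *.
(* [k < 1] allows [q >= (1 - r)^2] to be raised to the negative power [k - 1], and [k < b + 1/2]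
   keeps [I(b - k)] bounded. *)
set (k := Rmin 1 (b + 1 / 2) / 2).
assert (Hk : 0 < k < 1 /\ - (1 / 2) < b - k).
{ unfold k; assert (H1 := Rmin_l 1 (b + 1 / 2)); assert (H2 := Rmin_r 1 (b + 1 / 2)).
  assert (0 < Rmin 1 (b + 1 / 2)) by (apply Rmin_pos; lra); lra. }
destruct Hk as [Hk Hbk]; destruct (Irpow_bounded (b - k) Hbk) as [M HM].
set (K1 := Cmod (B + RtoC 1)%C); set (K2 := Cmod (RtoC 2 * B + RtoC 1)%C).
assert (HK1 : 0 < K1).
{ apply Cmod_gt_0; intros E; apply (f_equal Re) in E; rewrite re_plus in E; simpl in E.
  fold b in E; lra. }
assert (HK2 : 0 < K2).
{ apply Cmod_gt_0; intros E; apply (f_equal Re) in E; rewrite re_plus, re_scal_l in E.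
  simpl in E; fold b in E; lra. }
(* The [4] bounds [(1 + r)^2]; the [+ 1] makes [K3] positive even if [B = 0] or [M = 0]. *)
set (K3 := Cmod B * (4 * Rabs M) + 1).
assert (HK3 : 0 < K3).
{ assert (0 <= Cmod B * (4 * Rabs M)); [|unfold K3; lra].
  apply Rmult_le_pos; [apply Cmod_ge_0|]; assert (H := Rabs_pos M); lra. }
(* Near [1] the last term takes at most [K1 c / 2] from [K1 c], and [1 + r^2 <= 2] accounts for the
   other factor [2]. *)
exists (K1 * c / (4 * K2)); split.
{ apply Rdiv_lt_0_compat; [apply Rmult_lt_0_compat|]; lra. }
assert (He : 0 < K1 * c / (2 * K3)).
{ apply Rdiv_lt_0_compat; [apply Rmult_lt_0_compat|]; lra. }
generalize (filter_and _ _ (filter_and _ _ at_left_1_range Hc)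
  (Rpower_small (2 * k) _ ltac:(lra) He)); apply filter_imp; clear Hc.
intros r [[Hr Hc] Hs]; specialize (HM r Hr).
assert (Hrec := Icpow_recurrence B r Hr).
(* [q^(b-1) <= q^(b-k) (1-r)^(2k-2)] *)
assert (HI : (1 - r ^ 2) ^ 2 * Irpow (b - 1) r <= 4 * Rpower (1 - r) (2 * k) * Irpow (b - k) r).
{ assert (H1 : Irpow (b - 1) r <= Rpower (1 - r) (2 * k - 2) * Irpow (b - k) r).
  { unfold Irpow at 2.
    replace (Rpower (1 - r) (2 * k - 2) * _) with
      (RInt (fun t => Rpower (1 - r) (2 * k - 2) * Rpower (qf r t) (b - k)) 0 (2 * PI)).
    2:{ apply is_RInt_unique, (is_RInt_scal (V := R_NormedModule)).
        apply (RInt_correct (V := R_CompleteNormedModule)), ex_RInt_continuous_R.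
        intros; now apply continuous_Rpower_qf. }
    apply Irpow_le; [exact Hr| |].
    - intros t; apply continuous_Rmult; [apply continuous_const|now apply continuous_Rpower_qf].
    - intros t; assert (Hq := qf_pos r t Hr).
      replace (b - 1) with (- (1 - k) + (b - k)) by ring; rewrite Rpower_plus.
      apply Rmult_le_compat_r; [apply Rlt_le, Rpower_pos|].
      replace (2 * k - 2) with (INR 2 * - (1 - k)) by (simpl; ring).
      rewrite <- Rpower_mult, Rpower_pow by lra.
      rewrite !Rpower_Ropp; apply Rinv_le_contravar; [apply Rpower_pos|].
      apply Rpower_base_le; [lra|]; split; [apply pow_lt; lra|apply qf_bounds; lra]. }
  apply Rle_trans with ((1 - r ^ 2) ^ 2 * (Rpower (1 - r) (2 * k - 2) * Irpow (b - k) r)).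
  { apply Rmult_le_compat_l; [apply pow2_ge_0|exact H1]. }
  rewrite <- Rmult_assoc; apply Rmult_le_compat_r; [now apply Irpow_ge_0|].
  unfold Rminus at 3; rewrite Rpower_plus, Rpower_Ropp.
  replace (Rpower (1 - r) 2) with ((1 - r) ^ 2)
    by (rewrite <- Rpower_pow by lra; f_equal; simpl; ring).
  replace ((1 - r ^ 2) ^ 2 * _) with ((1 + r) ^ 2 * Rpower (1 - r) (2 * k)) by (field; lra).
  apply Rmult_le_compat_r; [apply Rlt_le, Rpower_pos|nra]. }
assert (HI2 : (1 - r ^ 2) ^ 2 * Cmod (Icpow (B - RtoC 1)%C r) <= (1 - r ^ 2) ^ 2 * Irpow (b - 1) r).
{ apply Rmult_le_compat_l; [apply pow2_ge_0|].
  assert (Hpi := PI_RGT_0); apply Cmod_CInt_le; [lra| | |].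
  - intros t; now apply continuous_cpow_qf.
  - intros t; now apply continuous_Rpower_qf.
  - intros t _; rewrite Cmod_cpow; now apply Req_le. }
assert (Hlast : Cmod (B * RtoC ((1 - r ^ 2) ^ 2) * Icpow (B - RtoC 1) r)%C <= K1 * c / 2).
{ rewrite !Cmod_mult, Cmod_R, (Rabs_pos_eq ((1 - r ^ 2) ^ 2)) by apply pow2_ge_0.
  rewrite Rmult_assoc.
  apply Rle_trans with (Cmod B * (4 * Rpower (1 - r) (2 * k) * Irpow (b - k) r)).
  { apply Rmult_le_compat_l; [apply Cmod_ge_0|lra]. }
  apply Rle_trans with (K3 * Rpower (1 - r) (2 * k)).
  - assert (Hp := Rpower_pos (1 - r) (2 * k)); unfold K3.
    assert (Hma := Rle_abs M); assert (HB0 := Cmod_ge_0 B).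
    assert (H1 : Cmod B * Irpow (b - k) r <= Cmod B * Rabs M) by (apply Rmult_le_compat_l; lra).
    nra.
  - apply Rlt_le; replace (K1 * c / 2) with (K3 * (K1 * c / (2 * K3))) by (field; lra).
    now apply Rmult_lt_compat_l. }
assert (Hmain := f_equal Cmod Hrec).
rewrite !Cmod_mult, Cmod_R, Rabs_pos_eq in Hmain by nra; fold K2 in Hmain.
assert (Htri := Cmod_triangle ((B + RtoC 1) * Icpow (B + RtoC 1)%C r +
  B * RtoC ((1 - r ^ 2) ^ 2) * Icpow (B - RtoC 1)%C r)
  (- (B * RtoC ((1 - r ^ 2) ^ 2) * Icpow (B - RtoC 1)%C r))).
rewrite Cmod_opp, <- Hmain in Htri.
replace (_ + _ + _)%C with ((B + RtoC 1) * Icpow (B + RtoC 1)%C r)%C in Htri by ring.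
rewrite (Cmod_mult (B + RtoC 1)%C) in Htri; fold K1 in Htri.
assert (H1 : K1 * c <= K1 * Cmod (Icpow (B + RtoC 1)%C r)) by (apply Rmult_le_compat_l; lra).
apply Rle_div_l; [lra|].
assert (H0 := Cmod_ge_0 (Icpow B r)).
assert (H2 : (1 + r ^ 2) * Cmod (Icpow B r) <= 2 * Cmod (Icpow B r)) by (apply Rmult_le_compat_r; nra).
assert (H3 : K2 * ((1 + r ^ 2) * Cmod (Icpow B r)) <= K2 * (2 * Cmod (Icpow B r)))
  by (apply Rmult_le_compat_l; lra).
lra.
Qed.

Lemma Icpow_bounded_below (B : C) : - (1 / 2) < Re B -> bounded_below (Icpow B).
Proof.
assert (H : forall n B, - (1 / 2) < Re B -> 2 + Rabs (Im B) <= Re B + INR n ->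
  bounded_below (Icpow B)).
{ induction n as [|n IH]; intros D H1 H2.
  - apply Icpow_bounded_below_large; simpl in H2; lra.
  - apply Icpow_bounded_below_step; [exact H1|].
    rewrite S_INR in H2; apply IH; rewrite re_plus, ?im_plus; simpl; [lra|].
    rewrite Rplus_0_r; lra. }
(* The steps leave [Im B] unchanged, so finitely many reach the large case; the additional [1]
   compensates for a negative [Re B > - 1/2]. *)
intros HB; destruct (nfloor_ex (2 + Rabs (Im B) + 1)) as [n Hn].
{ assert (H0 := Rabs_pos (Im B)); lra. }
apply H with (S n); [exact HB|rewrite S_INR; lra].
Qed.

(** * Rotations, disk automorphisms and the mass of the kernel *)

Lemma CInt_comp (f : R -> C) (g dg : R -> R) (a b : R) :
  (forall t, continuous f t) -> (forall t, is_derive g t (dg t)) ->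
  (forall t, continuous dg t) ->
  CInt (fun t => RtoC (dg t) * f (g t))%C a b = CInt f (g a) (g b).
Proof.
intros Hf Hg Hd.
rewrite <- (RInt_comp (V := C_R_CompleteNormedModule) f g dg a b); [|auto|auto].
apply CInt_ext; intros t; destruct (f (g t)) as [x y].
unfold Cmult, RtoC, scal; simpl; unfold prod_scal, scal; simpl; unfold mult; simpl.
f_equal; ring.
Qed.

Lemma CInt_periodic (f : R -> C) (u : R) :
  (forall t, continuous f t) -> (forall t, f (t + 2 * PI) = f t) ->
  CInt (fun t => f (t + u)) 0 (2 * PI) = CInt f 0 (2 * PI).
Proof.
intros Hf Hp.
assert (Hsh : forall v a b, CInt (fun t => f (t + v)) a b = CInt f (a + v) (b + v)).
{ intros v a b; rewrite <- (CInt_comp f (fun t => t + v) (fun _ => 1)).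
  - apply CInt_ext; intros t; ring.
  - exact Hf.
  - intros t; auto_derive; [easy|ring].
  - intros t; apply continuous_const. }
assert (Hch : forall a b c, CInt f a b = (CInt f a c + CInt f c b)%C).
{ intros a b c; symmetry; apply (RInt_Chasles (V := C_R_CompleteNormedModule));
    now apply ex_CInt. }
assert (H0 : forall a, CInt f a a = RtoC 0).
{ intros a; apply (RInt_point (V := C_R_CompleteNormedModule)). }
rewrite Hsh, Rplus_0_l, (Hch u _ 0), (Hch 0 _ (2 * PI)).
replace (2 * PI + u) with (u + 2 * PI) by ring; rewrite <- (Rplus_0_l (2 * PI)) at 2.
rewrite <- Hsh, (CInt_ext _ f 0 u Hp).
assert (H := Hch u u 0); rewrite H0 in H.
transitivity (CInt f 0 (2 * PI) + (CInt f u 0 + CInt f 0 u))%C; [C_ring|].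
rewrite <- H; C_ring.
Qed.

Lemma in_disk_polar (r u : R) : 0 <= r < 1 -> in_disk (RtoC r * cis u)%C.
Proof. intros Hr; unfold in_disk; rewrite Cmod_polar; lra. Qed.

Lemma polar_form (z : C) : exists u, z = (RtoC (Cmod z) * cis u)%C.
Proof.
destruct (Ceq_dec z (RtoC 0)) as [->|Hz].
- exists 0; rewrite Cmod_0; ring.
- exists (Carg z); now apply polar_Carg.
Qed.

Lemma gap_Cmod (z : C) : gap z = 1 - Cmod z ^ 2.
Proof. unfold gap; rewrite Cmod2_alt; ring. Qed.

Lemma gap_polar (r u : R) : gap (RtoC r * cis u)%C = 1 - r ^ 2.
Proof.
unfold gap; rewrite re_scal_l, im_scal_l; simpl; assert (H := cos_sin_sq u); nra.
Qed.

Lemma chord_sq_Cmod (z : C) (t : R) : chord_sq z t = Cmod (cis t - z)%C ^ 2.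
Proof. rewrite Cmod2_alt; unfold chord_sq, Re, Im; simpl; ring. Qed.

Lemma chord_sq_polar (r u t : R) :
  chord_sq (RtoC r * cis u)%C t = 1 - 2 * r * cos (t - u) + r ^ 2.
Proof.
unfold chord_sq; rewrite re_scal_l, im_scal_l, cos_minus; simpl.
assert (H := cos_sin_sq u); assert (H1 := cos_sin_sq t); nra.
Qed.

Lemma kernel_cpow (A z : C) (t : R) : in_disk z -> kernel A z t = cpow (gap z / chord_sq z t) A.
Proof.
intros Hz; unfold kernel, cpow, log_Poisson; now rewrite ln_div
  by (now apply in_disk_gap || now apply chord_sq_pos).
Qed.

Lemma continuous_kernel (A z : C) (t : R) : in_disk z -> continuous (kernel A z) t.
Proof.
intros Hz; destruct (jointly_continuous_kernels A) as (H & _).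
exact (jointly_continuous_snd in_disk _ H z t Hz).
Qed.

Definition kernel_mass (A z : C) : C := CInt (kernel A z) 0 (2 * PI).
Definition kernel_abs_mass (a : R) (z : C) : R :=
  RInt (fun t => Rpower (gap z / chord_sq z t) a) 0 (2 * PI).

Lemma Cmod_kernel (A z : C) (t : R) : in_disk z ->
  Cmod (kernel A z t) = Rpower (gap z / chord_sq z t) (Re A).
Proof. intros Hz; rewrite kernel_cpow by exact Hz; apply Cmod_cpow. Qed.

Lemma continuous_kernel_abs (a : R) (z : C) (t : R) : in_disk z ->
  continuous (fun t => Rpower (gap z / chord_sq z t) a) t.
Proof.
intros Hz; apply continuous_ext with (fun t => Cmod (kernel (RtoC a) z t)).
- intros s; now apply Cmod_kernel.
- apply (continuous_Cmod (kernel (RtoC a) z)); now apply continuous_kernel.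
Qed.

Lemma kernel_mass_RtoC (a : R) (z : C) : in_disk z ->
  kernel_mass (RtoC a) z = RtoC (kernel_abs_mass a z).
Proof.
intros Hz; unfold kernel_mass, kernel_abs_mass; rewrite <- CInt_RtoC.
- apply CInt_ext; intros t; rewrite kernel_cpow by exact Hz; apply cpow_RtoC.
- intros t; now apply continuous_kernel_abs.
Qed.

Lemma kernel_mass_polar (A : C) (r u : R) : 0 <= r < 1 ->
  kernel_mass A (RtoC r * cis u)%C = kernel_mass A (RtoC r).
Proof.
intros Hr; assert (Hd := in_disk_polar r u Hr).
assert (Hd0 := in_disk_polar r 0 Hr).
replace (RtoC r) with (RtoC r * cis 0)%C at 2 by (rewrite cis_0; ring).
unfold kernel_mass; rewrite <- (CInt_periodic (kernel A (RtoC r * cis 0)%C) (- u)).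
- apply CInt_ext; intros t; rewrite !kernel_cpow by assumption.
  rewrite !gap_polar, !chord_sq_polar; do 6 f_equal; ring.
- intros t; now apply continuous_kernel.
- intros t; rewrite !kernel_cpow by assumption; do 2 f_equal.
  rewrite !chord_sq_polar; do 3 f_equal; rewrite <- (cos_period (t - 0) 1); f_equal; simpl; ring.
Qed.

(* The boundary map [e^(iu) = (e^(it) - r) / (1 - r e^(it))] of the disk automorphism,
   lifted to the real line. *)
Definition boundary_lift (r t : R) : R := t + 2 * atan (r * sin t / (1 - r * cos t)).

Lemma cos_2atan (y : R) : cos (2 * atan y) = (1 - y ^ 2) / (1 + y ^ 2).
Proof.
rewrite cos_2a_cos, cos_atan.
assert (H : 0 < 1 + y ^ 2) by nra.
replace (2 * (1 / sqrt (1 + y²)) * (1 / sqrt (1 + y²))) with (2 / (sqrt (1 + y²) * sqrt (1 + y²))).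
- rewrite sqrt_sqrt by (unfold Rsqr; nra); unfold Rsqr; field; nra.
- field; apply Rgt_not_eq, sqrt_lt_R0; unfold Rsqr; nra.
Qed.

Lemma sin_2atan (y : R) : sin (2 * atan y) = 2 * y / (1 + y ^ 2).
Proof.
rewrite sin_2a, sin_atan, cos_atan.
assert (H : 0 < 1 + y ^ 2) by nra.
replace (2 * (y / sqrt (1 + y²)) * (1 / sqrt (1 + y²)))
  with (2 * y / (sqrt (1 + y²) * sqrt (1 + y²))).
- rewrite sqrt_sqrt by (unfold Rsqr; nra); unfold Rsqr; field; nra.
- field; apply Rgt_not_eq, sqrt_lt_R0; unfold Rsqr; nra.
Qed.

(** The boundary derivative of a disk automorphism is the Poisson kernel [P], and [1 + r e^(iu) = (1
    - r^2) / (1 - r e^(it))], so [q = (1 - r^2) P] at the image point. Hence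
    [q^B du = (1 - r^2)^B P^(B + 1) dt], which is the source of the shift from [B] to [B + 1]. *)
Lemma boundary_lift_facts (r t : R) : 0 <= r < 1 ->
  0 < 1 - 2 * r * cos t + r ^ 2 /\
  is_derive (boundary_lift r) t ((1 - r ^ 2) / (1 - 2 * r * cos t + r ^ 2)) /\
  qf r (boundary_lift r t) = (1 - r ^ 2) ^ 2 / (1 - 2 * r * cos t + r ^ 2).
Proof.
intros Hr; assert (Hcb := COS_bound t); assert (Hcs := cos_sin_sq t).
assert (H1 : 0 < 1 - r * cos t) by nra.
assert (H2 : 0 < 1 - 2 * r * cos t + r ^ 2).
{ replace (1 - 2 * r * cos t + r ^ 2) with ((1 - r) ^ 2 + 2 * r * (1 - cos t)) by ring.
  assert (0 < (1 - r) ^ 2) by (apply pow2_gt_0; lra); nra. }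
assert (Es : sin t ^ 2 = 1 - cos t ^ 2) by lra.
(* The argument of [atan] is minus the tangent of the argument of [1 - r e^(it)], whose squared
   modulus is the numerator on the right. *)
assert (Ey : 1 + (r * sin t / (1 - r * cos t)) ^ 2 =
  (1 - 2 * r * cos t + r ^ 2) / (1 - r * cos t) ^ 2).
{ replace ((r * sin t / (1 - r * cos t)) ^ 2) with (r ^ 2 * sin t ^ 2 / (1 - r * cos t) ^ 2)
    by (field; lra).
  rewrite Es; field; lra. }
split; [exact H2|split].
- unfold boundary_lift; evar_last.
  + apply (is_derive_plus (V := R_NormedModule) (fun t => t)); [apply is_derive_id|].
    apply (is_derive_scal (fun t => atan (r * sin t / (1 - r * cos t)))).
    apply (is_derive_comp atan (fun t => r * sin t / (1 - r * cos t))).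
    * apply is_derive_atan.
    * auto_derive; [lra|reflexivity].
  + unfold plus, scal, one; simpl; unfold mult; simpl; unfold Rsqr.
    replace (1 + r * sin t / (1 - r * cos t) * (r * sin t / (1 - r * cos t)))
      with ((1 - 2 * r * cos t + r ^ 2) / (1 - r * cos t) ^ 2) by (rewrite <- Ey; ring).
    set (D := 1 - 2 * r * cos t + r ^ 2) in *.
    transitivity (1 + 2 * (r * cos t * (1 - r * cos t) - r ^ 2 * sin t ^ 2) / D).
    * field; lra.
    * rewrite Es; unfold D; field; unfold D in H2; lra.
- unfold qf, boundary_lift; rewrite cos_plus, cos_2atan, sin_2atan, Ey.
  set (D := 1 - 2 * r * cos t + r ^ 2) in *.
  transitivity (1 + 2 * r * ((cos t * ((1 - r * cos t) ^ 2 - r ^ 2 * sin t ^ 2)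
    - 2 * r * sin t ^ 2 * (1 - r * cos t)) / D) + r ^ 2).
  + field; lra.
  + rewrite Es; unfold D; field; unfold D in H2; lra.
Qed.

Lemma kernel_mass_Icpow (B : C) (r : R) : 0 <= r < 1 ->
  kernel_mass (B + RtoC 1)%C (RtoC r) = (cpow (1 - r ^ 2) (- B) * Icpow B r)%C.
Proof.
intros Hr.
assert (Hd : in_disk (RtoC r)) by (unfold in_disk; rewrite Cmod_R, Rabs_pos_eq; lra).
assert (H1 : 0 < 1 - r ^ 2) by nra.
set (D := fun t => 1 - 2 * r * cos t + r ^ 2).
assert (HD : forall t, 0 < D t) by (intros t; now apply boundary_lift_facts).
assert (Hk : forall t, kernel (B + RtoC 1)%C (RtoC r) t = cpow ((1 - r ^ 2) / D t) (B + RtoC 1)%C).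
{ intros t; rewrite kernel_cpow by exact Hd; f_equal; unfold D.
  replace (RtoC r) with (RtoC r * cis 0)%C by (rewrite cis_0; ring).
  rewrite gap_polar, chord_sq_polar; do 5 f_equal; ring. }
assert (E : Icpow B r = CInt (fun t => RtoC ((1 - r ^ 2) / D t) *
  cpow (qf r (boundary_lift r t)) B)%C 0 (2 * PI)).
{ rewrite (CInt_comp (fun u => cpow (qf r u) B) (boundary_lift r)).
  (* The lift fixes [0] and [2 PI], so the interval of integration is preserved. *)
  - unfold boundary_lift; rewrite sin_0, sin_2PI, !Rmult_0_r; unfold Rdiv; rewrite !Rmult_0_l.
    rewrite atan_0, Rmult_0_r, !Rplus_0_r; reflexivity.
  - intros t; now apply continuous_cpow_qf.
  - intros t; now apply boundary_lift_facts.
  - intros t; assert (H2 := HD t); unfold D in *; continuity_tac; lra. }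
rewrite E, <- CInt_scal.
- apply CInt_ext; intros t; assert (Ht := HD t).
  assert (HP : 0 < (1 - r ^ 2) / D t) by now apply Rdiv_lt_0_compat.
  rewrite Hk, cpow_S by exact HP.
  destruct (boundary_lift_facts r t Hr) as (_ & _ & ->); fold (D t).
  replace ((1 - r ^ 2) ^ 2 / D t) with ((1 - r ^ 2) * ((1 - r ^ 2) / D t)) by (field; lra).
  rewrite cpow_mult by assumption.
  assert (Hi : (cpow (1 - r ^ 2) (- B) * cpow (1 - r ^ 2) B)%C = RtoC 1).
  { rewrite <- cpow_plus; replace (- B + B)%C with (RtoC 0) by ring.
    rewrite cpow_RtoC, Rpower_O by exact H1; reflexivity. }
  transitivity (RtoC ((1 - r ^ 2) / D t) * cpow ((1 - r ^ 2) / D t) B *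
    (cpow (1 - r ^ 2) (- B) * cpow (1 - r ^ 2) B))%C; [rewrite Hi|]; ring.
- intros t; apply continuous_Cmult.
  + assert (H2 := HD t); apply continuous_RtoC; unfold D in *; continuity_tac; lra.
  + apply (continuous_comp (boundary_lift r) (fun u => cpow (qf r u) B)).
    * apply (ex_derive_continuous (V := R_NormedModule)).
      destruct (boundary_lift_facts r t Hr) as (_ & H2 & _); eexists; exact H2.
    * now apply continuous_cpow_qf.
Qed.

Lemma kernel_abs_mass_Irpow (b r : R) : 0 <= r < 1 ->
  kernel_abs_mass (b + 1) (RtoC r) = Rpower (1 - r ^ 2) (- b) * Irpow b r.
Proof.
intros Hr; apply RtoC_inj.
assert (Hd : in_disk (RtoC r)) by (unfold in_disk; rewrite Cmod_R, Rabs_pos_eq; lra).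
rewrite <- kernel_mass_RtoC by exact Hd.
rewrite RtoC_plus, kernel_mass_Icpow, Icpow_RtoC, <- RtoC_opp, cpow_RtoC, RtoC_mult by exact Hr.
reflexivity.
Qed.

(** The two requirements of an approximate identity for the oscillating kernel [P^A]: its absolute
    mass is controlled by the modulus of its mass, and [(1 - r^2)^(Re A)], the size of [|P^A|] away
    from the boundary point approached, is negligible against that modulus. *)
Definition kernel_concentrates (A : C) : Prop :=
  (exists K, 0 < K /\ at_left 1 (fun r =>
     kernel_abs_mass (Re A) (RtoC r) <= K * Cmod (kernel_mass A (RtoC r)))) /\
  (forall eps, 0 < eps -> at_left 1 (fun r =>
     Rpower (1 - r ^ 2) (Re A) <= eps * Cmod (kernel_mass A (RtoC r)))).

(** Mass and absolute mass share the factor [(1 - r^2)^(- b)] with [b = Re A - 1 > - 1/2]; what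
    remains is [Icpow], bounded below, and [Irpow], bounded above. *)
Lemma kernel_concentrates_Re_pos (A : C) : 1 / 2 < Re A -> kernel_concentrates A.
Proof.
intros HA; set (B := (A - RtoC 1)%C).
assert (EA : A = (B + RtoC 1)%C) by (unfold B; ring).
assert (Ea : Re A = Re B + 1) by (rewrite EA at 1; apply re_plus).
set (b := Re B) in *.
assert (Hm : forall r, 0 <= r < 1 ->
  Cmod (kernel_mass A (RtoC r)) = Rpower (1 - r ^ 2) (- b) * Cmod (Icpow B r)).
{ intros r Hr; rewrite EA, kernel_mass_Icpow, Cmod_mult, Cmod_cpow by exact Hr; reflexivity. }
destruct (Icpow_bounded_below B) as [c [Hc Hlow]]; [fold b; lra|].
destruct (Irpow_bounded b) as [M HM]; [lra|].
split.
- exists ((Rabs M + 1) / c); assert (HMa := Rabs_pos M); split.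
  { apply Rdiv_lt_0_compat; lra. }
  generalize (filter_and _ _ at_left_1_range Hlow); apply filter_imp; intros r [Hr Hl].
  rewrite Hm, Ea, kernel_abs_mass_Irpow by exact Hr; specialize (HM r Hr).
  assert (HMb := Rle_abs M); assert (HP := Rpower_pos (1 - r ^ 2) (- b)).
  replace ((Rabs M + 1) / c * (Rpower (1 - r ^ 2) (- b) * Cmod (Icpow B r)))
    with (Rpower (1 - r ^ 2) (- b) * ((Rabs M + 1) * (Cmod (Icpow B r) / c))) by (field; lra).
  apply Rmult_le_compat_l; [lra|].
  assert (1 <= Cmod (Icpow B r) / c) by (apply -> Rle_div_r; lra); nra.
(* [k = 2 Re A - 1] is the excess of the exponent [Re A] over [- b]; it is positive exactly because
   [Re A > 1/2]. The constant [Rpower 2 k] comes from [1 - r^2 <= 2 (1 - r)]. *)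
- intros eps He; set (k := Re A + b).
  assert (Hk : 0 < k) by (unfold k; lra).
  assert (He' : 0 < eps * c / Rpower 2 k).
  { apply Rdiv_lt_0_compat; [now apply Rmult_lt_0_compat|apply Rpower_pos]. }
  generalize (filter_and _ _ (filter_and _ _ at_left_1_range Hlow) (Rpower_small k _ Hk He')).
  apply filter_imp; intros r [[Hr Hl] Hs]; rewrite Hm by exact Hr.
  replace (Re A) with (- b + k) by (unfold k; ring); rewrite Rpower_plus.
  assert (HP := Rpower_pos (1 - r ^ 2) (- b)).
  replace (eps * (Rpower (1 - r ^ 2) (- b) * Cmod (Icpow B r)))
    with (Rpower (1 - r ^ 2) (- b) * (eps * Cmod (Icpow B r))) by ring.
  apply Rmult_le_compat_l; [lra|].
  apply Rle_trans with (eps * c); [|apply Rmult_le_compat_l; lra].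
  apply Rle_trans with (Rpower (2 * (1 - r)) k).
  + apply Rpower_base_le; [lra|nra].
  + rewrite <- Rpower_mult_distr by lra.
    apply Rlt_le; apply Rlt_div_r in Hs; [lra|apply Rpower_pos].
Qed.

Lemma one_minus_cos_le (t : R) : 1 - cos t <= t ^ 2 / 2.
Proof.
assert (H : 1 - cos t = 2 * sin (t / 2) ^ 2).
{ replace t with (2 * (t / 2)) at 1 by field; rewrite cos_2a_sin; ring. }
assert (H1 : Rsqr (sin (t / 2)) <= Rsqr (t / 2)) by (apply Rsqr_le_abs_1, Rabs_sin_le).
unfold Rsqr in H1; nra.
Qed.

(* At [s = 0] the mass beats [(1 - r^2)^(1/2)] only by the logarithm [int_0^1 dt / (1 - r + t)]. *)
Lemma kernel_abs_mass_half (r : R) : 0 <= r < 1 ->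
  Rpower (1 - r ^ 2) (1 / 2) * - ln (1 - r) <= kernel_abs_mass (1 / 2) (RtoC r).
Proof.
intros Hr; assert (Hpi := PI_RGT_0); assert (Hpi2 := PI2_1).
assert (Hd : in_disk (RtoC r)) by (unfold in_disk; rewrite Cmod_R, Rabs_pos_eq; lra).
assert (Hc := fun t => continuous_kernel_abs (1 / 2) (RtoC r) t Hd).
unfold kernel_abs_mass.
rewrite <- (RInt_Chasles (V := R_CompleteNormedModule) _ 0 1 (2 * PI))
  by now apply ex_RInt_continuous_R.
assert (H2 : 0 <= RInt (fun t => Rpower (gap (RtoC r) / chord_sq (RtoC r) t) (1 / 2)) 1 (2 * PI)).
{ apply RInt_ge_0; [lra|now apply ex_RInt_continuous_R|].
  intros t _; apply Rlt_le, Rpower_pos. }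
assert (HI : is_RInt (fun t => Rpower (1 - r ^ 2) (1 / 2) * / (1 - r + t)) 0 1
  (Rpower (1 - r ^ 2) (1 / 2) * (ln (1 - r + 1) - ln (1 - r + 0)))).
{ apply (is_RInt_scal (V := R_NormedModule)).
  apply (is_RInt_derive (V := R_CompleteNormedModule) (fun t => ln (1 - r + t))).
  - intros t; rewrite Rmin_left, Rmax_right by lra; intros Ht; auto_derive; [lra|field; lra].
  - intros t; rewrite Rmin_left, Rmax_right by lra; intros Ht; continuity_tac; lra. }
assert (H1 : Rpower (1 - r ^ 2) (1 / 2) * (ln (1 - r + 1) - ln (1 - r + 0)) <=
  RInt (fun t => Rpower (gap (RtoC r) / chord_sq (RtoC r) t) (1 / 2)) 0 1).
{ rewrite <- (is_RInt_unique _ _ _ _ HI); apply RInt_le; [lra| | |].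
  - eexists; exact HI.
  - now apply ex_RInt_continuous_R.
  - intros t Ht; replace (RtoC r) with (RtoC r * cis 0)%C by (rewrite cis_0; ring).
    rewrite gap_polar, chord_sq_polar, Rminus_0_r.
    assert (H0 := COS_bound t); assert (H3 := one_minus_cos_le t).
    assert (Hg : 0 < 1 - r ^ 2) by nra.
    assert (Hs : 0 < (1 - r) ^ 2) by (apply pow2_gt_0; lra).
    assert (Hq : 0 < 1 - 2 * r * cos t + r ^ 2).
    { replace (1 - 2 * r * cos t + r ^ 2) with ((1 - r) ^ 2 + 2 * r * (1 - cos t)) by ring.
      nra. }
    (* The chord from [r] to [e^(it)] is at most the radial gap plus the arc. *)
    assert (Hq' : 1 - 2 * r * cos t + r ^ 2 <= (1 - r + t) ^ 2).
    { assert (H4 : r * (1 - cos t) <= 1 * (t ^ 2 / 2)) by (apply Rmult_le_compat; lra).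
      assert (0 <= (1 - r) * t) by (apply Rmult_le_pos; lra); lra. }
    unfold Rdiv at 2; rewrite <- Rpower_mult_distr; [|exact Hg|now apply Rinv_0_lt_compat].
    apply Rmult_le_compat_l; [apply Rlt_le, Rpower_pos|].
    replace (/ (1 - r + t)) with (Rpower (/ (1 - r + t) ^ 2) (1 / 2)).
    + apply Rpower_base_le; [lra|split; [apply Rinv_0_lt_compat, pow_lt; lra|]].
      now apply Rinv_le_contravar.
    + rewrite <- Rpower_pow by lra; rewrite <- Rpower_Ropp, Rpower_mult.
      replace (- INR 2 * (1 / 2)) with (- (1)) by (simpl; field).
      rewrite Rpower_Ropp, Rpower_1 by lra; reflexivity. }
assert (H3 : 0 <= ln (1 - r + 1)) by (rewrite <- ln_1; apply ln_le; lra).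
assert (HP := Rpower_pos (1 - r ^ 2) (1 / 2)).
rewrite Rplus_0_r in H1; assert (H4 := Rmult_le_pos _ _ (Rlt_le _ _ HP) H3).
eapply Rle_trans; [|apply Rplus_le_compat; [exact H1|exact H2]]; lra.
Qed.

(** The exponent is real, so the kernel is positive and its mass equals its absolute mass. *)
Lemma kernel_concentrates_half : kernel_concentrates (RtoC (1 / 2)).
Proof.
assert (Hm : forall r, 0 <= r < 1 ->
  Cmod (kernel_mass (RtoC (1 / 2)) (RtoC r)) = kernel_abs_mass (1 / 2) (RtoC r)).
{ intros r Hr; rewrite kernel_mass_RtoC by (unfold in_disk; rewrite Cmod_R, Rabs_pos_eq; lra).
  rewrite Cmod_R; apply Rabs_pos_eq.
  apply RInt_ge_0; [assert (H := PI_RGT_0); lra| |intros; apply Rlt_le, Rpower_pos].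
  apply ex_RInt_continuous_R; intros t; apply continuous_kernel_abs.
  unfold in_disk; rewrite Cmod_R, Rabs_pos_eq; lra. }
change (Re (RtoC (1 / 2))) with (1 / 2).
split.
- exists 1; split; [lra|].
  generalize at_left_1_range; apply filter_imp; intros r Hr; simpl Re; rewrite Hm by exact Hr; lra.
(* Once [1 - r < exp (- / eps)], the logarithm gained in [kernel_abs_mass_half] satisfies
   [eps * - ln (1 - r) >= 1]. *)
- intros eps He; assert (He' : 0 < exp (- / eps)) by apply exp_pos.
  assert (Hs : at_left 1 (fun r => 1 - r < exp (- / eps))).
  { apply at_left_1_small; [continuity_tac|lra]. }
  generalize (filter_and _ _ at_left_1_range Hs); apply filter_imp; intros r [Hr Hl]; simpl Re.
  rewrite Hm by exact Hr; assert (H := kernel_abs_mass_half r Hr).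
  assert (Hln : ln (1 - r) < - / eps) by (rewrite <- (ln_exp (- / eps)); apply ln_increasing; lra).
  assert (HP := Rpower_pos (1 - r ^ 2) (1 / 2)).
  apply Rle_trans with (eps * (Rpower (1 - r ^ 2) (1 / 2) * - ln (1 - r))).
  + assert (H1 : 1 <= eps * - ln (1 - r)).
    { apply Rle_trans with (eps * / eps); [rewrite Rinv_r; lra|apply Rmult_le_compat_l; lra]. }
    nra.
  + apply Rmult_le_compat_l; lra.
Qed.

Lemma spectral_kernel_concentrates (lambda : C) :
  ~ (Im lambda = 0 /\ Re lambda < - (1 / 4)) ->
  kernel_concentrates (spectral lambda + RtoC (1 / 2))%C.
Proof.
intros H; destruct (spectral_cases lambda H) as [H0|H0].
- apply kernel_concentrates_Re_pos; rewrite re_plus, re_RtoC; lra.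
- rewrite H0, Cplus_0_l; apply kernel_concentrates_half.
Qed.

(** * Boundary values *)

Lemma at_left_1_Cmod (P : R -> Prop) (xi : C) : on_circle xi -> at_left 1 P ->
  within in_disk (locally xi) (fun z => P (Cmod z)).
Proof.
intros Hxi HP.
assert (Hc : continuous Cmod xi) by (apply (continuous_Cmod (fun z => z)), continuous_id).
unfold continuous in Hc; rewrite Hxi in Hc; exact (Hc _ HP).
Qed.

Lemma kernel_mass_Cmod (A z : C) : in_disk z -> kernel_mass A z = kernel_mass A (RtoC (Cmod z)).
Proof.
intros Hz; destruct (polar_form z) as [u Hu]; rewrite Hu at 1; apply kernel_mass_polar.
split; [apply Cmod_ge_0|exact Hz].
Qed.

Lemma kernel_abs_mass_Cmod (a : R) (z : C) : in_disk z ->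
  kernel_abs_mass a z = kernel_abs_mass a (RtoC (Cmod z)).
Proof.
intros Hz; apply RtoC_inj; rewrite <- !kernel_mass_RtoC.
- now apply kernel_mass_Cmod.
- unfold in_disk; rewrite Cmod_R, Rabs_pos_eq; [exact Hz|apply Cmod_ge_0].
- exact Hz.
Qed.

Lemma on_circle_cis (t : R) : on_circle (cis t).
Proof. apply Cmod_cis. Qed.

Lemma continuous_circle_param (g : C -> C) (t : R) :
  continuous_on_circle g -> continuous (fun t => g (cis t)) t.
Proof.
intros Hg P HP.
assert (Hc : continuous cis t) by (apply (continuous_cis (fun t => t)), continuous_id).
assert (H : locally t (fun s => on_circle (cis s) -> P (g (cis s))))
  by exact (Hc _ (Hg (cis t) (on_circle_cis t) P HP)).
change (locally t (fun s => P (g (cis s)))); revert H; apply filter_imp.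
intros s Hs; apply Hs, on_circle_cis.
Qed.

Lemma continuous_bounded (f : R -> C) (a b : R) : a <= b -> (forall t, continuous f t) ->
  exists M, forall t, a <= t <= b -> Cmod (f t) <= M.
Proof.
intros Hab Hf.
destruct (continuity_ab_maj (fun t => Cmod (f t)) a b Hab) as [x [Hx _]].
- intros t _; apply continuity_pt_filterlim, (continuous_Cmod f), Hf.
- now exists (Cmod (f x)).
Qed.

(** By the triangle inequality [|e^(it) - z| >= delta / 2], so the Poisson kernel is at most
    [4 / delta^2] times [gap z]. *)
Lemma kernel_abs_far (a delta : R) (z xi : C) (t : R) : 0 <= a -> 0 < delta -> in_disk z ->
  Cmod (z - xi)%C < delta / 2 -> delta <= Cmod (cis t - xi)%C ->
  Rpower (gap z / chord_sq z t) a <= Rpower (4 / delta ^ 2) a * Rpower (gap z) a.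
Proof.
intros Ha Hd Hz Hzx Ht.
assert (Hg : 0 < gap z) by now apply in_disk_gap.
assert (H4 : 0 < 4 / delta ^ 2) by (apply Rdiv_lt_0_compat; [lra|apply pow_lt, Hd]).
rewrite Rpower_mult_distr by assumption.
assert (Hc := chord_sq_pos z t Hz).
apply Rpower_base_le; [exact Ha|split; [now apply Rdiv_lt_0_compat|]].
rewrite Rmult_comm; apply Rmult_le_compat_l; [lra|].
replace (4 / delta ^ 2) with (/ (delta / 2) ^ 2) by (field; lra).
apply Rinv_le_contravar; [apply pow_lt; lra|].
rewrite chord_sq_Cmod; apply pow_incr; split; [lra|].
assert (H := Cmod_triangle (cis t - z) (z - xi)).
replace (cis t - z + (z - xi))%C with (cis t - xi)%C in H by ring; lra.
Qed.

(** The usual splitting of the circle: near [xi], continuity of [g] is paired with the control of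
    the absolute mass; away from [xi], boundedness of [g] is paired with the decay of the kernel.
    Each part contributes [eps / 2]. *)
Lemma circle_transform_estimate (A xi : C) (g : C -> C) (eps : R) :
  kernel_concentrates A -> 0 <= Re A -> continuous_on_circle g -> on_circle xi -> 0 < eps ->
  within in_disk (locally xi) (fun z =>
    0 < Cmod (kernel_mass A z) /\
    Cmod (CInt (fun t => kernel A z t * g (cis t)) 0 (2 * PI) - g xi * kernel_mass A z)%C
      <= eps * Cmod (kernel_mass A z)).
Proof.
intros [[K [HK Hmass]] Hdecay] Ha Hg Hxi He; set (a := Re A) in *.
assert (Hpi := PI_RGT_0).
assert (Hgc := fun t => continuous_circle_param g t Hg).
destruct (continuous_bounded (fun t => (g (cis t) - g xi)%C) 0 (2 * PI)) as [M HM]; [lra| |].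
{ intros t; apply continuous_Cminus; [apply Hgc|apply continuous_const]. }
(* The last [/ 2] offsets [ball_Cmod]; the bound [eps / (2 K)] on the oscillation of [g], times the
   absolute mass, is at most [eps / 2] times the mass. *)
assert (He1 : 0 < eps / (2 * K) / 2) by (apply Rdiv_lt_0_compat; [apply Rdiv_lt_0_compat|]; lra).
destruct (Hg xi Hxi _ (locally_ball (g xi) (mkposreal _ He1))) as [delta Hdelta].
assert (Hnear : forall t, Cmod (cis t - xi)%C < delta -> Cmod (g (cis t) - g xi)%C <= eps / (2 * K)).
{ intros t Ht; assert (H := Hdelta (cis t) (Cmod_ball _ _ _ Ht) (on_circle_cis t)).
  apply ball_Cmod in H; simpl in H; lra. }
set (M' := Rabs M).
assert (HM' : forall t, 0 <= t <= 2 * PI -> Cmod (g (cis t) - g xi)%C <= M').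
{ intros t Ht; apply Rle_trans with (1 := HM t Ht), Rle_abs. }
set (Q := Rpower (4 / delta ^ 2) a).
assert (HQ : 0 < Q) by apply Rpower_pos.
assert (HM0 : 0 <= M') by apply Rabs_pos.
assert (HW : 0 < 2 * PI * (M' * Q) + 1).
{ assert (0 <= 2 * PI * (M' * Q)); [|lra].
  apply Rmult_le_pos; [lra|apply Rmult_le_pos; lra]. }
(* [M' * Q * (gap z)^a] bounds the far integrand; its integral over the circle is to be at most
   [eps / 2] times the mass. *)
assert (He2 : 0 < eps / 2 / (2 * PI * (M' * Q) + 1)) by (apply Rdiv_lt_0_compat; lra).
assert (Hd := cond_pos delta).
assert (Hloc : within in_disk (locally xi) (fun z => Cmod (z - xi)%C < delta / 2)).
{ apply filter_le_within.
  assert (Hc : continuous (fun z : C => Cmod (z - xi)%C) xi).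
  { apply continuous_Cmod, continuous_Cminus; [apply continuous_id|apply continuous_const]. }
  apply (Hc (fun y => y < delta / 2)), open_lt.
  replace (xi - xi)%C with (RtoC 0) by ring; rewrite Cmod_0; lra. }
assert (Hin : within in_disk (locally xi) in_disk).
{ unfold within; apply filter_forall; auto. }
generalize (filter_and _ _ (filter_and _ _ Hloc Hin) (filter_and _ _
  (at_left_1_Cmod _ xi Hxi Hmass) (at_left_1_Cmod _ xi Hxi (Hdecay _ He2)))).
apply filter_imp; intros z [[Hz1 Hz] [H1 H2]].
rewrite <- kernel_abs_mass_Cmod, <- kernel_mass_Cmod in H1 by exact Hz.
rewrite <- kernel_mass_Cmod, <- gap_Cmod in H2 by exact Hz.
assert (HP := Rpower_pos (gap z) a).
set (m := Cmod (kernel_mass A z)) in *.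
assert (Hm : 0 < m).
(* The decay property bounds a positive power of [gap z] by a multiple of [m], so the mass cannot
   vanish near the boundary. *)
{ apply Rnot_le_lt; intros Hm; assert (H3 := Rmult_le_compat_l _ _ _ (Rlt_le _ _ He2) Hm); lra. }
split; [exact Hm|].
assert (Hkc := fun t => continuous_kernel A z t Hz).
unfold kernel_mass; rewrite <- CInt_scal, <- CInt_minus; try exact Hkc.
2,3: intros t; apply continuous_Cmult; auto using continuous_const.
apply Rle_trans with (RInt (fun t => eps / (2 * K) * Rpower (gap z / chord_sq z t) a +
  M' * Q * Rpower (gap z) a) 0 (2 * PI)).
- apply Cmod_CInt_le; [lra| | |].
  + intros t; apply continuous_Cminus; apply continuous_Cmult; auto using continuous_const.
  + intros t; apply continuous_Rplus; [|apply continuous_const].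
    apply continuous_Rmult; [apply continuous_const|now apply continuous_kernel_abs].
  + intros t Ht.
    replace (kernel A z t * g (cis t) - g xi * kernel A z t)%C
      with (kernel A z t * (g (cis t) - g xi))%C by ring.
    rewrite Cmod_mult, Cmod_kernel by exact Hz; fold a.
    assert (Hk := Rpower_pos (gap z / chord_sq z t) a).
    destruct (Rlt_dec (Cmod (cis t - xi)%C) delta) as [Hn|Hn].
    * assert (H3 := Rmult_le_compat_l _ _ _ (Rlt_le _ _ Hk) (Hnear t Hn)).
      assert (0 <= M' * Q * Rpower (gap z) a) by (repeat apply Rmult_le_pos; lra); lra.
    * assert (H3 := kernel_abs_far a delta z xi t Ha Hd Hz Hz1 ltac:(lra)); fold Q in H3.
      assert (H4 := Rmult_le_compat _ _ _ _ (Rlt_le _ _ Hk) (Cmod_ge_0 _) H3 (HM' t Ht)).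
      assert (0 <= eps / (2 * K) * Rpower (gap z / chord_sq z t) a).
      { apply Rmult_le_pos; lra. }
      lra.
- replace (RInt _ 0 (2 * PI)) with
    (eps / (2 * K) * kernel_abs_mass a z + 2 * PI * (M' * Q * Rpower (gap z) a)).
  2:{ symmetry; apply is_RInt_unique.
      apply (is_RInt_plus (V := R_NormedModule)
        (fun t => eps / (2 * K) * Rpower (gap z / chord_sq z t) a)).
      - apply (is_RInt_scal (V := R_NormedModule)).
        apply (RInt_correct (V := R_CompleteNormedModule)), ex_RInt_continuous_R.
        intros t; now apply continuous_kernel_abs.
      - evar_last; [apply (is_RInt_const (V := R_NormedModule))|].
        unfold scal; simpl; unfold mult; simpl; ring. }
  assert (E1 : eps / (2 * K) * kernel_abs_mass a z <= eps / 2 * m).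
  { replace (eps / 2 * m) with (eps / (2 * K) * (K * m)) by (field; lra).
    apply Rmult_le_compat_l; lra. }
  assert (E2 : 2 * PI * (M' * Q * Rpower (gap z) a) <= eps / 2 * m).
  { apply Rle_trans with ((2 * PI * (M' * Q) + 1) * Rpower (gap z) a); [lra|].
    apply Rle_trans with ((2 * PI * (M' * Q) + 1) * (eps / 2 / (2 * PI * (M' * Q) + 1) * m)).
    - apply Rmult_le_compat_l; lra.
    - apply Req_le; field; lra. }
  lra.
Qed.

Lemma spherical_kernel_mass (lambda z : C) : in_disk z ->
  spherical lambda z = (RtoC (/ (2 * PI)) * kernel_mass (spectral lambda + RtoC (1 / 2)) z)%C.
Proof.
intros Hz; unfold spherical, circle_int, kernel_mass; f_equal.
apply CInt_ext; intros t; now apply Poisson_pow_kernel.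
Qed.

Lemma Poisson_transform_kernel (lambda z : C) (g : C -> C) : in_disk z ->
  Poisson_transform lambda g z =
  circle_transform (kernel (spectral lambda + RtoC (1 / 2))) (fun t => g (cis t)) z.
Proof.
intros Hz; unfold Poisson_transform, circle_int, circle_transform; f_equal.
apply CInt_ext; intros t; now rewrite Poisson_pow_kernel.
Qed.

Lemma Re_spectral_half (lambda : C) : 0 <= Re (spectral lambda + RtoC (1 / 2))%C.
Proof.
rewrite re_plus; assert (H := Re_Csqrt_ge_0 (lambda + RtoC (1 / 4))%C); unfold spectral.
rewrite re_RtoC; lra.
Qed.

Lemma Poisson_transform_boundary (lambda : C) (g : C -> C) :
  ~ (Im lambda = 0 /\ Re lambda < - (1 / 4)) -> continuous_on_circle g ->
  has_boundary_values lambda (Poisson_transform lambda g) g.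
Proof.
intros Hl Hg xi Hxi P [eps HP].
assert (He : 0 < eps / 2) by (assert (H := cond_pos eps); lra).
assert (Hin : within in_disk (locally xi) in_disk).
{ unfold within; apply filter_forall; auto. }
unfold filtermap.
generalize (filter_and _ _ Hin (circle_transform_estimate _ xi g (eps / 2)
  (spectral_kernel_concentrates lambda Hl) (Re_spectral_half lambda) Hg Hxi He)).
apply filter_imp; intros z (Hz & Hm & H); apply HP, Cmod_ball.
rewrite spherical_kernel_mass, Poisson_transform_kernel by exact Hz.
unfold circle_transform; set (A := (spectral lambda + RtoC (1 / 2))%C) in *.
set (m := kernel_mass A z) in *; set (I := RInt _ _ _) in *.
assert (Hm0 : m <> RtoC 0) by now apply Cmod_gt_0.
assert (Hpi : RtoC (/ (2 * PI)) <> RtoC 0).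
{ intros E; apply RtoC_inj in E; revert E; apply Rinv_neq_0_compat.
  assert (H0 := PI_RGT_0); lra. }
replace (RtoC (/ (2 * PI)) * I / (RtoC (/ (2 * PI)) * m) - g xi)%C with ((I - g xi * m) / m)%C
  by (field; now split).
rewrite Cmod_div by exact Hm0.
apply Rle_lt_trans with (eps / 2); [apply Rle_div_l; lra|].
assert (H0 := cond_pos eps); lra.
Qed.

Lemma Poisson_transform_harmonic (lambda : C) (g : C -> C) : continuous_on_circle g ->
  lambda_harmonic lambda (Poisson_transform lambda g).
Proof.
intros Hg.
destruct (circle_transform_harmonic (spectral lambda + RtoC (1 / 2)) lambda (fun t => g (cis t))
  (spectral_eigenvalue lambda) (fun t => continuous_circle_param g t Hg))
  as [(H1 & H2 & H3) HL].
set (h := circle_transform _ _) in *.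
assert (E : forall z, in_disk z -> h z = Poisson_transform lambda g z).
{ intros z Hz; symmetry; now apply Poisson_transform_kernel. }
destruct (C1_ext h _ E H1) as (G1 & Ex & Ey).
destruct (C1_ext (partial_x h) (partial_x (Poisson_transform lambda g))) as (G2 & Exx & _);
  [intros; now rewrite Ex|exact H2|].
destruct (C1_ext (partial_y h) (partial_y (Poisson_transform lambda g))) as (G3 & _ & Eyy);
  [intros; now rewrite Ey|exact H3|].
split; [now split|].
intros z Hz; unfold hyp_laplacian; rewrite Exx, Eyy, <- E by exact Hz; now apply HL.
Qed.

(** * Fourier modes of an eigenfunction *)

(** Here [p] is [Re] or [Im]. Partial derivatives, one of them continuous, give total
    differentiability, from which continuity and the chain rule in polar coordinates follow. *)
Lemma C1_component_filterdiff (p : C -> R) (h : C -> C) (px py : C -> R) (z : C) :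
  (forall w, in_disk w -> is_derive (fun x => p (h (x, Im w))) (Re w) (px w)) ->
  (forall w, in_disk w -> is_derive (fun y => p (h (Re w, y))) (Im w) (py w)) ->
  continuous px z -> in_disk z ->
  filterdiff (fun u : R * R => p (h (fst u, snd u))) (locally (Re z, Im z))
    (fun u => fst u * px z + snd u * py z).
Proof.
intros Hx Hy Hc Hz; destruct z as [x y].
apply (filterdiff_ext_lin _ (fun u : R * R => plus (scal (fst u) (px (x, y))) (scal (snd u) (py (x, y))))).
- apply (is_derive_filterdiff (fun a b => p (h (a, b))) x y (fun a b => px (a, b))).
  + generalize (open_in_disk (x, y) Hz); apply filter_imp; intros [a b] Hab.
    exact (Hx (a, b) Hab).
  + exact (Hy (x, y) Hz).
  + apply (continuous_ext px); [|exact Hc]; intros [a b]; reflexivity.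
- intros u; reflexivity.
Qed.

Lemma C1_Re_filterdiff (h : C -> C) (z : C) : C1_on_disk h -> in_disk z ->
  filterdiff (fun u : R * R => Re (h (fst u, snd u))) (locally (Re z, Im z))
    (fun u => fst u * Re (partial_x h z) + snd u * Re (partial_y h z)).
Proof.
intros Hh Hz.
apply (C1_component_filterdiff Re h (fun w => Re (partial_x h w)) (fun w => Re (partial_y h w)));
  [| | |exact Hz].
- intros w Hw; exact (is_derive_C_Re _ _ _ (C1_partial_x h w Hh Hw)).
- intros w Hw; exact (is_derive_C_Re _ _ _ (C1_partial_y h w Hh Hw)).
- destruct (Hh z Hz) as (_ & _ & H & _); now apply continuous_Re.
Qed.

Lemma C1_Im_filterdiff (h : C -> C) (z : C) : C1_on_disk h -> in_disk z ->
  filterdiff (fun u : R * R => Im (h (fst u, snd u))) (locally (Re z, Im z))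
    (fun u => fst u * Im (partial_x h z) + snd u * Im (partial_y h z)).
Proof.
intros Hh Hz.
apply (C1_component_filterdiff Im h (fun w => Im (partial_x h w)) (fun w => Im (partial_y h w)));
  [| | |exact Hz].
- intros w Hw; exact (is_derive_C_Im _ _ _ (C1_partial_x h w Hh Hw)).
- intros w Hw; exact (is_derive_C_Im _ _ _ (C1_partial_y h w Hh Hw)).
- destruct (Hh z Hz) as (_ & _ & H & _); now apply continuous_Im.
Qed.

Lemma C1_continuous (h : C -> C) (z : C) : C1_on_disk h -> in_disk z -> continuous h z.
Proof.
intros Hh Hz; destruct z as [x y]; apply continuous_C.
- apply (continuous_ext (fun u : R * R => Re (h (fst u, snd u)))); [intros []; reflexivity|].
  apply (filterdiff_continuous (K := R_AbsRing)
    (U := prod_NormedModule R_AbsRing R_NormedModule R_NormedModule) (V := R_NormedModule)).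
  eexists; exact (C1_Re_filterdiff h (x, y) Hh Hz).
- apply (continuous_ext (fun u : R * R => Im (h (fst u, snd u)))); [intros []; reflexivity|].
  apply (filterdiff_continuous (K := R_AbsRing)
    (U := prod_NormedModule R_AbsRing R_NormedModule R_NormedModule) (V := R_NormedModule)).
  eexists; exact (C1_Im_filterdiff h (x, y) Hh Hz).
Qed.

Lemma C1_chain_rule (h : C -> C) (x y : R -> R) (u dx dy : R) :
  C1_on_disk h -> in_disk (x u, y u) -> is_derive x u dx -> is_derive y u dy ->
  is_derive_C (fun v => h (x v, y v)) u
    (RtoC dx * partial_x h (x u, y u) + RtoC dy * partial_y h (x u, y u))%C.
Proof.
intros Hh Hz Hx Hy.
assert (HR := C1_Re_filterdiff h _ Hh Hz); assert (HI := C1_Im_filterdiff h _ Hh Hz).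
simpl in HR, HI; apply is_derive_C_pair.
- rewrite re_plus, !re_scal_l, (Rmult_comm dx), (Rmult_comm dy).
  apply is_derive_Reals, (derivable_pt_lim_comp_2d (fun a b => Re (h (a, b)))).
  + apply filterdiff_differentiable_pt_lim, HR.
  + now apply is_derive_Reals.
  + now apply is_derive_Reals.
- rewrite im_plus, !im_scal_l, (Rmult_comm dx), (Rmult_comm dy).
  apply is_derive_Reals, (derivable_pt_lim_comp_2d (fun a b => Im (h (a, b)))).
  + apply filterdiff_differentiable_pt_lim, HI.
  + now apply is_derive_Reals.
  + now apply is_derive_Reals.
Qed.

(** * Polar coordinates and angular modes *)

Definition polar (r t : R) : C := (r * cos t, r * sin t).

Lemma polar_mult (r t : R) : polar r t = (RtoC r * cis t)%C.
Proof. unfold polar, cis, Cmult, RtoC; simpl; f_equal; ring. Qed.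

Lemma in_disk_polar_abs (r t : R) : -1 < r < 1 -> in_disk (polar r t).
Proof.
intros Hr; apply in_disk_gap; unfold polar; simpl; assert (H := cos_sin_sq t); nra.
Qed.

Lemma C1_polar_r (h : C -> C) (r t : R) : C1_on_disk h -> -1 < r < 1 ->
  is_derive_C (fun s => h (polar s t)) r
    (RtoC (cos t) * partial_x h (polar r t) + RtoC (sin t) * partial_y h (polar r t))%C.
Proof.
intros Hh Hr.
apply (C1_chain_rule h (fun s => s * cos t) (fun s => s * sin t)); auto.
- exact (in_disk_polar_abs r t Hr).
- auto_derive; [easy|ring].
- auto_derive; [easy|ring].
Qed.

Lemma C1_polar_t (h : C -> C) (r t : R) : C1_on_disk h -> -1 < r < 1 ->
  is_derive_C (fun s => h (polar r s)) t
    (RtoC (- (r * sin t)) * partial_x h (polar r t)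
     + RtoC (r * cos t) * partial_y h (polar r t))%C.
Proof.
intros Hh Hr.
apply (C1_chain_rule h (fun s => r * cos s) (fun s => r * sin s)); auto.
- exact (in_disk_polar_abs r t Hr).
- auto_derive; [easy|ring].
- auto_derive; [easy|ring].
Qed.

Lemma jointly_continuous_polar (f : C -> C) : (forall z, in_disk z -> continuous f z) ->
  jointly_continuous (U := R_UniformSpace) (fun r => -1 < r < 1) (fun r t => f (polar r t)).
Proof.
intros Hf r t Hr.
apply (continuous_comp (U := prod_UniformSpace R_UniformSpace R_UniformSpace)
  (V := C_UniformSpace) (fun p : R * R => polar (fst p) (snd p)) f).
- assert (H1 : continuous (T := prod_UniformSpace R_UniformSpace R_UniformSpace)
    (fun p : R * R => fst p) (r, t)) by apply continuous_fst.
  assert (H2 : continuous (T := prod_UniformSpace R_UniformSpace R_UniformSpace)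
    (fun p : R * R => snd p) (r, t)) by apply continuous_snd.
  unfold polar; continuity_tac.
- now apply Hf, in_disk_polar_abs.
Qed.

Lemma locally_unit_interval (r : R) : -1 < r < 1 -> locally r (fun s => -1 < s < 1).
Proof.
intros Hr; apply (open_and (fun s => -1 < s) (fun s => s < 1) (open_gt (-1)) (open_lt 1)); lra.
Qed.

Definition fourier_char (k : Z) (t : R) : C := cis (- IZR k * t).

Lemma is_derive_fourier_char (k : Z) (t : R) :
  is_derive_C (fourier_char k) t (- (Ci * RtoC (IZR k)) * fourier_char k t)%C.
Proof.
evar_last.
- apply (is_derive_cis (fun t => - IZR k * t)); auto_derive; [easy|reflexivity].
- unfold fourier_char; rewrite Rmult_1_r, RtoC_opp; ring.
Qed.

Lemma continuous_fourier_char (k : Z) (t : R) : continuous (fourier_char k) t.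
Proof. eapply is_derive_C_continuous, is_derive_fourier_char. Qed.

Lemma cis_periodic_Z (k : Z) (t : R) : cis (t + 2 * IZR k * PI) = cis t.
Proof.
destruct (Z_le_dec 0 k) as [Hk|Hk].
- rewrite <- (Z2Nat.id k Hk), <- INR_IZR_INZ; unfold cis.
  now rewrite cos_period, sin_period.
- set (s := t + 2 * IZR k * PI); replace t with (s + 2 * INR (Z.to_nat (- k)) * PI).
  + unfold cis; now rewrite cos_period, sin_period.
  + rewrite INR_IZR_INZ, Z2Nat.id, opp_IZR by lia; unfold s; ring.
Qed.

Lemma fourier_char_periodic (k : Z) (t : R) : fourier_char k (t + 2 * PI) = fourier_char k t.
Proof.
unfold fourier_char; rewrite <- (cis_periodic_Z (- k) (- IZR k * t)), opp_IZR; f_equal; ring.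
Qed.

Definition mode (h : C -> C) (k : Z) (r : R) : C :=
  CInt (fun t => h (polar r t) * fourier_char k t)%C 0 (2 * PI).

(* The equation satisfied by [u r * e^(i k t)] being an eigenfunction of the hyperbolic
   Laplacian, multiplied by [r^2]. *)
Definition radial_solution (lambda : C) (k : Z) (u u1 u2 : R -> C) : Prop :=
  forall r, -1 < r < 1 ->
    is_derive_C u r (u1 r) /\ is_derive_C u1 r (u2 r) /\
    (RtoC (r ^ 2) * u2 r + RtoC r * u1 r =
     (RtoC (IZR k ^ 2) + RtoC (4 * r ^ 2 / (1 - r ^ 2) ^ 2) * lambda) * u r)%C.

(** In polar coordinates [r^2] times the Laplacian is [r^2 h_rr + r h_r + h_tt]. The radial
    derivatives pass under the integral sign, and integration by parts in the angle turns [h_tt]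
    into [- k^2 h]. *)
Lemma mode_radial_solution (lambda : C) (h : C -> C) (k : Z) : lambda_harmonic lambda h ->
  exists u1 u2, radial_solution lambda k (mode h k) u1 u2.
Proof.
intros [(H1 & Hx1 & Hy1) HL].
set (hx := partial_x h) in *; set (hy := partial_y h) in *.
set (hxx := partial_x hx); set (hxy := partial_y hx).
set (hyx := partial_x hy); set (hyy := partial_y hy).
assert (Cxx : forall z, in_disk z -> continuous hxx z)
  by (intros z Hz; now destruct (Hx1 z Hz) as (_ & _ & H & _)).
assert (Cxy : forall z, in_disk z -> continuous hxy z)
  by (intros z Hz; now destruct (Hx1 z Hz) as (_ & _ & _ & H)).
assert (Cyx : forall z, in_disk z -> continuous hyx z)
  by (intros z Hz; now destruct (Hy1 z Hz) as (_ & _ & H & _)).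
assert (Cyy : forall z, in_disk z -> continuous hyy z)
  by (intros z Hz; now destruct (Hy1 z Hz) as (_ & _ & _ & H)).
set (e := fourier_char k).
set (hr := fun r t => (RtoC (cos t) * hx (polar r t) + RtoC (sin t) * hy (polar r t))%C).
set (hrr := fun r t => (RtoC (cos t) * (RtoC (cos t) * hxx (polar r t) + RtoC (sin t) * hxy (polar r t))
  + RtoC (sin t) * (RtoC (cos t) * hyx (polar r t) + RtoC (sin t) * hyy (polar r t)))%C).
set (D := fun r : R => -1 < r < 1).
assert (J : forall f, (forall z, in_disk z -> continuous f z) ->
  jointly_continuous (U := R_UniformSpace) D (fun r t => f (polar r t)))
  by exact jointly_continuous_polar.
assert (J0 := J h (fun z => C1_continuous h z H1)).
assert (Jx := J hx (fun z => C1_continuous hx z Hx1)).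
assert (Jy := J hy (fun z => C1_continuous hy z Hy1)).
assert (Jxx := J hxx Cxx); assert (Jxy := J hxy Cxy).
assert (Jyx := J hyx Cyx); assert (Jyy := J hyy Cyy); clear J.
assert (Ct : forall r t, continuous (T := prod_UniformSpace R_UniformSpace R_UniformSpace)
  (fun p : R * R => snd p) (r, t)) by (intros; apply continuous_snd).
assert (Jr : jointly_continuous (U := R_UniformSpace) D hr).
{ intros r t Hr; specialize (Jx r t Hr); specialize (Jy r t Hr); specialize (Ct r t).
  unfold hr; continuity_tac. }
assert (Jrr : jointly_continuous (U := R_UniformSpace) D hrr).
{ intros r t Hr; specialize (Jxx r t Hr); specialize (Jxy r t Hr); specialize (Jyx r t Hr);
    specialize (Jyy r t Hr); specialize (Ct r t).
  unfold hrr; continuity_tac. }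
assert (Ce : forall t, continuous e t) by apply continuous_fourier_char.
assert (Dr : forall f f', jointly_continuous (U := R_UniformSpace) D f ->
  jointly_continuous (U := R_UniformSpace) D f' ->
  (forall r t, D r -> is_derive_C (fun s => f s t) r (f' r t)) -> forall r, D r ->
  is_derive_C (fun s => CInt (fun t => f s t * e t)%C 0 (2 * PI)) r
    (CInt (fun t => f' r t * e t)%C 0 (2 * PI))).
{ intros f f' Jf Jf' Hd r Hr.
  assert (Kf := jointly_continuous_mult e Ce D f Jf).
  assert (Kf' := jointly_continuous_mult e Ce D f' Jf').
  apply (is_derive_CInt_param D (fun s t => f s t * e t)%C (fun s t => f' s t * e t)%C);
    [now apply locally_unit_interval| | |exact Kf'].
  - intros v t Hv; exact (jointly_continuous_snd D _ Kf v t Hv).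
  - intros v t Hv; evar_last.
    + apply is_derive_Cmult; [now apply Hd|apply is_derive_C_const].
    + simpl; ring. }
exists (fun r => CInt (fun t => hr r t * e t)%C 0 (2 * PI)),
  (fun r => CInt (fun t => hrr r t * e t)%C 0 (2 * PI)).
intros r Hr; split; [|split].
- apply (Dr (fun s t => h (polar s t)) hr J0 Jr); [|exact Hr].
  intros s t Hs; exact (C1_polar_r h s t H1 Hs).
- apply (Dr hr hrr Jr Jrr); [|exact Hr].
  intros s t Hs; unfold hr, hrr; apply is_derive_Cplus; apply is_derive_Cscal.
  + exact (C1_polar_r hx s t Hx1 Hs).
  + exact (C1_polar_r hy s t Hy1 Hs).
- assert (S0 := fun t => jointly_continuous_snd D _ J0 r t Hr).
  assert (Sx := fun t => jointly_continuous_snd D _ Jx r t Hr).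
  assert (Sy := fun t => jointly_continuous_snd D _ Jy r t Hr).
  assert (Sxx := fun t => jointly_continuous_snd D _ Jxx r t Hr).
  assert (Sxy := fun t => jointly_continuous_snd D _ Jxy r t Hr).
  assert (Syx := fun t => jointly_continuous_snd D _ Jyx r t Hr).
  assert (Syy := fun t => jointly_continuous_snd D _ Jyy r t Hr).
  assert (Sr := fun t => jointly_continuous_snd D _ Jr r t Hr).
  assert (Srr := fun t => jointly_continuous_snd D _ Jrr r t Hr).
  set (ht := fun t => (RtoC (- (r * sin t)) * hx (polar r t) + RtoC (r * cos t) * hy (polar r t))%C).
  set (htt := fun t => (RtoC (- (r * cos t)) * hx (polar r t) + RtoC (- (r * sin t)) *
    (RtoC (- (r * sin t)) * hxx (polar r t) + RtoC (r * cos t) * hxy (polar r t)) +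
    (RtoC (- (r * sin t)) * hy (polar r t) + RtoC (r * cos t) *
    (RtoC (- (r * sin t)) * hyx (polar r t) + RtoC (r * cos t) * hyy (polar r t))))%C).
  assert (Stt : forall t, continuous htt t).
  { intros t; specialize (Sx t); specialize (Sy t); specialize (Sxx t); specialize (Sxy t);
      specialize (Syx t); specialize (Syy t); unfold htt; continuity_tac. }
  set (ik := (Ci * RtoC (IZR k))%C).
  assert (Hik : (ik * ik = - RtoC (IZR k ^ 2))%C).
  { unfold ik; replace (IZR k ^ 2) with (IZR k * IZR k) by ring.
    rewrite RtoC_mult; unfold Ci, Cmult, Copp, RtoC; simpl; f_equal; ring. }
  (* [d/dt ((H_t + i k H) e^(-ikt)) = (H_tt + k^2 H) e^(-ikt)] *)
  assert (Hang : (RtoC 0 = CInt (fun t => htt t * e t + RtoC (IZR k ^ 2) * (h (polar r t) * e t))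
    0 (2 * PI))%C).
  { rewrite (CInt_derive (fun t => (ht t + ik * h (polar r t)) * e t)%C).
    - assert (Ep : polar r (2 * PI) = polar r 0)
        by (unfold polar; now rewrite cos_2PI, sin_2PI, cos_0, sin_0).
      assert (Ee : e (2 * PI) = e 0).
      { unfold e; rewrite <- (fourier_char_periodic k 0); f_equal; ring. }
      unfold ht; rewrite Ep, Ee, cos_2PI, sin_2PI, cos_0, sin_0; ring.
    - intros t; evar_last.
      + apply is_derive_Cmult; [|apply is_derive_fourier_char].
        apply is_derive_Cplus; [|apply is_derive_Cscal; exact (C1_polar_t h r t H1 Hr)].
        apply is_derive_Cplus; apply is_derive_Cmult.
        * apply is_derive_RtoC; auto_derive; [easy|reflexivity].
        * exact (C1_polar_t hx r t Hx1 Hr).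
        * apply is_derive_RtoC; auto_derive; [easy|reflexivity].
        * exact (C1_polar_t hy r t Hy1 Hr).
      + simpl; fold hx hy hxx hxy hyx hyy ik; fold e.
        change (IZR k * (IZR k * 1)) with (IZR k ^ 2).
        replace (RtoC (IZR k ^ 2)) with (- (ik * ik))%C by (rewrite Hik; ring).
        unfold htt, ht; rewrite !Rmult_1_l.
        replace (r * - sin t) with (- (r * sin t)) by ring; ring.
    - intros t; specialize (S0 t); specialize (Stt t); specialize (Ce t); continuity_tac. }
  (* The first-order terms cancel between [hr] and [htt], and the terms in [hxy] and in [hyx] each
     cancel between [hrr] and [htt]; [cos^2 + sin^2 = 1] collects the rest. *)
  assert (Hlap : forall t, (RtoC (r ^ 2) * (hrr r t * e t) + RtoC r * (hr r t * e t) +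
    (htt t * e t) = RtoC (4 * r ^ 2 / (1 - r ^ 2) ^ 2) * lambda * (h (polar r t) * e t))%C).
  { intros t; assert (Hz := in_disk_polar_abs r t Hr).
    assert (Hh := HL _ Hz); unfold hyp_laplacian in Hh.
    fold hx hy in Hh; fold hxx hyy in Hh.
    replace (1 - Cmod (polar r t) ^ 2) with (1 - r ^ 2) in Hh.
    2:{ rewrite Cmod2_alt; unfold polar; simpl; assert (H := cos_sin_sq t); nra. }
    assert (Hg : 0 < 1 - r ^ 2) by nra.
    transitivity (RtoC (4 * r ^ 2 / (1 - r ^ 2) ^ 2) * (lambda * h (polar r t)) * e t)%C; [|ring].
    rewrite <- Hh.
    transitivity (RtoC (4 * r ^ 2 / (1 - r ^ 2) ^ 2 * ((1 - r ^ 2) ^ 2 / 4)) *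
      (hxx (polar r t) + hyy (polar r t)) * e t)%C; [|rewrite RtoC_mult; ring].
    replace (4 * r ^ 2 / (1 - r ^ 2) ^ 2 * ((1 - r ^ 2) ^ 2 / 4)) with (r ^ 2) by (field; lra).
    assert (Ecs : (RtoC (cos t) * RtoC (cos t) + RtoC (sin t) * RtoC (sin t) = RtoC 1)%C).
    { rewrite <- !RtoC_mult, <- RtoC_plus; f_equal; assert (H := cos_sin_sq t); lra. }
    unfold hrr, hr, htt; replace (r ^ 2) with (r * r) by ring.
    rewrite !RtoC_opp, !RtoC_mult.
    transitivity (RtoC r * RtoC r * ((RtoC (cos t) * RtoC (cos t) + RtoC (sin t) * RtoC (sin t)) *
      (hxx (polar r t) + hyy (polar r t))) * e t)%C; [ring|rewrite Ecs; ring]. }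
  assert (Sre : forall t, continuous (fun t => hr r t * e t)%C t)
    by (intros t; apply continuous_Cmult; [apply Sr|apply Ce]).
  assert (Srre : forall t, continuous (fun t => hrr r t * e t)%C t)
    by (intros t; apply continuous_Cmult; [apply Srr|apply Ce]).
  assert (Stte : forall t, continuous (fun t => htt t * e t)%C t)
    by (intros t; apply continuous_Cmult; [apply Stt|apply Ce]).
  assert (S0e : forall t, continuous (fun t => h (polar r t) * e t)%C t)
    by (intros t; apply continuous_Cmult; [apply S0|apply Ce]).
  rewrite CInt_plus, CInt_scal in Hang.
  2: exact S0e.
  2: exact Stte.
  2:{ intros t; apply continuous_Cmult; [apply continuous_const|apply S0e]. }
  unfold mode; fold e.
  assert (Hint : (RtoC (r ^ 2) * CInt (fun t => hrr r t * e t) 0 (2 * PI) +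
    RtoC r * CInt (fun t => hr r t * e t) 0 (2 * PI) + CInt (fun t => htt t * e t) 0 (2 * PI) =
    RtoC (4 * r ^ 2 / (1 - r ^ 2) ^ 2) * lambda * CInt (fun t => h (polar r t) * e t) 0 (2 * PI))%C).
  { rewrite <- (CInt_scal _ _ _ _ Srre), <- (CInt_scal _ _ _ _ Sre), <- (CInt_scal _ _ _ _ S0e).
    rewrite <- CInt_plus, <- CInt_plus.
    - apply CInt_ext, Hlap.
    - intros t; apply continuous_Cplus.
      + apply continuous_Cmult; [apply continuous_const|apply Srre].
      + apply continuous_Cmult; [apply continuous_const|apply Sre].
    - exact Stte.
    - intros t; apply continuous_Cmult; [apply continuous_const|apply Srre].
    - intros t; apply continuous_Cmult; [apply continuous_const|apply Sre]. }
  rewrite Cmult_plus_distr_r, <- Hint.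
  set (X := CInt (fun t => htt t * e t)%C 0 (2 * PI)) in *.
  set (Y := CInt (fun t => h (polar r t) * e t)%C 0 (2 * PI)) in *.
  set (P := CInt (fun t => hrr r t * e t)%C 0 (2 * PI)).
  set (Q := CInt (fun t => hr r t * e t)%C 0 (2 * PI)).
  transitivity (RtoC (r ^ 2) * P + RtoC r * Q + RtoC 0)%C; [ring|].
  rewrite Hang; ring.
Qed.

(** * The radial equation *)

Lemma radial_solution_minus (lambda c : C) (k : Z) (u u1 u2 v v1 v2 : R -> C) :
  radial_solution lambda k u u1 u2 -> radial_solution lambda k v v1 v2 ->
  radial_solution lambda k (fun r => u r - c * v r)%C (fun r => u1 r - c * v1 r)%C
    (fun r => u2 r - c * v2 r)%C.
Proof.
intros Hu Hv r Hr; destruct (Hu r Hr) as (U1 & U2 & U3); destruct (Hv r Hr) as (V1 & V2 & V3).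
assert (Hd : forall f g df dg, is_derive_C f r df -> is_derive_C g r dg ->
  is_derive_C (fun s => f s - c * g s)%C r (df - c * dg)%C).
{ intros f g df dg Hf Hg.
  apply (is_derive_minus (V := C_R_NormedModule) f (fun s => c * g s)%C r df (c * dg)%C Hf).
  now apply is_derive_Cscal. }
split; [|split]; [now apply Hd|now apply Hd|].
transitivity ((RtoC (r ^ 2) * u2 r + RtoC r * u1 r) - c * (RtoC (r ^ 2) * v2 r + RtoC r * v1 r))%C;
  [ring|rewrite U3, V3; ring].
Qed.

(** The derivative is prescribed in the open interval only: for the Wronskian the left end is [0],
    where the radial equation cannot be divided by [r]. *)
Lemma constant_of_derive_0 (f : R -> C) (a b : R) : a < b ->
  (forall x, a <= x <= b -> continuous f x) ->
  (forall x, a < x < b -> is_derive_C f x (RtoC 0)) -> f b = f a.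
Proof.
intros Hab Hc Hd.
assert (H : forall p : R -> R, (forall x, a <= x <= b -> continuous p x) ->
  (forall x, a < x < b -> is_derive p x 0) -> p b = p a).
{ intros p Hpc Hpd; destruct (MVT_gen p a b (fun _ => 0)) as [x [_ Hx]].
  - intros x; rewrite Rmin_left, Rmax_right by lra; apply Hpd.
  - intros x; rewrite Rmin_left, Rmax_right by lra; intros Hx.
    apply continuity_pt_filterlim, Hpc, Hx.
  - lra. }
rewrite (surjective_pairing (f b)), (surjective_pairing (f a)); f_equal.
- apply (H (fun x => Re (f x))).
  + intros x Hx; now apply continuous_Re, Hc.
  + intros x Hx; exact (is_derive_C_Re f x (RtoC 0) (Hd x Hx)).
- apply (H (fun x => Im (f x))).
  + intros x Hx; now apply continuous_Im, Hc.
  + intros x Hx; exact (is_derive_C_Im f x (RtoC 0) (Hd x Hx)).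
Qed.

(* [r (u v' - u' v)] is constant, and it vanishes at the singular point [r = 0]. *)
Lemma wronskian_zero (lambda : C) (k : Z) (u u1 u2 v v1 v2 : R -> C) (r : R) :
  radial_solution lambda k u u1 u2 -> radial_solution lambda k v v1 v2 -> 0 < r < 1 ->
  (u r * v1 r = u1 r * v r)%C.
Proof.
intros Hu Hv Hr.
set (W := fun s => (RtoC s * (u s * v1 s - u1 s * v s))%C).
assert (Hd : forall s, -1 < s < 1 -> is_derive_C W s
  ((u s * v1 s - u1 s * v s) + RtoC s * (u s * v2 s - u2 s * v s))%C).
{ intros s Hs; destruct (Hu s Hs) as (U1 & U2 & _); destruct (Hv s Hs) as (V1 & V2 & _).
  evar_last.
  - apply is_derive_Cmult.
    + apply is_derive_RtoC, (is_derive_id s).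
    + apply (is_derive_minus (V := C_R_NormedModule));
        [exact (is_derive_Cmult _ _ _ _ _ U1 V2)|exact (is_derive_Cmult _ _ _ _ _ U2 V1)].
  - unfold minus, plus, opp, one; simpl.
    change (RtoC 1 * (u s * v1 s - u1 s * v s) + RtoC s *
      ((u1 s * v1 s + u s * v2 s) - (u2 s * v s + u1 s * v1 s)) =
      (u s * v1 s - u1 s * v s) + RtoC s * (u s * v2 s - u2 s * v s))%C; ring. }
assert (HW : W r = W 0).
{ apply constant_of_derive_0; [lra| |].
  - intros s Hs; eapply is_derive_C_continuous, Hd; lra.
  - intros s Hs; assert (Hs' : -1 < s < 1) by lra.
    evar_last; [now apply Hd|].
    destruct (Hu s Hs') as (_ & _ & U3); destruct (Hv s Hs') as (_ & _ & V3).
    assert (H0 : RtoC s <> RtoC 0) by (intros E; apply RtoC_inj in E; lra).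
    replace (RtoC (s ^ 2)) with (RtoC s * RtoC s)%C in U3, V3 by (rewrite <- RtoC_mult; f_equal; ring).
    (* Both equations have the same zero-order coefficient, which drops out after cross
       multiplication. *)
    transitivity (((RtoC s * RtoC s * v2 s + RtoC s * v1 s) * u s -
      (RtoC s * RtoC s * u2 s + RtoC s * u1 s) * v s) / RtoC s)%C; [field; exact H0|].
    rewrite U3, V3; field; exact H0. }
unfold W in HW.
assert (H0 : RtoC r <> RtoC 0) by (intros E; apply RtoC_inj in E; lra).
transitivity (/ RtoC r * (RtoC r * (u r * v1 r - u1 r * v r)) + u1 r * v r)%C; [field; exact H0|].
rewrite HW; field; exact H0.
Qed.

(** From [|E'| <= L E], the function [E exp (- L y)] is nonincreasing and [E exp (L y)]
    nondecreasing. The former propagates the zero to the right of [x0], the latter to the left. *)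
Lemma gronwall_zero (E E' : R -> R) (L a b x0 x : R) :
  a <= x0 <= b -> a <= x <= b ->
  (forall y, a <= y <= b -> is_derive E y (E' y)) ->
  (forall y, a <= y <= b -> Rabs (E' y) <= L * E y) ->
  (forall y, 0 <= E y) -> E x0 = 0 -> E x = 0.
Proof.
intros Hx0 Hx Hd HL Hpos H0; apply Rle_antisym; [|apply Hpos].
assert (Hg : forall m y, a <= y <= b -> is_derive (fun y => E y * exp (m * y)) y
  ((E' y + m * E y) * exp (m * y))).
{ intros m y Hy; evar_last.
  - apply (is_derive_mult E (fun y => exp (m * y)) y (E' y) (m * exp (m * y))).
    + now apply Hd.
    + auto_derive; [easy|ring].
    + intros; apply Rmult_comm.
  - unfold plus, mult; simpl; ring. }
assert (H1 : a <= Rmin x0 x) by (apply Rmin_glb; lra).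
assert (H2 : Rmax x0 x <= b) by (apply Rmax_lub; lra).
assert (Hm : forall m, exists y, a <= y <= b /\
  E x * exp (m * x) = (E' y + m * E y) * exp (m * y) * (x - x0)).
{ intros m.
  destruct (MVT_gen (fun y => E y * exp (m * y)) x0 x (fun y => (E' y + m * E y) * exp (m * y)))
    as [y [Hy E1]].
  - intros y Hy; apply (Hg m y); lra.
  - intros y Hy; apply continuity_pt_filterlim.
    apply (ex_derive_continuous (V := R_NormedModule) (fun y => E y * exp (m * y)) y).
    eexists; apply (Hg m y); lra.
  - exists y; split.
    + lra.
    + rewrite H0, Rmult_0_l, Rminus_0_r in E1; exact E1. }
assert (Hfin : forall m y, a <= y <= b -> (E' y + m * E y) * (x - x0) <= 0 ->
  E x * exp (m * x) = (E' y + m * E y) * exp (m * y) * (x - x0) -> E x <= 0).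
{ intros m y Hy Hs E1; assert (H3 := exp_pos (m * x)); assert (H4 := exp_pos (m * y)).
  apply Rmult_le_reg_r with (exp (m * x)); [exact H3|rewrite Rmult_0_l, E1].
  replace (_ * (x - x0)) with ((E' y + m * E y) * (x - x0) * exp (m * y)) by ring.
  nra. }
destruct (Rle_dec x0 x) as [Hle|Hle].
- destruct (Hm (- L)) as (y & Hy & E1); apply (Hfin (- L) y Hy); [|exact E1].
  assert (H3 := HL y Hy); assert (H4 := Rle_abs (E' y)); nra.
- destruct (Hm L) as (y & Hy & E1); apply (Hfin L y Hy); [|exact E1].
  assert (H3 := HL y Hy); assert (H4 := Rle_abs (- E' y)); rewrite Rabs_Ropp in H4; nra.
Qed.

(** The left side is the modulus of the real part of [z * Cconj w]. *)
Lemma Re_Im_inner_le (z w : C) : Rabs (Re z * Re w + Im z * Im w) <= Cmod z * Cmod w.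
Proof.
assert (H := re_le_Cmod (z * Cconj w)%C).
rewrite Cmod_mult, Cmod_conj in H; eapply Rle_trans; [|exact H].
apply Req_le; f_equal; destruct z, w; simpl; ring.
Qed.

(** Uniqueness for the Cauchy problem away from the singular points [0] and [1]: between [r0] and
    [r] the coefficients are bounded, and the energy [E = |w|^2 + |w'|^2] obeys a Gronwall
    inequality. *)
Lemma radial_solution_zero (lambda : C) (k : Z) (w w1 w2 : R -> C) (r0 r : R) :
  radial_solution lambda k w w1 w2 -> 0 < r0 < 1 -> w r0 = RtoC 0 -> w1 r0 = RtoC 0 ->
  0 < r < 1 -> w r = RtoC 0.
Proof.
intros Hw Hr0 E0 E1 Hr.
set (E := fun s => (Re (w s) ^ 2 + Im (w s) ^ 2) + (Re (w1 s) ^ 2 + Im (w1 s) ^ 2)).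
set (E' := fun s => 2 * (Re (w s) * Re (w1 s) + Im (w s) * Im (w1 s))
  + 2 * (Re (w1 s) * Re (w2 s) + Im (w1 s) * Im (w2 s))).
set (a := Rmin r0 r); set (b := Rmax r0 r).
assert (Ha : 0 < a) by (apply Rmin_glb_lt; lra).
assert (Hb : b < 1) by (apply Rmax_lub_lt; lra).
assert (Hab : a <= b) by (apply Rle_trans with r0; [apply Rmin_l|apply Rmax_l]).
set (K := IZR k ^ 2 + 4 / (1 - b ^ 2) ^ 2 * Cmod lambda).
assert (Hb2 : 0 < 1 - b ^ 2) by nra.
assert (HE : E r = 0).
(* With [x = |w|], [y = |w'|] and [|w''| <= y / a + K x / a^2], one has [|E'| <= 2 x y + 2 y^2 / a +
   2 (K / a^2) x y], and [2 x y <= x^2 + y^2]. *)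
{ apply (gronwall_zero E E' (1 + 2 / a + K / a ^ 2) a b r0 r).
  - split; [apply Rmin_l|apply Rmax_l].
  - split; [apply Rmin_r|apply Rmax_r].
  - intros s Hs; destruct (Hw s ltac:(lra)) as (D1 & D2 & _).
    assert (A1 := is_derive_C_Re _ _ _ D1); assert (A2 := is_derive_C_Im _ _ _ D1).
    assert (A3 := is_derive_C_Re _ _ _ D2); assert (A4 := is_derive_C_Im _ _ _ D2).
    assert (Hsq : forall p dp, is_derive p s dp -> is_derive (fun y => p y ^ 2) s (2 * (p s * dp))).
    { intros p dp Hp; evar_last; [apply (is_derive_pow p 2 s dp Hp)|simpl; ring]. }
    evar_last.
    + apply (is_derive_plus (V := R_NormedModule) (fun y => Re (w y) ^ 2 + Im (w y) ^ 2));
        apply (is_derive_plus (V := R_NormedModule) (fun y => Re _ ^ 2));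
        [exact (Hsq _ _ A1)|exact (Hsq _ _ A2)|exact (Hsq _ _ A3)|exact (Hsq _ _ A4)].
    + unfold plus, E'; simpl; ring.
  - intros s Hs; destruct (Hw s ltac:(lra)) as (_ & _ & H3).
    assert (I1 := Re_Im_inner_le (w s) (w1 s)); assert (I2 := Re_Im_inner_le (w1 s) (w2 s)).
    assert (EE : E s = Cmod (w s) ^ 2 + Cmod (w1 s) ^ 2) by (unfold E; rewrite !Cmod2_alt; ring).
    assert (N0 := Cmod_ge_0 (w s)); assert (N1 := Cmod_ge_0 (w1 s)).
    assert (N2 : Cmod (w2 s) <= / a * Cmod (w1 s) + K / a ^ 2 * Cmod (w s)).
    { assert (Hs0 : RtoC s <> RtoC 0) by (intros F; apply RtoC_inj in F; lra).
      assert (Ew2 : w2 s = (- (RtoC (/ s) * w1 s) + RtoC (/ s ^ 2) *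
        ((RtoC (IZR k ^ 2) + RtoC (4 * s ^ 2 / (1 - s ^ 2) ^ 2) * lambda) * w s))%C).
      { rewrite <- H3, !RtoC_inv by (try apply pow_nonzero; lra).
        replace (s ^ 2) with (s * s) by ring; rewrite RtoC_mult; field; exact Hs0. }
      rewrite Ew2; eapply Rle_trans; [apply Cmod_triangle|]; rewrite Cmod_opp, !Cmod_mult, !Cmod_R.
      assert (Hinv : Rabs (/ s) <= / a).
      { rewrite Rabs_pos_eq by (apply Rlt_le, Rinv_0_lt_compat; lra).
        apply Rinv_le_contravar; lra. }
      assert (Hinv2 : Rabs (/ s ^ 2) <= / a ^ 2).
      { rewrite Rabs_pos_eq by (apply Rlt_le, Rinv_0_lt_compat, pow_lt; lra).
        apply Rinv_le_contravar; [apply pow_lt; lra|apply pow_incr; lra]. }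
      assert (HK : Cmod (RtoC (IZR k ^ 2) + RtoC (4 * s ^ 2 / (1 - s ^ 2) ^ 2) * lambda)%C <= K).
      { eapply Rle_trans; [apply Cmod_triangle|].
        rewrite Cmod_mult, !Cmod_R, (Rabs_pos_eq (IZR k ^ 2)) by apply pow2_ge_0.
        apply Rplus_le_compat_l, Rmult_le_compat_r; [apply Cmod_ge_0|].
        assert (Hs2 : 0 < 1 - b ^ 2 <= 1 - s ^ 2) by nra.
        assert (Hsb : / (1 - s ^ 2) ^ 2 <= / (1 - b ^ 2) ^ 2).
        { apply Rinv_le_contravar; [apply pow_lt; lra|apply pow_incr; lra]. }
        assert (Hsp : 0 < / (1 - s ^ 2) ^ 2) by (apply Rinv_0_lt_compat, pow_lt; lra).
        rewrite Rabs_pos_eq by (apply Rmult_le_pos; nra).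
        unfold Rdiv; apply Rmult_le_compat; nra. }
      apply Rplus_le_compat; [now apply Rmult_le_compat_r|].
      replace (K / a ^ 2 * Cmod (w s)) with (/ a ^ 2 * (K * Cmod (w s))) by (field; lra).
      apply Rmult_le_compat; [apply Rabs_pos| |exact Hinv2|now apply Rmult_le_compat_r].
      apply Rmult_le_pos; [apply Cmod_ge_0|exact N0]. }
    assert (HK0 : 0 <= K / a ^ 2).
    { apply Rle_div_r; [apply pow_lt, Ha|rewrite Rmult_0_l; unfold K].
      assert (0 <= IZR k ^ 2) by apply pow2_ge_0.
      assert (0 <= 4 / (1 - b ^ 2) ^ 2 * Cmod lambda).
      { apply Rmult_le_pos; [|apply Cmod_ge_0].
        apply Rlt_le, Rdiv_lt_0_compat; [lra|apply pow_lt, Hb2]. }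
      lra. }
    assert (Hia : 0 < / a) by now apply Rinv_0_lt_compat.
    rewrite EE; unfold E'; eapply Rle_trans; [apply Rabs_triang|].
    rewrite !Rabs_mult, (Rabs_pos_eq 2) by lra.
    set (x := Cmod (w s)) in *; set (y := Cmod (w1 s)) in *; set (q := K / a ^ 2) in *.
    assert (J2 : y * Cmod (w2 s) <= y * (/ a * y + q * x)) by now apply Rmult_le_compat_l.
    assert (Hxy : 2 * (x * y) <= x ^ 2 + y ^ 2) by (assert (H := pow2_ge_0 (x - y)); nra).
    assert (Hq : q * (2 * (x * y)) <= q * (x ^ 2 + y ^ 2)) by now apply Rmult_le_compat_l.
    assert (Hx2 : 0 <= / a * x ^ 2) by (apply Rmult_le_pos; [lra|apply pow2_ge_0]).
    unfold Rdiv; nra.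
  - intros s; unfold E; assert (H1 := pow2_ge_0 (Re (w s))); assert (H2 := pow2_ge_0 (Im (w s))).
    assert (H3 := pow2_ge_0 (Re (w1 s))); assert (H4 := pow2_ge_0 (Im (w1 s))); lra.
  - unfold E; rewrite E0, E1; simpl; ring. }
apply Cmod_eq_0; unfold E in HE.
assert (H1 := Cmod2_alt (w r)); assert (H2 := Cmod_ge_0 (w r)).
assert (H3 := pow2_ge_0 (Re (w1 r))); assert (H4 := pow2_ge_0 (Im (w1 r))); nra.
Qed.

(** For [c = u r0 / v r0], the solution [u - c v] vanishes at [r0]; since the Wronskian is zero, so
    does its derivative, and Cauchy uniqueness applies. *)
Lemma radial_solution_unique (lambda : C) (k : Z) (u u1 u2 v v1 v2 : R -> C) (r0 r : R) :
  radial_solution lambda k u u1 u2 -> radial_solution lambda k v v1 v2 ->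
  0 < r0 < 1 -> v r0 <> RtoC 0 -> 0 < r < 1 -> u r = (u r0 / v r0 * v r)%C.
Proof.
intros Hu Hv Hr0 Hv0 Hr; set (c := (u r0 / v r0)%C).
assert (H := radial_solution_zero lambda k _ _ _ r0 r
  (radial_solution_minus lambda c k u u1 u2 v v1 v2 Hu Hv) Hr0).
transitivity ((u r - c * v r) + c * v r)%C; [ring|rewrite H; [ring| | |exact Hr]].
- unfold c; field; exact Hv0.
- assert (HW := wronskian_zero lambda k u u1 u2 v v1 v2 r0 Hu Hv Hr0).
  transitivity ((u1 r0 * v r0 - u r0 * v1 r0) / v r0)%C; [unfold c; field; exact Hv0|].
  rewrite HW; field; exact Hv0.
Qed.

(** * Uniqueness *)

Lemma spherical_polar (lambda : C) (r t : R) : 0 <= r < 1 ->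
  spherical lambda (polar r t) = spherical lambda (RtoC r).
Proof.
intros Hr; rewrite !spherical_kernel_mass, polar_mult, kernel_mass_polar; try easy.
- unfold in_disk; rewrite Cmod_R, Rabs_pos_eq; lra.
- apply in_disk_polar_abs; lra.
Qed.

Lemma spherical_neq_0 (lambda : C) : ~ (Im lambda = 0 /\ Re lambda < - (1 / 4)) ->
  at_left 1 (fun r => spherical lambda (RtoC r) <> RtoC 0).
Proof.
intros Hl; destruct (spectral_kernel_concentrates lambda Hl) as [_ H].
generalize (filter_and _ _ at_left_1_range (H 1 Rlt_0_1)); apply filter_imp; intros r [Hr Hm].
rewrite spherical_kernel_mass by (unfold in_disk; rewrite Cmod_R, Rabs_pos_eq; lra).
apply Cmult_neq_0.
- intros E; apply RtoC_inj in E; revert E; apply Rinv_neq_0_compat.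
  assert (H0 := PI_RGT_0); lra.
- apply Cmod_gt_0; eapply Rlt_le_trans; [apply Rpower_pos|]; rewrite Rmult_1_l in Hm; exact Hm.
Qed.

(** The limits are unrestricted, so each boundary point controls a full neighbourhood in the disk;
    compactness of [[0, 2 PI]] makes the radius uniform in the angle, as integration over the circle
    requires. *)
Lemma uniform_boundary_values (lambda : C) (h g : C -> C) (eps : R) :
  ~ (Im lambda = 0 /\ Re lambda < - (1 / 4)) -> continuous_on_circle g ->
  has_boundary_values lambda h g -> 0 < eps ->
  at_left 1 (fun r => forall t, 0 <= t <= 2 * PI ->
    Cmod (h (polar r t) - g (cis t) * spherical lambda (RtoC r))%C
      <= eps * Cmod (spherical lambda (RtoC r))).
Proof.
intros Hl Hg Hb He.
(* Two comparisons with [g (cis t)], each doubled by [ball_Cmod]. *)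
assert (He4 : 0 < eps / 4) by lra; set (e := mkposreal _ He4).
assert (Hd : forall t, exists d : posreal, forall r s, 0 <= r < 1 -> 1 - r < d ->
  Rabs (s - t) < d -> Cmod (h (polar r s) / spherical lambda (polar r s) - g (cis s))%C < eps).
{ intros t.
  destruct (Hb (cis t) (on_circle_cis t) _ (locally_ball (g (cis t)) e)) as [d1 H1].
  destruct (continuous_circle_param g t Hg _ (locally_ball (g (cis t)) e)) as [d2 H2].
  (* The distance from [polar r s] to [cis t] is at most [(1 - r) + |s - t|], hence the half of
     [d1]. *)
  assert (Hp : 0 < Rmin (d1 / 2) d2).
  { apply Rmin_pos; [assert (H := cond_pos d1); lra|apply cond_pos]. }
  exists (mkposreal _ Hp); simpl; intros r s Hr Hrd Hsd.
  assert (M1 := Rmin_l (d1 / 2) d2); assert (M2 := Rmin_r (d1 / 2) d2).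
  assert (B1 : Cmod (polar r s - cis t)%C < d1).
  { assert (T := Cmod_triangle (RtoC (r - 1) * cis s) (cis s - cis t)).
    replace (RtoC (r - 1) * cis s + (cis s - cis t))%C with (polar r s - cis t)%C in T
      by (rewrite polar_mult, RtoC_minus; ring).
    rewrite Cmod_mult, Cmod_R, Cmod_cis, Rabs_left1 in T by lra.
    assert (T2 := Cmod_cis_minus s t); lra. }
  assert (B2 : ball t d2 s) by (apply Rlt_le_trans with (1 := Hsd), M2).
  assert (C1 := H1 _ (Cmod_ball _ _ _ B1) (in_disk_polar_abs r s ltac:(lra))).
  assert (C2 := H2 _ B2); apply ball_Cmod in C1; apply ball_Cmod in C2; simpl in C1, C2.
  assert (T := Cmod_triangle (h (polar r s) / spherical lambda (polar r s) - g (cis t))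
    (- (g (cis s) - g (cis t)))).
  rewrite Cmod_opp in T.
  replace (_ - g (cis t) + - (g (cis s) - g (cis t)))%C with
    (h (polar r s) / spherical lambda (polar r s) - g (cis s))%C in T by ring.
  lra. }
pose (delta t := proj1_sig (constructive_indefinite_description _ (Hd t))).
assert (Hdelta : forall t r s, 0 <= r < 1 -> 1 - r < delta t -> Rabs (s - t) < delta t ->
  Cmod (h (polar r s) / spherical lambda (polar r s) - g (cis s))%C < eps).
{ intros t; exact (proj2_sig (constructive_indefinite_description _ (Hd t))). }
clearbody delta; clear Hd.
destruct (compactness_value_1d 0 (2 * PI) delta) as [d Hd].
assert (Hd1 : at_left 1 (fun r => 1 - r < d)).
{ apply at_left_1_small; [continuity_tac|assert (H := cond_pos d); lra]. }
generalize (filter_and _ _ (filter_and _ _ at_left_1_range Hd1) (spherical_neq_0 lambda Hl)).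
apply filter_imp; intros r [[Hr Hrd] H0] t Ht.
assert (Hlt : Cmod (h (polar r t) / spherical lambda (polar r t) - g (cis t))%C < eps).
{ apply Rnot_le_lt; intros Hn; apply (Hd t Ht); intros (s & Hs & Hts & Hds).
  apply (Rle_not_lt _ _ Hn), (Hdelta s); [exact Hr|lra|exact Hts]. }
rewrite spherical_polar in Hlt by exact Hr.
set (p := spherical lambda (RtoC r)) in *.
replace (h (polar r t) - g (cis t) * p)%C with ((h (polar r t) / p - g (cis t)) * p)%C
  by (field; exact H0).
rewrite Cmod_mult; apply Rmult_le_compat_r; [apply Cmod_ge_0|lra].
Qed.

Definition boundary_mode (g : C -> C) (k : Z) : C :=
  CInt (fun t => g (cis t) * fourier_char k t)%C 0 (2 * PI).

Lemma Cmod_fourier_char (k : Z) (t : R) : Cmod (fourier_char k t) = 1.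
Proof. apply Cmod_cis. Qed.

Lemma continuous_polar (h : C -> C) (r t : R) : C1_on_disk h -> -1 < r < 1 ->
  continuous (fun t => h (polar r t)) t.
Proof.
intros Hh Hr.
exact (jointly_continuous_snd (fun r => -1 < r < 1) _
  (jointly_continuous_polar h (fun z => C1_continuous h z Hh)) r t Hr).
Qed.

Lemma mode_asymptotics (lambda : C) (h g : C -> C) (k : Z) (eps : R) :
  ~ (Im lambda = 0 /\ Re lambda < - (1 / 4)) -> continuous_on_circle g -> C1_on_disk h ->
  has_boundary_values lambda h g -> 0 < eps ->
  at_left 1 (fun r => Cmod (mode h k r - boundary_mode g k * spherical lambda (RtoC r))%C
    <= 2 * PI * eps * Cmod (spherical lambda (RtoC r))).
Proof.
intros Hl Hg Hh Hb He; assert (Hpi := PI_RGT_0).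
generalize (filter_and _ _ at_left_1_range (uniform_boundary_values lambda h g eps Hl Hg Hb He)).
apply filter_imp; intros r [Hr Hu].
assert (Hr' : -1 < r < 1) by lra.
assert (Sh := fun t => continuous_polar h r t Hh Hr').
assert (Sg := fun t => continuous_circle_param g t Hg).
assert (Se := continuous_fourier_char k).
set (p := spherical lambda (RtoC r)) in *.
unfold mode, boundary_mode; rewrite Cmult_comm, <- CInt_scal, <- CInt_minus.
- rewrite Rmult_assoc, <- RInt_0_2PI_const; apply Cmod_CInt_le; [lra| | |].
  + intros t; apply continuous_Cminus; [|apply continuous_Cmult; [apply continuous_const|]];
      apply continuous_Cmult; auto.
  + intros t; apply continuous_const.
  + intros t Ht.
    replace (h (polar r t) * fourier_char k t - p * (g (cis t) * fourier_char k t))%C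
      with ((h (polar r t) - g (cis t) * p) * fourier_char k t)%C by ring.
    rewrite Cmod_mult, Cmod_fourier_char, Rmult_1_r; now apply Hu.
- intros t; apply continuous_Cmult; auto.
- intros t; apply continuous_Cmult; [apply continuous_const|apply continuous_Cmult; auto].
- intros t; apply continuous_Cmult; auto.
Qed.

(** Boundary data are functions on all of [C]; this is a continuous extension of [e^(ikt)], with
    powers of the conjugate for negative [k]. *)
Definition circle_char (k : Z) (z : C) : C :=
  if Z_le_dec 0 k then (z ^ Z.to_nat k)%C else (Cconj z ^ Z.to_nat (- k))%C.

Lemma cis_pow (t : R) (n : nat) : (cis t ^ n)%C = cis (INR n * t).
Proof.
induction n as [|n IH].
- simpl; rewrite Rmult_0_l, cis_0; reflexivity.
- rewrite Cpow_S, IH, <- cis_plus, S_INR; f_equal; ring.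
Qed.

Lemma circle_char_cis (k : Z) (t : R) : circle_char k (cis t) = cis (IZR k * t).
Proof.
unfold circle_char; destruct (Z_le_dec 0 k) as [Hk|Hk].
- rewrite cis_pow, INR_IZR_INZ, Z2Nat.id by lia; reflexivity.
- replace (Cconj (cis t)) with (cis (- t)).
  + rewrite cis_pow, INR_IZR_INZ, Z2Nat.id, opp_IZR by lia; f_equal; ring.
  + unfold Cconj, cis; simpl; rewrite cos_neg, sin_neg; reflexivity.
Qed.

Lemma continuous_circle_char (k : Z) : continuous_on_circle (circle_char k).
Proof.
intros xi _; eapply filterlim_filter_le_1; [apply filter_le_within|].
unfold circle_char; destruct (Z_le_dec 0 k).
- apply (continuous_Cpow (fun z => z)), continuous_id.
- apply (continuous_Cpow Cconj), continuous_C; simpl.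
  + apply (continuous_Re (fun z => z)), continuous_id.
  + apply continuous_Ropp, (continuous_Im (fun z => z)), continuous_id.
Qed.

Lemma boundary_mode_circle_char (k : Z) : boundary_mode (circle_char k) k = RtoC (2 * PI).
Proof.
unfold boundary_mode; rewrite (CInt_ext _ (fun _ => RtoC 1)).
- rewrite CInt_const, Rminus_0_r; C_ring.
- intros t; rewrite circle_char_cis; unfold fourier_char; rewrite <- cis_plus.
  replace (IZR k * t + - IZR k * t) with 0 by ring; apply cis_0.
Qed.

Lemma modes_eq (lambda : C) (h h' g : C -> C) (k : Z) (r : R) :
  ~ (Im lambda = 0 /\ Re lambda < - (1 / 4)) -> continuous_on_circle g ->
  lambda_harmonic lambda h -> has_boundary_values lambda h g ->
  lambda_harmonic lambda h' -> has_boundary_values lambda h' g ->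
  0 < r < 1 -> mode h k r = mode h' k r.
Proof.
intros Hl Hg Hh Hb Hh' Hb' Hr; assert (Hpi := PI_RGT_0).
set (v := Poisson_transform lambda (circle_char k)).
assert (Hv := Poisson_transform_harmonic lambda (circle_char k) (continuous_circle_char k)).
assert (Hvb := Poisson_transform_boundary lambda (circle_char k) Hl (continuous_circle_char k)).
fold v in Hv, Hvb.
destruct (mode_radial_solution lambda h k Hh) as (a1 & a2 & Ha).
destruct (mode_radial_solution lambda h' k Hh') as (b1 & b2 & Hb2).
destruct (mode_radial_solution lambda v k Hv) as (v1 & v2 & Hv2).
assert (Hu := radial_solution_minus lambda (RtoC 1) k _ _ _ _ _ _ Ha Hb2).
set (u := fun r => (mode h k r - RtoC 1 * mode h' k r)%C) in Hu.
set (p := fun r => spherical lambda (RtoC r)).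
(* The boundary mode of [circle_char k] is [2 PI]; an error of [2 PI * (1 / 2)] leaves [PI]. *)
assert (Vlow : at_left 1 (fun r => 0 < r < 1 /\ 0 < Cmod (p r) /\ PI * Cmod (p r) <= Cmod (mode v k r))).
{ assert (H := mode_asymptotics lambda v (circle_char k) k (1 / 2) Hl (continuous_circle_char k)
    (proj1 (proj1 Hv)) Hvb ltac:(lra)).
  assert (H01 : at_left 1 (fun r => 0 < r < 1)) by (apply at_left_1_intro with 0; [lra|auto]).
  generalize (filter_and _ _ H01 (filter_and _ _ (spherical_neq_0 lambda Hl) H)).
  apply filter_imp; intros s (Hs & H0 & H1); fold (p s) in H0, H1.
  rewrite boundary_mode_circle_char in H1.
  split; [exact Hs|split; [now apply Cmod_gt_0|]].
  assert (T := Cmod_triangle (mode v k s) (- (mode v k s - RtoC (2 * PI) * p s))).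
  rewrite Cmod_opp in T.
  replace (mode v k s + - (mode v k s - RtoC (2 * PI) * p s))%C with (RtoC (2 * PI) * p s)%C in T
    by ring.
  rewrite Cmod_mult, Cmod_R, Rabs_pos_eq in T by lra; lra. }
destruct (at_left_1_elim _ Vlow) as (r0 & Hr0 & Hlow).
set (s := (r0 + 1) / 2).
destruct (Hlow s) as (Hs & Hps & Hvs); [unfold s; lra|].
assert (Hv0 : mode v k s <> RtoC 0).
{ apply Cmod_gt_0; apply Rlt_le_trans with (2 := Hvs); now apply Rmult_lt_0_compat. }
set (c := (u s / mode v k s)%C).
assert (Hc : forall t, 0 < t < 1 -> u t = (c * mode v k t)%C).
{ intros t Ht; exact (radial_solution_unique lambda k _ _ _ _ _ _ s t Hu Hv2 Hs Hv0 Ht). }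
(* Near the boundary [|c| * PI * |p| <= |u| <= 2 * (2 PI eps |p|)], as both modes are within
   [2 PI eps |p|] of the same multiple of [p]. *)
assert (Hsmall : forall eps, 0 < eps -> Cmod c <= 4 * eps).
{ intros eps He.
  assert (A1 := mode_asymptotics lambda h g k eps Hl Hg (proj1 (proj1 Hh)) Hb He).
  assert (A2 := mode_asymptotics lambda h' g k eps Hl Hg (proj1 (proj1 Hh')) Hb' He).
  destruct (filter_ex _ (filter_and _ _ Vlow (filter_and _ _ A1 A2)))
    as (t & (Ht & Hp & Hvt) & B1 & B2).
  fold (p t) in B1, B2.
  assert (T := Cmod_triangle (mode h k t - boundary_mode g k * p t)
    (- (mode h' k t - boundary_mode g k * p t))).
  rewrite Cmod_opp in T.
  replace (_ + - _)%C with (u t) in T by (unfold u; ring).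
  rewrite (Hc t Ht), Cmod_mult in T.
  assert (H1 := Rmult_le_compat_l _ _ _ (Cmod_ge_0 c) Hvt).
  apply Rmult_le_reg_r with (PI * Cmod (p t)); [now apply Rmult_lt_0_compat|lra]. }
assert (Hc0 : c = RtoC 0).
{ apply Cmod_eq_0, Rle_antisym; [|apply Cmod_ge_0].
  apply Rnot_lt_le; intros Hpos; specialize (Hsmall (Cmod c / 8) ltac:(lra)); lra. }
specialize (Hc r Hr); rewrite Hc0 in Hc; unfold u in Hc.
transitivity ((mode h k r - RtoC 1 * mode h' k r) + mode h' k r)%C; [ring|rewrite Hc; ring].
Qed.

(** * Continuous periodic functions with zero Fourier coefficients *)

Definition vanishing_modes (F : R -> C) : Prop :=
  forall k : Z, CInt (fun t => F t * fourier_char k t)%C 0 (2 * PI) = RtoC 0.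

Lemma fourier_char_mult (j k : Z) (t : R) :
  (fourier_char j t * fourier_char k t)%C = fourier_char (j + k) t.
Proof. unfold fourier_char; rewrite <- cis_plus, plus_IZR; f_equal; ring. Qed.

Lemma vanishing_modes_scal (c : C) (F : R -> C) : (forall t, continuous F t) ->
  vanishing_modes F -> vanishing_modes (fun t => c * F t)%C.
Proof.
intros HF H k; rewrite (CInt_ext _ (fun t => c * (F t * fourier_char k t))%C) by (intros; ring).
rewrite CInt_scal, H; [C_ring|].
intros t; apply continuous_Cmult; [apply HF|apply continuous_fourier_char].
Qed.

(** Since [cos t] is the mean of [e^(it)] and [e^(-it)], the new modes are combinations of old ones
    with indices [k] and [k] plus or minus [1]. *)
Lemma vanishing_modes_cos (F : R -> C) : (forall t, continuous F t) ->
  vanishing_modes F -> vanishing_modes (fun t => RtoC (1 - cos t) * F t)%C.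
Proof.
intros HF H k.
assert (S : forall j t, continuous (fun t => F t * fourier_char j t)%C t)
  by (intros; apply continuous_Cmult; [apply HF|apply continuous_fourier_char]).
assert (Ec : forall t, RtoC (1 - cos t) =
  (RtoC 1 + RtoC (- (1 / 2)) * (fourier_char 1 t + fourier_char (-1) t))%C).
{ intros t; unfold fourier_char, cis, RtoC, Cmult, Cplus; simpl.
  replace (- (1) * t) with (- t) by ring; replace (- -1 * t) with t by ring.
  rewrite cos_neg, sin_neg; f_equal; field. }
rewrite (CInt_ext _ (fun t => F t * fourier_char k t + RtoC (- (1 / 2)) *
  (F t * fourier_char (1 + k) t + F t * fourier_char (-1 + k) t))%C).
- set (f2 := fun t => (F t * fourier_char (1 + k) t + F t * fourier_char (-1 + k) t)%C).
  assert (S2 : forall t, continuous f2 t)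
    by exact (fun t => continuous_Cplus _ _ t (S (1 + k)%Z t) (S (-1 + k)%Z t)).
  assert (E2 : CInt f2 0 (2 * PI) = RtoC 0).
  { unfold f2; rewrite (CInt_plus _ _ 0 (2 * PI) (S (1 + k)%Z) (S (-1 + k)%Z)), !H; C_ring. }
  change (CInt (fun t => F t * fourier_char k t + RtoC (- (1 / 2)) * f2 t)%C 0 (2 * PI) = RtoC 0).
  rewrite CInt_plus, (CInt_scal _ f2 0 (2 * PI) S2), H, E2; [C_ring|exact (S k)|].
  intros t; apply continuous_Cmult; [apply continuous_const|apply S2].
- intros t; rewrite Ec, <- !fourier_char_mult; ring.
Qed.

Lemma vanishing_modes_pow (F : R -> C) (n : nat) : (forall t, continuous F t) ->
  vanishing_modes F -> CInt (fun t => RtoC ((1 - cos t) ^ n) * F t)%C 0 (2 * PI) = RtoC 0.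
Proof.
intros HF H.
assert (Hn : (forall t, continuous (fun t => RtoC ((1 - cos t) ^ n) * F t)%C t) /\
  vanishing_modes (fun t => RtoC ((1 - cos t) ^ n) * F t)%C).
{ induction n as [|n [IHc IHv]].
  - split.
    + intros t; specialize (HF t); continuity_tac.
    + intros k; rewrite <- (H k); apply CInt_ext; intros t; simpl; ring.
  - split.
    + intros t; specialize (HF t); continuity_tac.
    + assert (V := vanishing_modes_cos _ IHc IHv); intros k; rewrite <- (V k).
      apply CInt_ext; intros t; simpl; rewrite RtoC_mult; ring. }
destruct Hn as [_ Hn]; rewrite <- (Hn 0%Z); apply CInt_ext; intros t.
unfold fourier_char; rewrite Ropp_0, Rmult_0_l, cis_0; ring.
Qed.

Lemma cos_far_from_PI (d t : R) : 0 < d < PI -> 0 <= t <= 2 * PI -> d <= Rabs (t - PI) ->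
  - cos d <= cos t.
Proof.
intros Hd Ht Ha; assert (E : - cos d = cos (PI - d)).
{ rewrite cos_minus, cos_PI, sin_PI; ring. }
rewrite E; destruct (Rle_dec t PI) as [H|H].
- rewrite Rabs_left1 in Ha by lra; apply cos_decr_1; lra.
- rewrite Rabs_pos_eq in Ha by lra.
  replace (cos t) with (cos (2 * PI - t)).
  + apply cos_decr_1; lra.
  + rewrite cos_minus, cos_2PI, sin_2PI; ring.
Qed.

(* The kernels [(1 - cos t)^n] concentrate at [t = PI]: they are at most [b^n] away from it and
   at least [b'^n] close to it, with [b < b']. *)
Lemma vanishing_modes_Re_le_0 (F : R -> C) : (forall t, continuous F t) ->
  vanishing_modes F -> Re (F PI) <= 0.
Proof.
intros HF Hv; apply Rnot_lt_le; intros Hpos; assert (Hpi := PI_RGT_0); assert (Hpi2 := PI2_1).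
set (c := Re (F PI) / 2).
assert (Hc : 0 < c) by (unfold c; lra).
assert (HR : forall t, continuous (fun t => Re (F t)) t) by (intros; now apply continuous_Re).
destruct (HR PI _ (locally_ball (Re (F PI)) (mkposreal c Hc))) as [d0 Hd0].
assert (Hd : 0 < Rmin d0 1) by (apply Rmin_pos; [apply cond_pos|lra]).
set (d := Rmin d0 1) in *.
assert (Hd1 : d <= 1) by apply Rmin_r.
assert (Hnear : forall t, Rabs (t - PI) < d -> c <= Re (F t)).
{ intros t Ht.
  assert (H : ball PI d0 t) by (apply Rlt_le_trans with (1 := Ht), Rmin_l).
  assert (H1 := Hd0 t H); apply Rabs_lt_between' in H1; simpl in H1; unfold c in H1 |- *; lra. }
destruct (continuous_bounded F 0 (2 * PI)) as [M HM]; [lra|exact HF|].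
(* These are the values of [1 - cos t] at distance [d] and [d / 2] from [PI], where it is
   largest. *)
set (b := 1 + cos d); set (b' := 1 + cos (d / 2)).
assert (Hbb : 1 < b < b').
{ assert (cos d < cos (d / 2)) by (apply cos_decreasing_1; lra).
  assert (0 < cos d) by (apply cos_gt_0; lra).
  unfold b, b'; lra. }
assert (HM0 : 0 <= M) by (apply Rle_trans with (2 := HM 0 ltac:(lra)), Cmod_ge_0).
assert (Hk0 : forall t, 0 <= 1 - cos t) by (intros t; assert (H := COS_bound t); lra).
assert (Hkc : forall n t, continuous (fun t => (1 - cos t) ^ n) t)
  by (intros; continuity_tac).
assert (Hmain : forall n, c * RInt (fun t => (1 - cos t) ^ n) 0 (2 * PI) <=
  2 * PI * ((c + M) * b ^ n)).
{ intros n; assert (H0 := vanishing_modes_pow F n HF Hv).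
  assert (Hcont : forall t, continuous (fun t => RtoC ((1 - cos t) ^ n) * F t)%C t).
  { intros t; specialize (HF t); continuity_tac. }
  rewrite CInt_pair in H0 by exact Hcont.
  assert (HRe : RInt (fun t => Re (RtoC ((1 - cos t) ^ n) * F t)%C) 0 (2 * PI) = 0)
    by exact (f_equal fst H0).
  (* The pointwise bound holds near [PI] because [Re F >= c], and elsewhere because [Re F >= - M]
     and the kernel is at most [b^n]. *)
  assert (Hle : RInt (fun t => c * (1 - cos t) ^ n - (c + M) * b ^ n) 0 (2 * PI) <=
    RInt (fun t => Re (RtoC ((1 - cos t) ^ n) * F t)%C) 0 (2 * PI)).
  { apply RInt_le; [lra| | |].
    - apply ex_RInt_continuous_R; intros t; specialize (Hkc n t); continuity_tac.
    - apply ex_RInt_continuous_R; intros t; now apply continuous_Re.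
    - intros t Ht; rewrite re_scal_l.
      assert (Hkn : 0 <= (1 - cos t) ^ n) by now apply pow_le.
      assert (Hbn : 0 <= (c + M) * b ^ n) by (apply Rmult_le_pos; [lra|apply pow_le; lra]).
      destruct (Rlt_dec (Rabs (t - PI)) d) as [Hn|Hn].
      + assert (H1 := Rmult_le_compat_r _ _ _ Hkn (Hnear t Hn)); lra.
      + assert (Hcos := cos_far_from_PI d t ltac:(lra) ltac:(lra) ltac:(lra)).
        assert (Hkb : (1 - cos t) ^ n <= b ^ n) by (apply pow_incr; unfold b; split; [apply Hk0|lra]).
        assert (HF1 : - M <= Re (F t)).
        { assert (H1 := re_le_Cmod (F t)); assert (H2 := HM t ltac:(lra)).
          apply Rabs_le_between in H1; lra. }
        assert (H1 := Rmult_le_compat_r _ _ _ Hkn HF1).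
        assert (H2 : (c + M) * (1 - cos t) ^ n <= (c + M) * b ^ n)
          by (apply Rmult_le_compat_l; lra).
        lra. }
  rewrite HRe in Hle.
  replace (RInt _ 0 (2 * PI)) with
    (c * RInt (fun t => (1 - cos t) ^ n) 0 (2 * PI) - 2 * PI * ((c + M) * b ^ n)) in Hle; [lra|].
  symmetry; apply is_RInt_unique.
  apply (is_RInt_minus (V := R_NormedModule) (fun t => c * (1 - cos t) ^ n)).
  - apply (is_RInt_scal (V := R_NormedModule)).
    apply (RInt_correct (V := R_CompleteNormedModule)), ex_RInt_continuous_R; auto.
  - evar_last; [apply (is_RInt_const (V := R_NormedModule))|].
    unfold scal; simpl; unfold mult; simpl; ring. }
assert (Hlow : forall n, d * b' ^ n <= RInt (fun t => (1 - cos t) ^ n) 0 (2 * PI)).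
{ intros n.
  assert (Hex : forall x y, ex_RInt (fun t => (1 - cos t) ^ n) x y)
    by (intros; now apply ex_RInt_continuous_R).
  rewrite <- (RInt_Chasles (V := R_CompleteNormedModule) _ 0 (PI - d / 2) (2 * PI)) by apply Hex.
  rewrite <- (RInt_Chasles (V := R_CompleteNormedModule) _ (PI - d / 2) (PI + d / 2) (2 * PI))
    by apply Hex.
  assert (H1 : 0 <= RInt (fun t => (1 - cos t) ^ n) 0 (PI - d / 2)).
  { apply RInt_ge_0; [lra|apply Hex|intros; now apply pow_le]. }
  assert (H2 : 0 <= RInt (fun t => (1 - cos t) ^ n) (PI + d / 2) (2 * PI)).
  { apply RInt_ge_0; [lra|apply Hex|intros; now apply pow_le]. }
  assert (H3 : RInt (fun _ => b' ^ n) (PI - d / 2) (PI + d / 2) <=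
    RInt (fun t => (1 - cos t) ^ n) (PI - d / 2) (PI + d / 2)).
  { apply RInt_le; [lra| |apply Hex|].
    - apply ex_RInt_continuous_R; intros; apply continuous_const.
    - intros t Ht; apply pow_incr; split; [lra|].
      replace (cos t) with (- cos (t - PI)) by (rewrite cos_minus, cos_PI, sin_PI; ring).
      assert (cos (d / 2) <= cos (t - PI)); [|unfold b'; lra].
      replace (cos (t - PI)) with (cos (Rabs (t - PI)))
        by (unfold Rabs; destruct (Rcase_abs (t - PI)); [apply cos_neg|reflexivity]).
      apply cos_decr_1; try lra; try apply Rabs_pos.
      + apply Rle_trans with (d / 2); [apply Rabs_le|]; lra.
      + apply Rabs_le; lra. }
  rewrite RInt_const in H3; unfold scal in H3; simpl in H3; unfold mult in H3; simpl in H3.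
  unfold plus; simpl.
  replace (PI + d / 2 - (PI - d / 2)) with d in H3 by field; lra. }
set (x := b' / b - 1).
assert (Hx : 0 < x) by (unfold x; assert (1 < b' / b) by (apply Rlt_div_r; lra); lra).
(* The two estimates bound [(b' / b)^n] uniformly in [n], while by Bernoulli's inequality it grows
   at least linearly. *)
assert (Hbound : forall n, 1 + INR n * x <= 2 * PI * (c + M) / (c * d)).
{ intros n; apply Rle_trans with ((1 + x) ^ n); [now apply poly|].
  replace (1 + x) with (b' / b) by (unfold x; ring).
  assert (Hbn : 0 < b ^ n) by (apply pow_lt; lra).
  unfold Rdiv at 1; rewrite Rpow_mult_distr, pow_inv.
  assert (Hcd : 0 < c * d) by now apply Rmult_lt_0_compat.
  apply Rmult_le_reg_r with (b ^ n * (c * d)); [now apply Rmult_lt_0_compat|].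
  replace (b' ^ n * / b ^ n * (b ^ n * (c * d))) with (c * (d * b' ^ n)) by (field; lra).
  replace (2 * PI * (c + M) / (c * d) * (b ^ n * (c * d))) with (2 * PI * ((c + M) * b ^ n))
    by (field; lra).
  apply Rle_trans with (2 := Hmain n), Rmult_le_compat_l; [lra|apply Hlow]. }
set (Y := 2 * PI * (c + M) / (c * d)) in *.
assert (HY : 0 <= Y / x).
{ apply Rmult_le_pos; [|apply Rlt_le, Rinv_0_lt_compat, Hx].
  specialize (Hbound 0%nat); simpl in Hbound; lra. }
destruct (nfloor_ex (Y / x) HY) as [n Hn]; specialize (Hbound (S n)).
rewrite S_INR in Hbound.
assert (H : Y < (INR n + 1) * x) by (apply -> Rlt_div_l; lra).
lra.
Qed.

(** A translation moves [t0] to [PI]; multiplication by the conjugate of [F t0] turns the sign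
    statement there into [|F t0|^2 <= 0]. *)
Lemma vanishing_modes_zero (F : R -> C) (t0 : R) : (forall t, continuous F t) ->
  (forall t, F (t + 2 * PI) = F t) -> vanishing_modes F -> F t0 = RtoC 0.
Proof.
intros HF Hp Hv.
set (G := fun t => F (t + (t0 - PI))).
assert (HG : forall t, continuous G t).
{ intros t; apply (continuous_comp (fun t => t + (t0 - PI)) F); [continuity_tac|apply HF]. }
assert (HvG : vanishing_modes G).
{ intros k; set (u := t0 - PI).
  rewrite (CInt_ext _ (fun t => cis (IZR k * u) * (F (t + u)%R * fourier_char k (t + u)))%C).
  - rewrite CInt_scal.
    + rewrite (CInt_periodic (fun t => F t * fourier_char k t)%C), Hv; [C_ring| |].
      * intros t; apply continuous_Cmult; [apply HF|apply continuous_fourier_char].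
      * intros t; now rewrite Hp, fourier_char_periodic.
    + intros t; apply continuous_Cmult; [apply HG|].
      apply (continuous_comp (fun t => t + u) (fourier_char k)); [continuity_tac|].
      apply continuous_fourier_char.
  - intros t; unfold G; fold u; unfold fourier_char.
    replace (- IZR k * t) with (IZR k * u + - IZR k * (t + u)) by ring.
    rewrite cis_plus; ring. }
assert (E : G PI = F t0) by (unfold G; f_equal; ring).
assert (H := vanishing_modes_Re_le_0 _
  (fun t => continuous_Cmult _ G t (continuous_const (Cconj (G PI)) t) (HG t))
  (vanishing_modes_scal (Cconj (G PI)) G HG HvG)).
rewrite <- E; apply Cmod_eq_0.
assert (H1 := Cmod2_alt (G PI)); assert (H2 := Cmod_ge_0 (G PI)).
simpl in H; unfold Re, Im in H1; nra.
Qed.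

Lemma harmonic_unique (lambda : C) (h h' g : C -> C) :
  ~ (Im lambda = 0 /\ Re lambda < - (1 / 4)) -> continuous_on_circle g ->
  lambda_harmonic lambda h -> has_boundary_values lambda h g ->
  lambda_harmonic lambda h' -> has_boundary_values lambda h' g ->
  forall z, in_disk z -> h z = h' z.
Proof.
intros Hl Hg Hh Hb Hh' Hb' z Hz.
assert (C1 := proj1 (proj1 Hh)); assert (C1' := proj1 (proj1 Hh')).
assert (Hpol : forall r t, 0 < r < 1 -> h (polar r t) = h' (polar r t)).
{ intros r t Hr; assert (Hr' : -1 < r < 1) by lra.
  assert (S := fun t => continuous_polar h r t C1 Hr').
  assert (S' := fun t => continuous_polar h' r t C1' Hr').
  assert (H : (h (polar r t) - h' (polar r t))%C = RtoC 0).
  { apply (vanishing_modes_zero (fun t => h (polar r t) - h' (polar r t))%C).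
    - intros s; apply continuous_Cminus; [apply S|apply S'].
    - intros s; rewrite !polar_mult, cis_2PI_plus; reflexivity.
    - intros k; rewrite (CInt_ext _ (fun t => h (polar r t) * fourier_char k t
        - h' (polar r t) * fourier_char k t)%C) by (intros; ring).
      rewrite CInt_minus.
      + fold (mode h k r) (mode h' k r).
        rewrite (modes_eq lambda h h' g k r Hl Hg Hh Hb Hh' Hb' Hr); C_ring.
      + intros s; apply continuous_Cmult; [apply S|apply continuous_fourier_char].
      + intros s; apply continuous_Cmult; [apply S'|apply continuous_fourier_char]. }
  transitivity ((h (polar r t) - h' (polar r t)) + h' (polar r t))%C; [ring|rewrite H; ring]. }
destruct (Ceq_dec z (RtoC 0)) as [->|Hz0].
(* The modes were compared for [0 < r < 1] only; the origin is reached by continuity along a ray. *)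
- assert (Hray : forall f, C1_on_disk f -> filterlim (fun r => f (polar r 0)) (at_right 0)
    (locally (f (RtoC 0)))).
  { intros f Hf.
    assert (E0 : polar 0 0 = RtoC 0) by (unfold polar, RtoC; f_equal; ring).
    rewrite <- E0; eapply filterlim_filter_le_1; [apply filter_le_within|].
    assert (H : continuous (fun r => polar r 0) 0) by (unfold polar; continuity_tac).
    apply (continuous_comp (fun r => polar r 0) f); [exact H|].
    apply C1_continuous; [exact Hf|apply in_disk_polar_abs; lra]. }
  apply (filterlim_locally_unique (F := at_right 0) (fun r => h (polar r 0))).
  + now apply Hray.
  + apply filterlim_ext_loc with (2 := Hray h' C1').
    exists (mkposreal 1 Rlt_0_1); intros r Hr Hr0; symmetry; apply Hpol.
    apply Rabs_lt_between' in Hr; simpl in Hr; lra.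
- destruct (polar_form z) as [t Ht]; rewrite Ht, <- polar_mult; apply Hpol.
  split; [now apply Cmod_gt_0|exact Hz].
Qed.

Theorem theorem5p1 (lambda : C) (g : C -> C)
  (Hlambda : ~ (Im lambda = 0 /\ Re lambda < - (1 / 4)))
  (Hg : continuous_on_circle g) :
  (lambda_harmonic lambda (Poisson_transform lambda g) /\
   has_boundary_values lambda (Poisson_transform lambda g) g) /\
  (forall h : C -> C,
     lambda_harmonic lambda h -> has_boundary_values lambda h g ->
     forall z : C, in_disk z -> h z = Poisson_transform lambda g z).
Proof.
assert (Hh := Poisson_transform_harmonic lambda g Hg).
assert (Hb := Poisson_transform_boundary lambda g Hlambda Hg).
split; [now split|].
intros h Hh' Hb' z Hz; now apply (harmonic_unique lambda h _ g).
Qed.
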